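(* Let $k$ be a field, $r\ge1$ an integer, and $B=k\langle x,y\rangle/(y^{r+1})$ with $\deg x=\deg y=1$. Let $\alpha$ be the unique positive root of $x^{r+1}-x^r-\cdots-x-1$. (1) There is an injective group homomorphism $K_0(\mathsf{qgr}\,B)\to\mathbb{R}$ given by $[\mathcal{O}]\mapsto1$ and $[\mathcal{O}(n)]\mapsto\alpha^n$ (for $n\in\mathbb{Z}$) that maps $K_0(\mathsf{qgr}\,B)$ isomorphically onto $\mathbb{Z}[\alpha]$. (2) The image of the positive cone in $K_0(\mathsf{qgr}\,B)$ under the homomorphism in (1) is $\mathbb{R}_{\ge0}\cap\mathbb{Z}[\alpha]=\mathbb{Z}[\alpha^{-1}]\cap\mathbb{R}_{\ge0}$.
   Context: $\mathsf{gr}\,B$ is the abelian category of finitely presented $\mathbb{Z}$-graded left $B$-modules (degree-preserving maps), $\mathsf{fdim}\,B$ its Serre subcategory of finite dimensional modules, and $\mathsf{qgr}\,B:=\mathsf{gr}\,B/\mathsf{fdim}\,B$. $\mathcal{O}$ is the image of the left module $B$ in $\mathsf{qgr}\,B$. For a graded module $M$, $M(n)$ is $M$ with grading $M(n)_i=M_{n+i}$, and $\mathcal{F}\mapsto\mathcal{F}(n)$ is the induced twist on $\mathsf{qgr}\,B$. $K_0(\mathsf{qgr}\,B)$ is the Grothendieck group of this abelian category; its positive cone is $\{[\mathcal{F}] : \mathcal{F}\in\mathsf{qgr}\,B\}$ (which includes $0$). *)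

(* Defs.v *)
From HB Require Import structures.
From mathcomp Require Import all_boot all_order all_algebra.
From mathcomp Require Import boolp classical_sets reals.
From mathcomp Require Import finmap monalg.

Set Implicit Arguments.
Unset Strict Implicit.
Unset Printing Implicit Defensive.

Import Order.TTheory GRing.Theory Num.Theory.
Local Open Scope quotient_scope.
Local Open Scope classical_set_scope.
Local Open Scope ring_scope.

(* A Z-grading V = (+)_i V_i is given by the projections [c i] of V onto V_i. *)
Record is_grading (V : zmodType) (c : int -> V -> V) : Prop := IsGrading {
  grading_add : forall i, {morph c i : x y / x + y};
  grading_proj : forall i j x, c i (c j x) = if i == j then c j x else 0;
  grading_sum : forall x, exists2 s : seq int, uniq s & x = \sum_(i <- s) c i x
}.

Record gradedAlg (k : fieldType) := GradedAlg {
  galg :> algType k;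
  acomp : int -> galg -> galg;
  acompP : is_grading acomp;
  acompZ : forall i (c : k) x, acomp i (c *: x) = c *: acomp i x;
  acomp1 : acomp 0 1 = 1;
  acompM : forall i j x y,
    acomp (i + j) (acomp i x * acomp j y) = acomp i x * acomp j y
}.

Record gradedMod (k : fieldType) (A : gradedAlg k) := GradedMod {
  gmod :> lmodType A;
  comp : int -> gmod -> gmod;
  compP : is_grading comp;
  compM : forall i j (a : A) x,
    comp (i + j) (acomp i a *: comp j x) = acomp i a *: comp j x
}.
Arguments comp {k A M} : rename.

Section GradedModules.
Variables (k : fieldType) (A : gradedAlg k).
Implicit Types M N P : gradedMod A.

(* (n; d; rels) stands for n generators, the i-th one of degree d_i, subject to
   the relations \sum_i rho_i g_i = 0 for rho in rels. *)
Definition presentation : choiceType :=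
  {n : nat & (n.-tuple int * seq 'rV[A]_n)%type}.

Definition presents (M : gradedMod A) (p : presentation) : Prop :=
  let: existT n (d, rels) := p in
  exists g : 'I_n -> M,
  [/\ forall i, comp (tnth d i) (g i) = g i,
      forall x, exists u : 'rV[A]_n, x = \sum_i u 0 i *: g i,
      forall rho, rho \in rels ->
        exists e : int, forall i, acomp (e - tnth d i) (rho 0 i) = rho 0 i
    & forall u : 'rV[A]_n, \sum_i u 0 i *: g i = 0 <->
        exists c : 'I_(size rels) -> A, u = \sum_j c j *: rels`_j].

Definition fin_presented M : Prop := exists p, presents M p.

(* dim_k U / (U :&: V) < oo, for k-subspaces U and V of M *)
Definition fin_codim M (U V : set M) : Prop :=
  exists e : seq M, forall x, U x ->
  exists c : nat -> k, V (x - \sum_(j < size e) (c j)%:A *: e`_j).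

Definition cofinite M (U : set M) : Prop := fin_codim setT U.
Definition finite_dim M (U : set M) : Prop := fin_codim U [set 0].

Definition graded_submod M (U : set M) : Prop :=
  [/\ U 0, forall a x y, U x -> U y -> U (a *: x + y)
    & forall i x, U x -> U (comp i x)].

(* Following Gabriel, a morphism M -> N of the quotient category is an element of
   the direct limit of the groups Hom(M', N / N') over the graded submodules M'
   of M and N' of N such that M / M' and N' are finite dimensional.  (When A is
   finitely generated and graded coherent, and M, N are finitely presented, such
   M' and N / N' are finitely presented.)  A degree-preserving linear map
   f : M' -> N / N' is encoded by the graded submodule
   { (u, v) | u in M', v in f u } of M (+) N; so M' is the domain of the relation
   and N' is the set of values at 0. *)
Record qhom M N := QHom {
  qrel : M -> N -> Prop;
  qrel0 : qrel 0 0;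
  qrel_lin : forall a u u' v v',
    qrel u v -> qrel u' v' -> qrel (a *: u + u') (a *: v + v');
  qrel_comp : forall i u v, qrel u v -> qrel (comp i u) (comp i v);
  qrel_dom : cofinite [set u | exists v, qrel u v];
  qrel_indet : finite_dim [set v | qrel 0 v]
}.

(* Equality in the direct limit: f and g induce the same map D -> N / E for some
   D contained in both domains and some E (which then contains the values of f
   and g at 0). *)
Definition qeq M N (f g : qhom M N) : Prop :=
  exists (D : set M) (E : set N),
  [/\ graded_submod D, cofinite D, graded_submod E, finite_dim E &
      forall u, D u ->
      [/\ exists v, qrel f u v, exists v, qrel g u v
        & forall v w, qrel f u v -> qrel g u w -> E (v - w)]].

Lemma fin_codim_param M n (D W : set M) (rho : M -> (nat -> k) -> Prop) :
    (forall x, D x -> exists c, rho x c) ->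
    (forall a x x' c c', rho x c -> rho x' c' ->
       rho (a%:A *: x + x') (fun i => a * c i + c' i)) ->
    (forall x c, rho x c -> forall i, (n <= i)%N -> c i = 0) ->
    (forall x c, rho x c -> (forall i, c i = 0) -> W x) ->
  fin_codim D W.
Proof.
elim: n D rho => [|n IHn] D rho rhoD rhoL rho_n rho0.
  exists [::] => x /rhoD[c xc]; exists (fun=> 0).
  rewrite big_ord0 subr0; apply: (rho0 _ _ xc) => i; exact: rho_n xc _ _.
pose rho' x c := rho x c /\ c n = 0.
have [e eP] : fin_codim [set x | exists c, rho' x c] W.
  apply: (IHn _ rho') => //.
  - move=> a x x' c c' [xc cn] [x'c' c'n]; split; first exact: rhoL.
    by rewrite cn c'n mulr0 addr0.
  - move=> x c [xc cn] i; rewrite leq_eqVlt => /predU1P[<- //|].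
    exact: rho_n xc i.
  - by move=> x c [xc _]; exact: rho0 xc.
have [[x0 [c0 [x0c0 /eqP c0N0]]]|noc] :=
    pselect (exists x0, exists c0, rho x0 c0 /\ c0 n <> 0); last first.
  exists e => x /rhoD[c xc]; apply: eP; exists c; split=> //.
  by apply/eqP/negPn/negP => /eqP cN0; apply: noc; exists x, c.
exists (x0 :: e) => x /rhoD[c xc].
pose a := c n / c0 n.
have /eP[b bP] : [set x | exists c, rho' x c] (x - a%:A *: x0).
  exists (fun i => - a * c0 i + c i); split; last first.
    by rewrite mulNr divfK // addNr.
  by have := rhoL (- a) _ _ _ _ x0c0 xc; rewrite scaleNr scaleNr addrC.
exists (fun i => if i is j.+1 then b j else a).
by rewrite big_ord_recl /= opprD addrA.
Qed.

Lemma fin_codim_trans M (U V W : set M) :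
  fin_codim U V -> fin_codim V W -> fin_codim U W.
Proof.
move=> [e eP] [d dP]; exists (e ++ d) => x /eP[c /dP[b bP]].
exists (fun i => if (i < size e)%N then c i else b (i - size e)%N).
rewrite size_cat big_split_ord /= opprD addrA.
rewrite (eq_bigr (fun j : 'I__ => (c j)%:A *: e`_j)); last first.
  by move=> j _; rewrite ltn_ord nth_cat ltn_ord.
rewrite [X in _ - _ - X](eq_bigr (fun j : 'I__ => (b j)%:A *: d`_j)) // => j _.
by rewrite nth_cat !ltnNge leq_addr /= addKn.
Qed.

Lemma qcomp_dom M N P (g : qhom N P) (f : qhom M N) :
  cofinite [set u | exists w, exists2 v, qrel f u v & qrel g v w].
Proof.
apply: fin_codim_trans (qrel_dom f) _; have [e eP] := qrel_dom g.
pose rho (x : M) (c : nat -> k) := (forall i, (size e <= i)%N -> c i = 0) /\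
  exists2 v, qrel f x v
           & exists w, qrel g (v - \sum_(j < size e) (c j)%:A *: e`_j) w.
apply: (@fin_codim_param M (size e) _ _ rho).
- move=> x [v xv]; have [c [w cw]] := eP v I.
  exists (fun i => if (i < size e)%N then c i else 0); split.
    by move=> i ei; rewrite ltnNge ei.
  exists v => //; exists w.
  rewrite (eq_bigr (fun j : 'I__ => (c j)%:A *: e`_j)) // => j _.
  by rewrite ltn_ord.
- move=> a x x' c c' [c0 [v xv [w vw]]] [c'0 [v' xv' [w' vw']]].
  split; first by move=> i ei; rewrite c0 // c'0 // mulr0 addr0.
  exists (a%:A *: v + v'); first exact: qrel_lin.
  exists (a%:A *: w + w').
  rewrite (_ : _ - _ = a%:A *: (v - \sum_(j < size e) (c j)%:A *: e`_j) +
                       (v' - \sum_(j < size e) (c' j)%:A *: e`_j)).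
    exact: qrel_lin.
  rewrite scalerBr scaler_sumr addrACA -opprD -big_split /=; congr (_ - _).
  apply: eq_bigr => j _.
  by rewrite 2!scalerDl scalerA -scalerAl mul1r scalerA.
- by move=> x c [].
- move=> x c [_ [v xv [w vw]]] ci0; exists w; exists v => //.
  by rewrite big1 ?subr0 // in vw => j _; rewrite ci0 !scale0r.
Qed.

Lemma qcomp_indet M N P (g : qhom N P) (f : qhom M N) :
  finite_dim [set w | exists2 v, qrel f 0 v & qrel g v w].
Proof.
apply: fin_codim_trans (qrel_indet g); have [e eP] := qrel_indet f.
pose rho (x : P) (c : nat -> k) := (forall i, (size e <= i)%N -> c i = 0) /\
  exists2 v, v = \sum_(j < size e) (c j)%:A *: e`_j & qrel g v x.
apply: (@fin_codim_param P (size e) _ _ rho).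
- move=> x [v /eP[c] /subr0_eq vE vx].
  exists (fun i => if (i < size e)%N then c i else 0); split.
    by move=> i ei; rewrite ltnNge ei.
  exists v => //; rewrite vE; apply: eq_bigr => j _.
  by rewrite ltn_ord.
- move=> a x x' c c' [c0 [v vE vx]] [c'0 [v' v'E v'x']].
  split; first by move=> i ei; rewrite c0 // c'0 // mulr0 addr0.
  exists (a%:A *: v + v'); last exact: qrel_lin.
  rewrite vE v'E scaler_sumr -big_split /=.
  apply: eq_bigr => j _.
  by rewrite 2!scalerDl scalerA -scalerAl mul1r scalerA.
- by move=> x c [].
- move=> x c [_ [v vE vx]] ci0.
  by rewrite big1 // in vE => [|j _]; rewrite ?ci0 ?scale0r //; rewrite vE in vx.
Qed.

Lemma qcomp_lin M N P (g : qhom N P) (f : qhom M N) a u u' w w' :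
    (exists2 v, qrel f u v & qrel g v w) ->
    (exists2 v, qrel f u' v & qrel g v w') ->
  exists2 v, qrel f (a *: u + u') v & qrel g v (a *: w + w').
Proof.
by move=> [v uv vw] [v' uv' vw']; exists (a *: v + v'); exact: qrel_lin.
Qed.

Lemma qcomp_comp M N P (g : qhom N P) (f : qhom M N) i u w :
    (exists2 v, qrel f u v & qrel g v w) ->
  exists2 v, qrel f (comp i u) v & qrel g v (comp i w).
Proof. by move=> [v uv vw]; exists (comp i v); exact: qrel_comp. Qed.

Definition qcomp M N P (g : qhom N P) (f : qhom M N) : qhom M P :=
  @QHom M P (fun u w => exists2 v, qrel f u v & qrel g v w)
    (ex_intro2 _ _ 0 (qrel0 f) (qrel0 g)) (@qcomp_lin M N P g f)
    (@qcomp_comp M N P g f) (qcomp_dom g f) (qcomp_indet g f).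

Lemma comp0 M i : comp i (0 : M) = 0.
Proof.
by apply: (@addrI _ (comp i (0 : M))); rewrite -(grading_add (compP M)) !addr0.
Qed.

Lemma qzero_lin M N a (u u' : M) (v v' : N) :
  v = 0 -> v' = 0 -> a *: v + v' = 0.
Proof. by move=> -> ->; rewrite scaler0 addr0. Qed.

Lemma qzero_comp M N i (u : M) (v : N) : v = 0 -> comp i v = 0.
Proof. by move=> ->; rewrite comp0. Qed.

Lemma qzero_dom M N : cofinite [set u : M | exists v : N, v = 0].
Proof. by exists [::] => x _; exists (fun=> 0); exists 0. Qed.

Lemma qzero_indet M N : finite_dim [set v : N | v = 0].
Proof.
by exists [::] => x ->; exists (fun=> 0); rewrite big_ord0 subr0.
Qed.

Definition qzero M N : qhom M N :=
  @QHom M N (fun _ v => v = 0) erefl (@qzero_lin M N) (@qzero_comp M N)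
    (qzero_dom M N) (qzero_indet M N).

Record qgr := QGr {
  qgr_mod :> gradedMod A;
  qgr_fp : fin_presented qgr_mod
}.

Definition is_kernel (X Y Z : qgr) (f : qhom X Y) (g : qhom Y Z) : Prop :=
  qeq (qcomp g f) (qzero X Z) /\
  forall (W : qgr) (h : qhom W Y), qeq (qcomp g h) (qzero W Z) ->
  exists u : qhom W X,
    qeq (qcomp f u) h /\ forall u', qeq (qcomp f u') h -> qeq u' u.

Definition is_cokernel (X Y Z : qgr) (f : qhom X Y) (g : qhom Y Z) : Prop :=
  qeq (qcomp g f) (qzero X Z) /\
  forall (W : qgr) (h : qhom Y W), qeq (qcomp h f) (qzero X W) ->
  exists u : qhom Z W,
    qeq (qcomp u g) h /\ forall u', qeq (qcomp u' g) h -> qeq u' u.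

Definition short_exact (X Y Z : qgr) (f : qhom X Y) (g : qhom Y Z) : Prop :=
  is_kernel f g /\ is_cokernel f g.

(* The objects of the category are too large to index a zmodType, so the free
   abelian group is taken on the presentations of objects: a presentation
   determines the module up to isomorphism, hence its class. *)
Definition K0_index : choiceType :=
  {p : presentation | `[< exists M : gradedMod A, presents M p >]}.

Definition K0_relation (a : {malg int[K0_index]}) : Prop :=
  exists (X Y Z : qgr) (f : qhom X Y) (g : qhom Y Z) (p q s : K0_index),
  [/\ short_exact f g,
      [/\ presents X (val p), presents Y (val q) & presents Z (val s)]
    & a = << q >> - (<< p >> + << s >>)].

Definition K0_null : {pred {malg int[K0_index]}} :=
  fun a => `[< forall S : zmodClosed {malg int[K0_index]},
                 (forall b, K0_relation b -> b \in S) -> a \in S >].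

Lemma K0_null_zmod : zmod_closed K0_null.
Proof.
split=> [|a b /asboolP aN /asboolP bN]; apply/asboolP => S SP.
  exact: rpred0.
by apply: rpredB; [exact: aN | exact: bN].
Qed.

HB.instance Definition _ :=
  GRing.isZmodClosed.Build {malg int[K0_index]} K0_null K0_null_zmod.

Definition K0 : zmodType := Quotient.quot K0_null.

Lemma qgr_index (X : qgr) : {p : K0_index | presents X (val p)}.
Proof.
have [p Xp] := cid (qgr_fp X).
have pP : `[< exists M : gradedMod A, presents M p >].
  by apply/asboolP; exists X.
by exists (exist _ p pP).
Qed.

Definition K0_class (X : qgr) : K0 := \pi_K0 << sval (qgr_index X) >>.

Lemma K0_class_exact (X Y Z : qgr) (f : qhom X Y) (g : qhom Y Z) :
  short_exact f g -> K0_class Y = K0_class X + K0_class Z.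
Proof.
move=> fg; rewrite /K0_class -raddfD; apply/eqP.
rewrite -Quotient.idealrBE; apply/asboolP => S; apply.
exists X, Y, Z, f, g, (sval (qgr_index X)), (sval (qgr_index Y)),
  (sval (qgr_index Z)); split=> //.
by split; exact: svalP (qgr_index _).
Qed.

Definition positive_cone : set K0 := [set a | exists X : qgr, a = K0_class X].

Section Twist.
Variables (M : gradedMod A) (n : int).

Definition twist_comp (i : int) (x : M) : M := comp (n + i) x.

Lemma twist_compP : is_grading twist_comp.
Proof.
split=> [i x y|i j x|x]; rewrite /twist_comp.
- exact: grading_add (compP M) _ _ _.
- rewrite (grading_proj (compP M)).
  by rewrite (inj_eq (addrI n)).
- have [s s_uniq {1}->] := grading_sum (compP M) x.
  exists [seq i - n | i <- s]; first by rewrite map_inj_uniq //; exact: addIr.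
  by rewrite big_map; apply: eq_bigr => i _; rewrite addrC subrK.
Qed.

Lemma twist_compM i j (a : A) (x : M) :
  twist_comp (i + j) (acomp i a *: twist_comp j x) = acomp i a *: twist_comp j x.
Proof. by rewrite /twist_comp addrCA compM. Qed.

Definition gtwist : gradedMod A := GradedMod twist_compP twist_compM.

Lemma gtwist_fp : fin_presented M -> fin_presented gtwist.
Proof.
move=> [[m [d rels]]] [g [gd gM rd relM]].
exists (existT _ m ([tuple tnth d i - n | i < m], rels)), g; split=> //.
- by move=> i; rewrite tnth_mktuple /= /twist_comp addrC subrK.
- move=> rho /rd[e eP]; exists (e - n) => i.
  by rewrite tnth_mktuple opprB addrA subrK.
Qed.

End Twist.

Definition twist (X : qgr) (n : int) : qgr := QGr (gtwist_fp n (qgr_fp X)).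

Definition gfree1 : gradedMod A :=
  @GradedMod k A (GRing.regular A) (@acomp k A) (@acompP k A) (@acompM k A).

Lemma gfree1_fp : fin_presented gfree1.
Proof.
exists (existT _ 1 ([tuple 0], [::])), (fun=> 1); split=> //=.
- by move=> i; rewrite (tnth_nth 0) ord1; exact: acomp1.
- move=> x; exists (const_mx x : 'rV[A]_1); rewrite big_ord1 mxE.
  by rewrite /GRing.scale /= mulr1.
- move=> u; rewrite big_ord1 /GRing.scale /= mulr1; split=> [u0|[c ->]].
    exists (fun=> 0); rewrite big_ord0; apply/rowP => i.
    by rewrite ord1 u0 mxE.
  by rewrite big_ord0 mxE.
Qed.

Definition structure_sheaf : qgr := QGr gfree1_fp.

End GradedModules.

Arguments positive_cone {k} A _.

Section PrincipalQuotient.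
Variables (k : fieldType) (F : algType k) (z : F).

Definition principal_ideal : {pred F} :=
  fun a => `[< exists s : seq (F * F), a = \sum_(p <- s) p.1 * z * p.2 >].

Lemma principal_ideal_zmod : zmod_closed principal_ideal.
Proof.
split=> [|a b /asboolP[s ->] /asboolP[t ->]]; apply/asboolP.
  by exists [::]; rewrite big_nil.
exists (s ++ [seq (- p.1, p.2) | p <- t]); rewrite big_cat big_map -sumrN /=.
by congr (_ + _); apply: eq_bigr => p _; rewrite !mulNr.
Qed.

HB.instance Definition _ :=
  GRing.isZmodClosed.Build F principal_ideal principal_ideal_zmod.

Lemma principal_idealM a b c :
  b \in principal_ideal -> a * b * c \in principal_ideal.
Proof.
move=> /asboolP[s ->]; apply/asboolP; exists [seq (a * p.1, p.2 * c) | p <- s].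
rewrite big_map mulr_sumr mulr_suml.
by apply: eq_bigr => p _ /=; rewrite !mulrA.
Qed.

Hypothesis z_proper : 1 \notin principal_ideal.

Definition principal_quot of 1 \notin principal_ideal : Type :=
  Quotient.quot principal_ideal.
Local Notation Q := (principal_quot z_proper).
HB.instance Definition _ := GRing.Zmodule.on Q.

Definition qproj (a : F) : Q := \pi_(Quotient.quot principal_ideal) a.
Definition qrepr (a : Q) : F := repr (a : Quotient.quot principal_ideal).

Lemma qreprK : cancel qrepr qproj.
Proof. exact: reprK. Qed.

Lemma qproj_eq a b : (qproj a == qproj b) = (a - b \in principal_ideal).
Proof. by rewrite Quotient.idealrBE. Qed.

Lemma qprojB : zmod_morphism qproj.
Proof. exact: pi_is_zmod_morphism. Qed.
HB.instance Definition _ := GRing.isZmodMorphism.Build F Q qproj qprojB.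

Definition qone : Q := qproj 1.
Definition qmul (a b : Q) : Q := qproj (qrepr a * qrepr b).
Definition qscale (c : k) (a : Q) : Q := qproj (c *: qrepr a).

Lemma qprojM a b : qproj (a * b) = qmul (qproj a) (qproj b).
Proof.
apply/eqP; rewrite qproj_eq.
set a' := qrepr _; set b' := qrepr _.
have -> : a * b - a' * b' = 1 * (a - a') * b + a' * (b - b') * 1.
  by rewrite mul1r mulr1 mulrBl mulrBr addrA subrK.
by apply: rpredD; apply: principal_idealM; rewrite -qproj_eq qreprK.
Qed.

Lemma qprojZ c a : qproj (c *: a) = qscale c (qproj a).
Proof.
apply/eqP; rewrite qproj_eq -scalerBr -[a - _]mul1r scalerAl -[X in X \in _]mulr1.
by apply: principal_idealM; rewrite -qproj_eq qreprK.
Qed.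

Lemma qmulA : associative qmul.
Proof.
by move=> a b c; rewrite -[a]qreprK -[b]qreprK -[c]qreprK -!qprojM mulrA.
Qed.

Lemma qmul1 : left_id qone qmul.
Proof. by move=> a; rewrite -[a]qreprK -qprojM mul1r. Qed.

Lemma qmulr1 : right_id qone qmul.
Proof. by move=> a; rewrite -[a]qreprK -qprojM mulr1. Qed.

Lemma qmulDl : left_distributive qmul +%R.
Proof.
move=> a b c; rewrite -[a]qreprK -[b]qreprK -[c]qreprK.
by rewrite -raddfD -!qprojM mulrDl raddfD.
Qed.

Lemma qmulDr : right_distributive qmul +%R.
Proof.
move=> a b c; rewrite -[a]qreprK -[b]qreprK -[c]qreprK.
by rewrite -raddfD -!qprojM mulrDr raddfD.
Qed.

Lemma qone_neq0 : qone != 0.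
Proof. by rewrite -(raddf0 qproj) qproj_eq subr0 z_proper. Qed.

HB.instance Definition _ := GRing.Zmodule_isNzRing.Build Q
  qmulA qmul1 qmulr1 qmulDl qmulDr qone_neq0.

Lemma qscaleA a b v : qscale a (qscale b v) = qscale (a * b) v.
Proof. by rewrite -[v]qreprK -!qprojZ scalerA. Qed.

Lemma qscale1 : left_id 1 qscale.
Proof. by move=> v; rewrite -[v]qreprK -qprojZ scale1r. Qed.

Lemma qscaleDr : right_distributive qscale +%R.
Proof.
move=> c u v; rewrite -[u]qreprK -[v]qreprK -raddfD -!qprojZ -raddfD.
by rewrite scalerDr.
Qed.

Lemma qscaleDl v : {morph qscale^~ v : a b / a + b}.
Proof. by move=> a b; rewrite -[v]qreprK -!qprojZ -raddfD scalerDl. Qed.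

HB.instance Definition _ := GRing.Zmodule_isLmodule.Build k Q
  qscaleA qscale1 qscaleDr qscaleDl.

Lemma qprojrM (a b : F) : qproj (a * b) = qproj a * qproj b :> Q.
Proof. exact: qprojM. Qed.

Lemma qprojlZ (c : k) (a : F) : qproj (c *: a) = c *: qproj a :> Q.
Proof. exact: qprojZ. Qed.

Lemma qscaleAl c (u v : Q) : c *: (u * v) = (c *: u) * v.
Proof.
by rewrite -[u]qreprK -[v]qreprK -qprojrM -!qprojlZ -qprojrM scalerAl.
Qed.
HB.instance Definition _ := GRing.Lmodule_isLalgebra.Build k Q qscaleAl.

Lemma qscaleAr c (u v : Q) : c *: (u * v) = u * (c *: v).
Proof.
by rewrite -[u]qreprK -[v]qreprK -qprojrM -!qprojlZ -qprojrM scalerAr.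
Qed.
HB.instance Definition _ := GRing.Lalgebra_isAlgebra.Build k Q qscaleAr.

End PrincipalQuotient.

Section MonomialAlgebra.
Variables (k : fieldType) (r : nat).

(* k<x, y>, with x and y the letters false and true *)
Definition free_alg : Type := {malg k[{fmonom bool}]}.
HB.instance Definition _ := GRing.Lalgebra.on free_alg.

Lemma free_algAr (c : k) (a b : free_alg) : c *: (a * b) = a * (c *: b).
Proof.
have malgCC (a' : free_alg) : c%:MP * a' = a' * c%:MP :> free_alg.
  rewrite /GRing.mul /= fgmulUg fgmulgU; apply: eq_bigr => w _.
  by rewrite mul1m mulm1 mulrC.
by rewrite -[RHS]/(a * _) -!(mul_malgC c) mulrA malgCC -mulrA.
Qed.
HB.instance Definition _ :=
  GRing.Lalgebra_isAlgebra.Build k free_alg free_algAr.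

Definition free_x : free_alg := << fmu false >>.
Definition free_y : free_alg := << fmu true >>.

Lemma free_y_proper : 1 \notin principal_ideal (free_y ^+ r.+1).
Proof.
apply/negP => /asboolP[s E].
have /eqP := congr1 (@mcoeff {fmonom bool} k mone) E.
rewrite mcoeff1 eqxx raddf_sum big1 ?oner_eq0 // => p _.
by rewrite /= !rmorphM rmorphXn /= mcoeffU1 fm1_eq1 expr0n /= mulr0 mul0r.
Qed.

(* Homogeneous component of degree i: the words of length i. *)
Definition fcomp (i : int) (a : free_alg) : free_alg :=
  [malg w in msupp a => if (fdeg w)%:Z == i then a@_w else 0].

Lemma fcompE i a w : (fcomp i a)@_w = if (fdeg w)%:Z == i then a@_w else 0.
Proof. by rewrite mcoeffE; case: msuppP => // _; rewrite if_same. Qed.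

Lemma fcompD i : {morph fcomp i : a b / a + b}.
Proof.
move=> a b; apply/malgP => w; rewrite mcoeffD !fcompE mcoeffD.
by case: ifP; rewrite ?addr0.
Qed.

Lemma fcompZ i c a : fcomp i (c *: a) = c *: fcomp i a.
Proof.
apply/malgP => w; rewrite mcoeffZ !fcompE mcoeffZ.
by case: ifP; rewrite ?mulr0.
Qed.

Lemma fcomp_proj i j a : fcomp i (fcomp j a) = if i == j then fcomp j a else 0.
Proof.
apply/malgP => w; rewrite !fcompE; case: (eqVneq i j) => [->|ij].
  by rewrite fcompE; case: ifP => // ->.
rewrite mcoeff0; case: (eqVneq _ i) => // ->.
by rewrite (negPf ij).
Qed.

Lemma fcomp_id i (a : free_alg) :
  (forall w, w \in msupp a -> (fdeg w)%:Z = i) -> fcomp i a = a.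
Proof.
move=> aP; apply/malgP => w; rewrite fcompE; case: eqVneq => // wi.
by case: msuppP => // /aP /eqP; rewrite (negPf wi).
Qed.

Lemma fcomp_supp i a w : w \in msupp (fcomp i a) -> (fdeg w)%:Z = i.
Proof. by rewrite -mcoeff_neq0 fcompE; case: (eqVneq _ i) => // _; rewrite eqxx. Qed.

Lemma fcompM i j a b : fcomp (i + j) (fcomp i a * fcomp j b) = fcomp i a * fcomp j b.
Proof.
apply: fcomp_id => w /msuppM_le[u [v [/fcomp_supp <- /fcomp_supp <- ->]]].
by rewrite fdegM PoszD.
Qed.

Lemma fcomp_sum a : exists2 s : seq int, uniq s & a = \sum_(i <- s) fcomp i a.
Proof.
exists (undup [seq (fdeg w)%:Z | w <- msupp a]); first exact: undup_uniq.
apply/malgP => w; rewrite raddf_sum /=.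
case: (msuppP a w) => [wa|wa]; last first.
  by rewrite big1 // => i _; rewrite fcompE mcoeff_outdom ?if_same.
rewrite (bigD1_seq (fdeg w)%:Z) ?undup_uniq ?mem_undup ?map_f //=.
rewrite fcompE eqxx big1 ?addr0 // => i iw.
by rewrite fcompE eq_sym (negPf iw).
Qed.

Lemma fcomp1 : fcomp 0 1 = 1.
Proof.
apply: fcomp_id => w; rewrite msuppU1 in_fset1 => /eqP ->.
by rewrite fdeg1.
Qed.

Lemma fcomp_y (n : nat) : fcomp n (free_y ^+ n) = free_y ^+ n.
Proof.
elim: n => [|n IHn]; first exact: fcomp1.
have y1 : fcomp 1 free_y = free_y.
  apply: fcomp_id => w; rewrite msuppU1 in_fset1 => /eqP ->.
  by rewrite fdegU.
by have := fcompM 1 n free_y (free_y ^+ n); rewrite y1 IHn -exprS -intS.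
Qed.

Lemma fcomp_ideal i (a : free_alg) :
  a \in principal_ideal (free_y ^+ r.+1) ->
  fcomp i a \in principal_ideal (free_y ^+ r.+1).
Proof.
have fcomp_sumr (T : Type) (s : seq T) (F : T -> free_alg) j :
    fcomp j (\sum_(p <- s) F p) = \sum_(p <- s) fcomp j (F p).
  apply: (big_morph (fcomp j)); first exact: fcompD.
  by apply/malgP => w; rewrite fcompE mcoeff0 if_same.
move=> /asboolP[s ->]; rewrite fcomp_sumr; apply: rpred_sum => -[b c] _ /=.
have [sb _ ->] := fcomp_sum b; have [sc _ ->] := fcomp_sum c.
have sumE (R : nzRingType) (f g : int -> R) (y : R) :
    (\sum_(m <- sb) f m) * y * (\sum_(n <- sc) g n) =
    \sum_(m <- sb) \sum_(n <- sc) f m * y * g n.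
  by rewrite mulr_suml mulr_suml; apply: eq_bigr => m _; rewrite mulr_sumr.
rewrite sumE fcomp_sumr; apply: rpred_sum => m _.
rewrite fcomp_sumr; apply: rpred_sum => n _.
set t := fcomp m b * _ * _.
have tE : fcomp (m + r.+1 + n) t = t.
  by rewrite /t -(fcomp_y r.+1) -(fcompM m) fcompM.
rewrite -tE fcomp_proj tE; case: eqVneq => _; last exact: rpred0.
apply: principal_idealM; apply/asboolP.
by exists [:: (1, 1)]; rewrite big_seq1 mul1r mulr1.
Qed.

Local Notation Q := (principal_quot free_y_proper).
Local Notation pi := (qproj free_y_proper).

Definition qcomp_xy (i : int) (a : Q) : Q := pi (fcomp i (qrepr a)).

Lemma qcomp_xyE i a : qcomp_xy i (pi a) = pi (fcomp i a).
Proof.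
apply/eqP; rewrite qproj_eq.
have -> : fcomp i (qrepr (pi a)) - fcomp i a = fcomp i (qrepr (pi a) - a).
  by rewrite fcompD -scaleN1r -fcompZ scaleN1r.
by apply: fcomp_ideal; rewrite -(qproj_eq free_y_proper) qreprK.
Qed.

Lemma qcomp_xyP : is_grading qcomp_xy.
Proof.
split=> [i u v|i j u|u].
- rewrite -[u]qreprK -[v]qreprK -raddfD !qcomp_xyE -raddfD.
  by rewrite fcompD.
- rewrite -[u]qreprK !qcomp_xyE fcomp_proj.
  by case: ifP => // _; rewrite raddf0.
- have [s s_uniq uE] := fcomp_sum (qrepr u); exists s => //.
  by rewrite -[LHS]qreprK {1}uE raddf_sum.
Qed.

Lemma qcomp_xyZ i (c : k) u : qcomp_xy i (c *: u) = c *: qcomp_xy i u.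
Proof.
by rewrite -[u]qreprK -qprojlZ !qcomp_xyE fcompZ qprojlZ.
Qed.

Lemma qcomp_xy1 : qcomp_xy 0 1 = 1.
Proof. by rewrite [LHS]qcomp_xyE fcomp1. Qed.

Lemma qcomp_xyM i j u v :
  qcomp_xy (i + j) (qcomp_xy i u * qcomp_xy j v) = qcomp_xy i u * qcomp_xy j v.
Proof. by rewrite -qprojrM qcomp_xyE fcompM. Qed.

(* k<x, y> / (y ^ (r + 1)), graded by word length *)
Definition xy_alg : gradedAlg k :=
  @GradedAlg k Q qcomp_xy qcomp_xyP qcomp_xyZ qcomp_xy1 qcomp_xyM.

End MonomialAlgebra.

(* Z[x], the subring generated by x *)
Definition int_adjoin (R : comNzRingType) (x : R) : set R :=
  range (fun p : {poly int} => (map_poly intr p).[x]).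

(* Main.v *)
From HB Require Import structures.
From mathcomp Require Import all_boot all_order all_algebra.
From mathcomp Require Import boolp classical_sets reals.
From mathcomp Require Import finmap monalg zify.
Require Import Defs.

Set Implicit Arguments.
Unset Strict Implicit.
Unset Printing Implicit Defensive.

Import Order.TTheory GRing.Theory Num.Theory.
Local Open Scope classical_set_scope.
Local Open Scope ring_scope.

(** Write [O(n)] for the class of the n-th twist of the structure sheaf, and t_j = y ^ j x.

    Modules in high degrees.  A word is a power of y, or starts with exactly one of the
    t_j; so for i <= r + 1 an element of B of degree >= i is sum_(j < i) t_j b_j + y ^ i b'
    for unique b_j.  This passes to a finitely presented module M beyond the degrees of its
    generators and relations ([presents_regular]): if these are all <= N, then
    M_D = x M_(D-1) + y M_(D-1) for D > N, and sum_(j < i) t_j m_j + y ^ i m' = 0, with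
    homogeneous terms of degree >= N + i, forces all m_j = 0.  Consequently, if e_s runs
    through homogeneous bases of the spaces y ^ i M_N, 0 <= i <= r, then the elements x e_s
    are free generators of a submodule that contains M in all degrees above N + r
    ([cover_injective], [cover_surjective]).  In the quotient category every object is
    thus a finite sum of twists O(n).  For M = O(n) one may take e_i = y ^ i, whence
    [O(n)] = [O(n-1)] + ... + [O(n-r-1)] ([line_type]).

    The homomorphism.  A short exact sequence of the quotient category is exact in all large
    degrees ([short_exact_high]), so dimensions of components are eventually additive.
    Let h be the Hilbert function of B.  It eventually satisfies the recurrence with
    characteristic polynomial x ^ (r+1) - x ^ r - ... - 1, and pairing a window of r + 1
    consecutive values with the left eigenvector for alpha gives a positive quantity W(i)
    with W(i+1) = alpha W(i).  For an object isomorphic to the sum of the O(s), s in ds, the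
    Hilbert function is eventually the sum of the h(s + i), so its window pairs to
    (sum of the alpha ^ s) W(i).  Hence the number sum of the alpha ^ s depends only on the
    object, and is additive ([type_value_eq], [K0_rank_exists]).

    Injectivity and positivity.  Both follow from one statement, [nonneg_value_is_sum]: an
    integral combination of the [O(n)] whose value is >= 0 equals a sum of classes [O(s)].  The
    value of a sum of classes vanishes only for the empty sum, so a class of value 0 is 0;
    and a sum of classes is the class of a direct sum.  To prove the statement, expand the
    class with respect to partial sums of [O(m-1)], ..., [O(m-r-1)].  Lowering m turns the
    integer coefficients u_0, ..., u_r into u_1, ..., u_r, u_0 + ... + u_r.  The new entry
    equals (alpha - 1) W(u) plus a weighted mean of the u_l with weights alpha ^ -(l+1),
    which add up to 1.  If W(u) >= 0 it is thus at least the minimum of the u_l, with equality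
    at a negative minimum excluded, since then all u_l would be equal and W(u) < 0.  By
    integrality the minimum grows by at least 1 in r + 1 steps until it is nonnegative. *)

(** * Components of graded modules *)

Section Graded.
Variables (k : fieldType) (A : gradedAlg k).
Implicit Types (M N : gradedMod A) (i j n : int) (t : k).

Section Components.
Variable M : gradedMod A.
Implicit Types (x : M) (a : A).

Lemma compD i : {morph comp i : x x' / x + x' : M}.
Proof. exact: grading_add (compP M) i. Qed.

Lemma compN i x : comp i (- x) = - comp i x.
Proof. by apply: (addrI (comp i x)); rewrite -compD !subrr comp0. Qed.

Lemma compB i x x' : comp i (x - x') = comp i x - comp i x'.
Proof. by rewrite compD compN. Qed.

Lemma comp_sum (I : Type) (s : seq I) (P : pred I) (F : I -> M) i :
  comp i (\sum_(l <- s | P l) F l) = \sum_(l <- s | P l) comp i (F l).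
Proof. by apply: (big_morph (comp i)); [exact: compD | exact: comp0]. Qed.

Lemma comp_comp i j x : comp i (comp j x) = if i == j then comp j x else 0.
Proof. exact: grading_proj (compP M) i j x. Qed.

Lemma compK i x : comp i (comp i x) = comp i x.
Proof. by rewrite comp_comp eqxx. Qed.

Lemma comp_ne i j x : comp j x = x -> i != j -> comp i x = 0.
Proof. by move=> <- ij; rewrite comp_comp (negPf ij). Qed.

Lemma comp_eq x x' : (forall i, comp i x = comp i x') -> x = x'.
Proof.
move=> E; apply/eqP; rewrite -subr_eq0; apply/eqP.
have [s _ ->] := grading_sum (compP M) (x - x').
by rewrite big1 // => i _; rewrite compB E subrr.
Qed.

Lemma comp_bounded x : exists n, forall i, n <= i -> comp i x = 0.
Proof.
have [s _ ->] := grading_sum (compP M) x.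
exists (1 + \sum_(l <- s) `|l|) => i ni; rewrite comp_sum big_seq big1 // => l ls.
rewrite comp_comp; case: eqVneq => // il.
have : \sum_(l <- s) `|l| >= `|l|.
  by rewrite (big_rem l) //= lerDl; apply: sumr_ge0.
lia.
Qed.

Lemma scale_comp i j a x :
  comp i (acomp j a *: x) = acomp j a *: comp (i - j) x.
Proof.
have [s _ ->] := grading_sum (compP M) x.
rewrite scaler_sumr !comp_sum scaler_sumr; apply: eq_bigr => l _.
rewrite -(@compM _ _ M j l) !comp_comp.
rewrite (_ : (i == j + l) = (i - j == l)); last by rewrite subr_eq addrC.
by case: ifP => [_|_]; rewrite ?scaler0 ?compM.
Qed.

Lemma acompA t : acomp 0 t%:A = t%:A :> A.
Proof. by rewrite acompZ acomp1. Qed.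

Lemma compZ i t x : comp i (t%:A *: x) = t%:A *: comp i x.
Proof. by rewrite -acompA scale_comp subr0. Qed.

Lemma scaleA_comm t a x : a *: (t%:A *: x) = t%:A *: (a *: x).
Proof. by rewrite !scalerA mulr_algl mulr_algr. Qed.

Definition hom i : set M := [set x | comp i x = x].
Definition below n : set M := [set x | forall i, n <= i -> comp i x = 0].
Definition above n : set M := [set x | forall i, i < n -> comp i x = 0].

Lemma hom_comp i x : hom i (comp i x). Proof. exact: compK. Qed.

Lemma hom_below i x : hom i x -> below (i + 1) x.
Proof. by move=> xi j ij; apply: comp_ne xi _; lia. Qed.

Lemma below_le m n x : m <= n -> below m x -> below n x.
Proof. by move=> mn xm i ni; apply: xm; exact: le_trans ni. Qed.

Lemma cut_comp n x : exists l h, [/\ x = l + h, below n l & above n h].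
Proof.
have [s s_uniq xE] := grading_sum (compP M) x.
exists (\sum_(i <- s | i < n) comp i x), (\sum_(i <- s | ~~ (i < n)) comp i x).
split; first by rewrite [LHS]xE (bigID (fun i => i < n)).
  move=> i ni; rewrite comp_sum big1 // => l ln.
  by rewrite comp_comp; case: eqVneq => // il; lia.
move=> i ni; rewrite comp_sum big1 // => l ln.
by rewrite comp_comp; case: eqVneq => // il; lia.
Qed.

Lemma mem_of_comp (U : set M) x : graded_submod U -> (forall i, U (comp i x)) -> U x.
Proof.
move=> [U0 UL _] Ux; have [s _ ->] := grading_sum (compP M) x.
apply: (big_ind U) => // u v Uu Uv.
by have := UL 1 u v Uu Uv; rewrite scale1r.
Qed.

End Components.

Arguments hom {M}.
Arguments below {M}.
Arguments above {M}.

(** * Dimensions of k-subspaces *)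

Section Dimension.

Definition ksubspace M (U : set M) : Prop :=
  U 0 /\ forall t x x', U x -> U x' -> U (t%:A *: x + x').

Lemma ksubspace_sum M (U : set M) (I : Type) (s : seq I) (P : pred I) (c : I -> k)
    (e : I -> M) : ksubspace U -> (forall l, P l -> U (e l)) ->
  U (\sum_(l <- s | P l) (c l)%:A *: e l).
Proof.
move=> [U0 UL] Ue; apply: (big_ind U) => // [u v Uu Uv|l /Ue Ul].
  by have := UL 1 u v Uu Uv; rewrite !scale1r.
by have := UL (c l) _ _ Ul U0; rewrite addr0.
Qed.

Lemma hom_ksubspace M i : ksubspace (@hom M i).
Proof.
by split=> [|t x x' xi x'i]; rewrite /hom /= ?comp0 // compD compZ xi x'i.
Qed.

Record is_basis M (U : set M) m (e : 'I_m -> M) : Prop := IsBasis {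
  basis_in : forall l, U (e l);
  basis_span : forall x, U x -> exists c : 'I_m -> k, x = \sum_l (c l)%:A *: e l;
  basis_free : forall c : 'I_m -> k, \sum_l (c l)%:A *: e l = 0 -> forall l, c l = 0
}.

Definition has_dim M (U : set M) (m : nat) : Prop :=
  exists e : 'I_m -> M, is_basis U e.

(** An injective change of basis matrix has full row rank, so it has no more rows than
    columns. *)
Lemma has_dim_le M (U : set M) m p : has_dim U m -> has_dim U p -> (m <= p)%N.
Proof.
move=> [e [eU _ efree]] [d [_ dspan _]].
have /choice[c cE] l := dspan _ (eU l).
pose P : 'M[k]_(m, p) := \matrix_(l, q) c l q.
rewrite leqNgt; apply/negP => pm.
have : (0 < \rank (kermx P))%N.
  by rewrite mxrank_ker subn_gt0; apply: leq_ltn_trans pm; exact: rank_leq_col.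
rewrite lt0n mxrank_eq0 => /rowV0Pn[v /sub_kermxP vP v0].
case/negP: v0; apply/eqP/rowP => l; rewrite mxE.
apply: efree (fun l => v 0 l) _ l.
under eq_bigr do rewrite cE scaler_sumr.
rewrite exchange_big /= big1 // => q _.
under eq_bigr do rewrite scalerA mulr_algl scalerA.
have /rowP/(_ q) := vP; rewrite !mxE => vPq.
rewrite -scaler_suml -scaler_suml; set s := (\sum_i _) in vPq *.
rewrite (_ : \sum_(i < m) _ = 0) ?scale0r //.
by rewrite -[RHS]vPq; apply: eq_bigr => l' _; rewrite mxE.
Qed.

Lemma has_dim_uniq M (U : set M) m p : has_dim U m -> has_dim U p -> m = p.
Proof. by move=> Um Up; apply/eqP; rewrite eqn_leq (has_dim_le Um Up) (has_dim_le Up Um). Qed.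

Lemma finite_dim_span M (U : set M) (I : finType) (e : I -> M) :
  (forall x, U x -> exists c : I -> k, x = \sum_l (c l)%:A *: e l) -> finite_dim U.
Proof.
move=> eP; exists [seq e l | l <- enum I] => x /eP[c ->].
exists (fun j : nat => nth 0 [seq c l | l <- enum I] j).
apply/eqP; rewrite subr_eq0; apply/eqP; rewrite size_map -big_enum /=.
case: (enum I) => [|l0 s]; first by rewrite big_nil big_ord0.
rewrite (big_nth l0) big_mkord; apply: eq_bigr => j _.
by rewrite !(nth_map l0).
Qed.

Lemma finite_dimS M (U V : set M) : U `<=` V -> finite_dim V -> finite_dim U.
Proof. by move=> UV [e eP]; exists e => x /UV /eP. Qed.

(** Induction on a spanning list: the members of U that avoid the head of the list
    form a subspace V, and U is V or V plus one vector, whose coefficient at the head is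
    nonzero. *)
Lemma basis_exists M (U : set M) : ksubspace U -> finite_dim U ->
  exists m, has_dim U m.
Proof.
move=> Uk [e eP]; have {}eP x : U x -> exists c : nat -> k,
    x = \sum_(j < size e) (c j)%:A *: e`_j.
  by move=> /eP[c /subr0_eq ->]; exists c.
elim: e U Uk eP => [|e0 e IHe] U Uk eP.
  exists 0%N, (fun=> 0); split=> [[]//|x /eP[c ->]|c _ []//].
  by exists (fun=> 0); rewrite !big_ord0.
pose V : set M := [set x | U x /\ exists c : nat -> k,
  x = \sum_(j < size e) (c j)%:A *: e`_j].
have Vk : ksubspace V.
  split=> [|t x x' [Ux [c xE]] [Ux' [c' x'E]]].
    by split; [case: Uk | exists (fun=> 0); rewrite big1 // => j _; rewrite !scale0r].
  split; first by case: Uk => _; apply.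
  exists (fun j : nat => t * c j + c' j); rewrite xE x'E scaler_sumr -big_split.
  by apply: eq_bigr => j _; rewrite /= 2!scalerDl scalerA mulr_algl scalerA.
have [m [d [dV dspan dfree]]] := IHe V Vk (fun x Vx => Vx.2).
have [UV|] := pselect (forall x, U x -> V x).
  exists m, d; split=> // [l|x /UV]; last exact: dspan.
  by have [] := dV l.
move=> /existsNP[x0 /not_implyP[Ux0 Vx0]].
have [c0 x0E] := eP x0 Ux0.
have c00 : c0 0%N != 0.
  apply/eqP => c00; apply: Vx0; split=> //; exists (fun j : nat => c0 j.+1).
  by rewrite x0E big_ord_recl /= c00 !scale0r add0r.
exists m.+1, (fun l => if unlift ord0 l is Some j then d j else x0); split=> [l|x Ux|c].
- by case: unliftP => [j _|//]; have [] := dV j.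
- have [c xE] := eP x Ux.
  have /dspan[b bE] : V (x - (c 0%N / c0 0%N)%:A *: x0).
    split.
      have [_ /(_ (- (c 0%N / c0 0%N)) _ _ Ux0 Ux)] := Uk.
      by rewrite !scaleNr addrC.
    exists (fun j : nat => - (c 0%N / c0 0%N) * c0 j.+1 + c j.+1).
    rewrite xE x0E scaler_sumr -sumrB big_ord_recl /= scalerA mulr_algl scalerA.
    rewrite divfK // subrr add0r; apply: eq_bigr => j _.
    rewrite scalerA mulr_algl scalerA mulNr [in RHS]addrC.
    by rewrite scalerBl scalerBl.
  exists (fun l => if unlift ord0 l is Some j then b j else c 0%N / c0 0%N).
  rewrite big_ord_recl unlift_none; under eq_bigr do rewrite liftK.
  by rewrite -bE addrC subrK.
rewrite big_ord_recl unlift_none; under eq_bigr do rewrite liftK.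
move=> E; have cl0 : c ord0 = 0.
  apply/eqP/negPn/negP => cn0; apply: Vx0.
  have -> : x0 = \sum_l (- (c ord0)^-1 * c (lift ord0 l))%:A *: d l.
    have /eqP := E; rewrite addr_eq0 => /eqP /(congr1 (fun v => (c ord0)^-1%:A *: v)).
    rewrite scalerA mulr_algl scalerA mulVf // !scale1r => ->.
    rewrite scalerN scaler_sumr -sumrN; apply: eq_bigr => l _.
    by rewrite scalerA mulr_algl scalerA mulNr !scaleNr.
  exact: ksubspace_sum.
move: E; rewrite cl0 !scale0r add0r => /dfree cS l.
by case: (unliftP ord0 l) => [j ->|->].
Qed.

(** Additivity of dimension, for linear relations f and g in place of maps: a morphism
    of the quotient category is a relation, which becomes a map on components of large
    degree only. *)
Lemma has_dim_exact M N (P : gradedMod A) (f : M -> N -> Prop) (g : N -> P -> Prop)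
    (U : set M) (V : set N) (W : set P) a c :
  ksubspace V ->
  f 0 0 -> (forall t x x' v v', f x v -> f x' v' -> f (t%:A *: x + x') (t%:A *: v + v')) ->
  g 0 0 -> (forall t v v' w w', g v w -> g v' w' -> g (t%:A *: v + v') (t%:A *: w + w')) ->
  (forall x, U x -> exists2 v, V v & f x v) -> (forall v, V v -> exists2 w, W w & g v w) ->
  ksubspace U -> ksubspace W ->
  (forall v, V v -> f 0 v -> v = 0) -> (forall w, W w -> g 0 w -> w = 0) ->
  (forall x, U x -> f x 0 -> x = 0) ->
  (forall x v, U x -> V v -> f x v -> g v 0) ->
  (forall v, V v -> g v 0 -> exists2 x, U x & f x v) ->
  (forall w, W w -> exists2 v, V v & g v w) ->
  has_dim U a -> has_dim W c -> has_dim V (a + c).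
Proof.
move=> Vk f0 fL g0 gL fU gV Uk Wk fV gW finj gf exV gsurj [e [eU espan efree]]
  [d [dW dspan dfree]].
have fsum (I : finType) (b : I -> k) (x : I -> M) (v : I -> N) :
    (forall l, f (x l) (v l)) -> f (\sum_l (b l)%:A *: x l) (\sum_l (b l)%:A *: v l).
  move=> xv; apply: (big_ind2 f) => // [x1 v1 x2 v2 f1 f2|l _].
    by have := fL 1 _ _ _ _ f1 f2; rewrite !scale1r.
  by have := fL (b l) _ _ _ _ (xv l) f0; rewrite !addr0.
have gsum (I : finType) (b : I -> k) (x : I -> N) (v : I -> P) :
    (forall l, g (x l) (v l)) -> g (\sum_l (b l)%:A *: x l) (\sum_l (b l)%:A *: v l).
  move=> xv; apply: (big_ind2 g) => // [x1 v1 x2 v2 f1 f2|l _].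
    by have := gL 1 _ _ _ _ f1 f2; rewrite !scale1r.
  by have := gL (b l) _ _ _ _ (xv l) g0; rewrite !addr0.
have /choice[y yP] l : exists v, V v /\ f (e l) v.
  by have [v Vv ev] := fU _ (eU l); exists v.
have /choice[z zP] l : exists v, V v /\ g v (d l).
  by have [v Vv ev] := gsurj _ (dW l); exists v.
have gB v v' w w' : g v w -> g v' w' -> g (v' - v) (w' - w).
  by move=> h h'; have := gL (-1) _ _ _ _ h h'; rewrite !scaleN1r addrC [- w + _]addrC.
have fB v v' w w' : f v w -> f v' w' -> f (v' - v) (w' - w).
  by move=> h h'; have := fL (-1) _ _ _ _ h h'; rewrite !scaleN1r addrC [- w + _]addrC.
have VB v v' : V v -> V v' -> V (v' - v).
  by move=> h h'; have := Vk.2 (-1) _ _ h h'; rewrite !scaleN1r addrC.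
exists (fun l => match split l with inl l => y l | inr l => z l end); split.
- by move=> l; case: split => l'; [have [] := yP l' | have [] := zP l'].
- move=> v Vv; have [w Ww vw] := gV v Vv; have [b wE] := dspan w Ww.
  have Vz : V (\sum_l (b l)%:A *: z l) by apply: ksubspace_sum => // l; have [] := zP l.
  have := gB _ _ _ _ (gsum _ b z d (fun l => (zP l).2)) vw.
  rewrite -wE subrr => /exV[|x Ux xv]; first exact: VB.
  have [b' xE] := espan x Ux.
  have := fB _ _ _ _ (fsum _ b' e y (fun l => (yP l).2)) xv.
  rewrite -xE subrr => /fV E.
  exists (fun l => match split l with inl l => b' l | inr l => b l end).
  rewrite big_split_ord /=.
  under eq_bigr do rewrite (unsplitK (inl _)).
  under [X in _ + X]eq_bigr do rewrite (unsplitK (inr _)).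
  rewrite -[LHS](subrK (\sum_l (b l)%:A *: z l)); congr (_ + _).
  apply/subr0_eq/E; apply: (VB _ _ _); last exact: VB.
  by apply: ksubspace_sum => // l; have [] := yP l.
move=> b; rewrite big_split_ord /=.
under eq_bigr do rewrite (unsplitK (inl _)).
under [X in _ + X]eq_bigr do rewrite (unsplitK (inr _)).
pose b1 l := b (lshift c l); pose b2 l := b (rshift a l).
rewrite -/(b1 _) => E.
have Vy : V (\sum_l (b1 l)%:A *: y l) by apply: ksubspace_sum => // l; have [] := yP l.
have Ue : U (\sum_l (b1 l)%:A *: e l) by exact: ksubspace_sum.
have fy := fsum _ b1 e y (fun l => (yP l).2).
have gz := gsum _ b2 z d (fun l => (zP l).2).
have := gB _ _ _ _ gz (gB _ _ _ _ (gf _ _ Ue Vy fy) g0).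
rewrite sub0r -opprD E oppr0 subrr sub0r => g0d.
have /gW : W (- \sum_l (b2 l)%:A *: d l).
  have Wd : W (\sum_l (b2 l)%:A *: d l) by exact: ksubspace_sum.
  by have := Wk.2 (-1) _ _ Wd Wk.1; rewrite !scaleN1r addr0.
move=> /(_ g0d)/eqP; rewrite oppr_eq0 => /eqP /dfree b20.
move: E; rewrite [X in _ + X]big1 ?addr0 => [E|l _]; last by rewrite -/(b2 l) b20 !scale0r.
move: fy; rewrite E => /(finj _ Ue) /efree b10 l.
by case: (splitP l) => l' ll; [rewrite -[RHS](b10 l') | rewrite -[RHS](b20 l')];
  congr b; apply: val_inj.
Qed.

End Dimension.

End Graded.

(** * Graded linear maps, free modules and quotient modules *)

Section GradedLinear.
Variables (k : fieldType) (A : gradedAlg k).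
Implicit Types (M N : gradedMod A).

Definition graded_linear M N (f : M -> N) : Prop :=
  (forall a x y, f (a *: x + y) = a *: f x + f y) /\
  (forall i x, f (comp i x) = comp i (f x)).

Section Basic.
Variables (M N : gradedMod A) (f : M -> N).
Hypothesis fP : graded_linear f.

Lemma glinD x y : f (x + y) = f x + f y.
Proof. by have := fP.1 1 x y; rewrite !scale1r. Qed.

Lemma glin0 : f 0 = 0.
Proof. by apply: (addrI (f 0)); rewrite -glinD !addr0. Qed.

Lemma glinZ a x : f (a *: x) = a *: f x.
Proof. by have := fP.1 a x 0; rewrite glin0 !addr0. Qed.

Lemma glinN x : f (- x) = - f x.
Proof. by rewrite -scaleN1r glinZ scaleN1r. Qed.

Lemma glinB x y : f (x - y) = f x - f y.
Proof. by rewrite glinD glinN. Qed.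

Lemma glinC i x : f (comp i x) = comp i (f x). Proof. exact: fP.2. Qed.

Lemma glin_sum (I : Type) (s : seq I) (P : pred I) (F : I -> M) :
  f (\sum_(l <- s | P l) F l) = \sum_(l <- s | P l) f (F l).
Proof. by apply: (big_morph f); [exact: glinD | exact: glin0]. Qed.

End Basic.

Lemma glin_zero M N : graded_linear (fun _ : M => 0 : N).
Proof. by split=> [a x y|i x]; rewrite ?scaler0 ?addr0 ?comp0. Qed.

Section Free.
Variables (n : nat) (d : 'I_n -> int).

Definition gfree_comp (i : int) (u : 'rV[A]_n) : 'rV[A]_n :=
  \row_l acomp (i - d l) (u 0 l).

Lemma acomp_comp i j (a : A) : acomp i (acomp j a) = if i == j then acomp j a else 0.
Proof. exact: (comp_comp (M := gfree1 A)). Qed.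

Lemma acompD i (a b : A) : acomp i (a + b) = acomp i a + acomp i b.
Proof. exact: (compD (M := gfree1 A)). Qed.

Lemma acomp0 i : acomp i (0 : A) = 0.
Proof. exact: (comp0 (gfree1 A)). Qed.

Lemma acomp_eq (a b : A) : (forall i, acomp i a = acomp i b) -> a = b.
Proof. exact: (comp_eq (M := gfree1 A)). Qed.

Lemma mul_acomp i j (a b : A) : acomp i (acomp j a * b) = acomp j a * acomp (i - j) b.
Proof. exact: (scale_comp (M := gfree1 A)). Qed.

Lemma comp_scale_hom M e i (a : A) (g : M) :
  comp e g = g -> comp i (a *: g) = acomp (i - e) a *: g.
Proof.
move=> ge; have [s _ aE] := grading_sum (compP (gfree1 A)) (a : gfree1 A).
rewrite [in LHS]aE scaler_suml comp_sum.
rewrite -[acomp _ a]/(comp (i - e) (a : gfree1 A)) [in RHS]aE comp_sum scaler_suml.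
apply: eq_bigr => m _; rewrite -[comp m _]/(acomp m a) scale_comp.
rewrite -[comp (i - e) _]/(acomp _ _) acomp_comp.
case: eqVneq => [<-|im]; first by rewrite subKr ge.
by rewrite (comp_ne ge) ?scaler0 ?scale0r //; apply: contra im => /eqP <-; apply/eqP; lia.
Qed.

(** The entries of u have finitely many components, so all of them lie in one interval
    of degrees, and the components of u over that interval add up to u. *)
Lemma gfree_compP : is_grading gfree_comp.
Proof.
split=> [i u v|i j u|u].
- by apply/rowP => l; rewrite !mxE acompD.
- case: eqVneq => [->|ij]; apply/rowP => l; rewrite !mxE acomp_comp ?eqxx //.
  by rewrite (inj_eq (addIr _)) (negPf ij).
have /choice[b bP] l := comp_bounded (M := gfree1 A) (u 0 l).
have /choice[c cP] l : exists c : int, forall i, i < c -> acomp i (u 0 l) = 0.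
  have [s _ uE] := grading_sum (compP (gfree1 A)) (u 0 l : gfree1 A).
  exists (- \sum_(j <- s) `|j|) => i ni.
  rewrite -[acomp _ _]/(comp i (u 0 l : gfree1 A)) uE comp_sum big_seq big1 // => j js.
  rewrite comp_comp; case: eqVneq => // ij.
  have : \sum_(j <- s) `|j| >= `|j|.
    by rewrite (big_rem j) //= lerDl; apply: sumr_ge0.
  lia.
pose K := \sum_l (`|b l| + `|c l| + `|d l|).
have KP l : `|b l| + `|c l| + `|d l| <= K.
  by rewrite /K (bigD1 l) //= lerDl; apply: sumr_ge0 => *; rewrite !addr_ge0.
pose s : seq int := [seq (j : nat)%:Z - K | j <- iota 0 (`|K|.*2.+1)].
have s_uniq : uniq s by rewrite map_inj_uniq ?iota_uniq // => i' j; lia.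
exists s => //.
apply/rowP => l; rewrite summxE; apply: acomp_eq => i.
rewrite -[acomp i (\sum_(_ <- _) _)]/(comp i (\sum_(j <- s) (gfree_comp j u) 0 l : gfree1 A)).
rewrite comp_sum; under eq_bigr do rewrite mxE.
have [is_|is_] := boolP (i + d l \in s).
  rewrite (bigD1_seq (i + d l)) //=.
  rewrite acomp_comp addrK eqxx big1 ?addr0 // => j jl.
  by rewrite acomp_comp; case: eqP => // jE; move: jl; rewrite jE subrK eqxx.
rewrite big_seq big1 => [|j js]; last first.
  rewrite -[comp _ _]/(acomp _ _) acomp_comp; case: eqP => // jE.
  by move: is_; rewrite jE subrK js.
have := KP l => Kl; have [bi|ib] := leP (b l) i; first exact: bP.
have [ic|ci] := ltP i (c l); first exact: cP.
case/negP: is_; apply/mapP; exists (absz (i + d l + K)); last lia.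
by rewrite mem_iota; lia.
Qed.

Lemma gfree_compM i j (a : A) (u : 'rV[A]_n) :
  gfree_comp (i + j) (acomp i a *: gfree_comp j u) = acomp i a *: gfree_comp j u.
Proof. by apply/rowP => l; rewrite !mxE -addrA acompM. Qed.

(** Generator l has degree d_l: the module is the sum of the A(- d_l). *)
Definition gfree : gradedMod A := GradedMod gfree_compP gfree_compM.

Lemma gfree_presents : presents gfree (existT _ n ([tuple d l | l < n], [::])).
Proof.
exists (fun l => delta_mx 0 l); split=> //.
- move=> l; rewrite tnth_mktuple; apply/rowP => j; rewrite !mxE /=.
  by case: (eqVneq j l) => [->|jl]; rewrite ?subrr ?acomp1 // acomp0.
- move=> u; exists u; apply/rowP => j; rewrite summxE (bigD1 j) //= !mxE !eqxx mulr1.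
  by rewrite big1 ?addr0 // => l lj; rewrite !mxE eq_sym (negPf lj) andbF mulr0.
move=> u; have -> : \sum_i u 0 i *: (delta_mx 0 i : 'rV_n) = u.
  apply/rowP => j; rewrite summxE (bigD1 j) //= !mxE !eqxx mulr1.
  by rewrite big1 ?addr0 // => l lj; rewrite !mxE eq_sym (negPf lj) andbF mulr0.
by split=> [->|[c ->]]; [exists (fun=> 0)|]; rewrite big_ord0.
Qed.

Definition qfree : qgr A := QGr (ex_intro _ _ gfree_presents).

Lemma gfree_map M (g : 'I_n -> M) : (forall l, comp (d l) (g l) = g l) ->
  graded_linear (fun u : gfree => \sum_l u 0 l *: g l).
Proof.
move=> gd; split=> [a u v|i u].
  rewrite scaler_sumr -big_split; apply: eq_bigr => l _.
  by rewrite !mxE scalerDl scalerA.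
rewrite comp_sum; apply: eq_bigr => l _; rewrite mxE.
by rewrite (comp_scale_hom _ _ (gd l)).
Qed.

End Free.

Section Quotient.
Variables (M : gradedMod A) (U : set M).

Definition submod_pred of graded_submod U : {pred M} := fun x => `[< U x >].

Hypothesis UP : graded_submod U.

Lemma submod_zmod : zmod_closed (submod_pred UP).
Proof.
have [U0 UL _] := UP; split=> [|x y /asboolP Ux /asboolP Uy]; apply/asboolP => //.
by have := UL (-1) y x Uy Ux; rewrite scaleN1r addrC.
Qed.

HB.instance Definition _ :=
  GRing.isZmodClosed.Build M (submod_pred UP) submod_zmod.

Definition quot_type : Type := Quotient.quot (submod_pred UP).
HB.instance Definition _ := GRing.Zmodule.on quot_type.

Definition quot_proj (x : M) : quot_type := \pi_(Quotient.quot (submod_pred UP))%qT x.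
Definition quot_repr (x : quot_type) : M := repr (x : Quotient.quot (submod_pred UP)).

Lemma quot_reprK : cancel quot_repr quot_proj. Proof. exact: reprK. Qed.

Lemma quot_projB : zmod_morphism quot_proj.
Proof. exact: pi_is_zmod_morphism. Qed.
HB.instance Definition _ := GRing.isZmodMorphism.Build M quot_type quot_proj quot_projB.

Lemma quot_proj_eq x y : quot_proj x = quot_proj y <-> U (x - y).
Proof.
have : (quot_proj x == quot_proj y) = (x - y \in submod_pred UP).
  by rewrite Quotient.idealrBE.
by move=> E; split=> [/eqP|/asboolP Uxy]; [rewrite E => /asboolP|apply/eqP; rewrite E].
Qed.

Definition quot_scale (a : A) (x : quot_type) := quot_proj (a *: quot_repr x).

Lemma quot_projZ a x : quot_proj (a *: x) = quot_scale a (quot_proj x).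
Proof.
apply/quot_proj_eq; rewrite -scalerBr.
have [U0 UL _] := UP; rewrite -[_ *: _]addr0; apply: UL => //.
by apply/quot_proj_eq; rewrite quot_reprK.
Qed.

Lemma quot_scaleA a b v : quot_scale a (quot_scale b v) = quot_scale (a * b) v.
Proof. by rewrite -[v]quot_reprK -!quot_projZ scalerA. Qed.

Lemma quot_scale1 : left_id 1 quot_scale.
Proof. by move=> v; rewrite -[v]quot_reprK -quot_projZ scale1r. Qed.

Lemma quot_scaleDr : right_distributive quot_scale +%R.
Proof.
move=> c u v; rewrite -[u]quot_reprK -[v]quot_reprK -raddfD -!quot_projZ -raddfD.
by rewrite scalerDr.
Qed.

Lemma quot_scaleDl v : {morph quot_scale^~ v : a b / a + b}.
Proof. by move=> a b; rewrite -[v]quot_reprK -!quot_projZ -raddfD scalerDl. Qed.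

HB.instance Definition _ := GRing.Zmodule_isLmodule.Build A quot_type
  quot_scaleA quot_scale1 quot_scaleDr quot_scaleDl.

Lemma quot_proj_scale a x : quot_proj (a *: x) = a *: quot_proj x.
Proof. exact: quot_projZ. Qed.

Definition quot_comp (i : int) (x : quot_type) : quot_type := quot_proj (comp i (quot_repr x)).

Lemma quot_comp_proj i x : quot_comp i (quot_proj x) = quot_proj (comp i x).
Proof.
apply/quot_proj_eq; rewrite -compB; have [_ _] := UP; apply.
by apply/quot_proj_eq; rewrite quot_reprK.
Qed.

Lemma quot_compP : is_grading quot_comp.
Proof.
split=> [i u v|i j u|u].
- rewrite -[u]quot_reprK -[v]quot_reprK -raddfD !quot_comp_proj -raddfD.
  by rewrite compD.
- rewrite -[u]quot_reprK !quot_comp_proj comp_comp.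
  by case: ifP => // _; rewrite raddf0.
have [s s_uniq uE] := grading_sum (compP M) (quot_repr u); exists s => //.
by rewrite -[LHS]quot_reprK {1}uE raddf_sum.
Qed.

Lemma quot_compM i j (a : A) (u : quot_type) :
  quot_comp (i + j) (acomp i a *: quot_comp j u) = acomp i a *: quot_comp j u.
Proof.
by rewrite -[u]quot_reprK quot_comp_proj -quot_proj_scale quot_comp_proj compM.
Qed.

Definition gquot : gradedMod A := GradedMod quot_compP quot_compM.

Definition gproj (x : M) : gquot := quot_proj x.

Lemma gproj_linear : graded_linear gproj.
Proof.
split=> [a x y|i x]; last by rewrite /gproj -quot_comp_proj.
by rewrite /gproj raddfD /= quot_proj_scale.
Qed.

Lemma gproj_eq0 x : gproj x = 0 <-> U x.
Proof. by rewrite -(glin0 gproj_linear) /gproj quot_proj_eq subr0. Qed.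

Lemma gproj_surj z : exists x, gproj x = z.
Proof. by exists (quot_repr z); exact: quot_reprK. Qed.

End Quotient.

(** Lifts of the y_s to vectors of coefficients, chosen homogeneous, are added to the
    relations of M. *)
Lemma gquot_fp M (U : set M) (UP : graded_submod U) t (y : 'I_t -> M) (e : 'I_t -> int) :
    (forall s, comp (e s) (y s) = y s) ->
    (forall x, U x <-> exists b : 'I_t -> A, x = \sum_s b s *: y s) ->
  fin_presented M -> fin_presented (gquot UP).
Proof.
move=> ye Uy [[n [d rels]] [g [gd gspan relh ker]]].
have gl := gfree_map gd; pose G := gfree (tnth d).
have /choice[v vP] s : exists v : 'rV[A]_n,
    \sum_l v 0 l *: g l = y s /\ gfree_comp (tnth d) (e s) v = v.
  have [v vE] := gspan (y s); exists (gfree_comp (tnth d) (e s) v).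
  split; last exact: (compK (M := G)).
  have := glinC gl (e s) v; rewrite /= -vE ye => <-.
  by apply: eq_bigr => l _.
exists (existT _ n (d, rels ++ [seq v s | s <- enum 'I_t])).
exists (fun l => gproj UP (g l)); split.
- by move=> l; rewrite -(glinC (gproj_linear UP)) gd.
- move=> z; have [x <-] := gproj_surj z; have [u ->] := gspan x.
  exists u; rewrite (glin_sum (gproj_linear UP)); apply: eq_bigr => l _.
  by rewrite (glinZ (gproj_linear UP)).
- move=> rho; rewrite mem_cat => /orP[/relh //|/mapP[s _ ->]].
  exists (e s) => l; have [_ {2}<-] := vP s; by rewrite mxE.
move=> u; have -> : \sum_i u 0 i *: gproj UP (g i) = gproj UP (\sum_i u 0 i *: g i).
  rewrite (glin_sum (gproj_linear UP)); apply: eq_bigr => l _.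
  by rewrite (glinZ (gproj_linear UP)).
rewrite gproj_eq0 Uy size_cat size_map size_enum_ord.
have nthl (j : 'I_(size rels)) : (rels ++ [seq v s | s <- enum 'I_t])`_j = rels`_j.
  by rewrite nth_cat /= ltn_ord.
have nthr (s : 'I_t) : (rels ++ [seq v s | s <- enum 'I_t])`_(size rels + s)%N = v s.
  rewrite nth_cat /= ltnNge leq_addr /= addKn (nth_map s) ?size_enum_ord //.
  by rewrite nth_ord_enum.
have sumv (b : 'I_t -> A) : \sum_l (\sum_s b s *: v s) 0 l *: g l = \sum_s b s *: y s.
  have := glin_sum gl (index_enum 'I_t) xpredT (fun s => b s *: v s : G) => /= ->.
  by apply: eq_bigr => s _; have := glinZ gl (b s) (v s) => /= ->; have [-> _] := vP s.
split=> [[b uE]|[c ->]].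
  have /ker[c cE] : \sum_l (u - \sum_s b s *: v s) 0 l *: g l = 0.
    have := glinB gl u (\sum_s b s *: v s) => /= ->.
    by rewrite sumv uE subrr.
  exists (fun j => match split j with inl j => c j | inr s => b s end).
  rewrite big_split_ord /=.
  under eq_bigr do rewrite (unsplitK (inl _)) nthl.
  under [X in _ + X]eq_bigr do rewrite (unsplitK (inr _)) nthr.
  by rewrite -cE subrK.
exists (fun s => c (rshift (size rels) s)).
rewrite (_ : (\sum_j c j *: _) = \sum_(j < size rels) c (lshift t j) *: rels`_j +
    \sum_s c (rshift (size rels) s) *: v s); last first.
  rewrite big_split_ord /=; congr (_ + _); apply: eq_bigr => j _.
    by rewrite nthl.
  by rewrite nthr.
have := glinD gl (\sum_(j < size rels) c (lshift t j) *: rels`_j)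
   (\sum_s c (rshift (size rels) s) *: v s) => /= ->.
rewrite sumv; set z := (X in X + _); rewrite (_ : z = 0) ?add0r //.
by apply/ker; exists (fun j => c (lshift t j)).
Qed.

End GradedLinear.

(** * Morphisms and exact sequences in high degrees *)

Section HighDegrees.
Variables (k : fieldType) (A : gradedAlg k).
Implicit Types (M N P : gradedMod A) (X Y Z W : qgr A) (i j n : int).

Lemma seq_bounded M (e : seq M) :
  exists n, forall (j : nat) i, n <= i -> comp i e`_j = 0.
Proof.
elim: e => [|x e [n nP]]; first by exists 0 => j i _; rewrite nth_nil comp0.
have [m mP] := comp_bounded x; exists (`|n| + `|m|) => -[|j] i ni /=.
  by apply: mP; lia.
by apply: nP; lia.
Qed.

(** M / U is spanned by finitely many elements, and each of these has components in
    finitely many degrees. *)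
Lemma cofinite_high M (U : set M) : (forall i x, U x -> U (comp i x)) ->
  cofinite U -> exists n, forall i x, n <= i -> U (comp i x).
Proof.
move=> UC [e eP]; have [n nP] := seq_bounded e; exists n => i x ni.
have [c /(UC i)] := eP x I; rewrite compB comp_sum big1 ?subr0 // => j _.
by rewrite compZ nP // scaler0.
Qed.

Lemma finite_dim_high M (E : set M) : finite_dim E ->
  exists n, forall i x, n <= i -> E x -> comp i x = 0.
Proof.
move=> [e eP]; have [n nP] := seq_bounded e; exists n => i x ni /eP[c].
move=> /subr0_eq ->; rewrite comp_sum big1 // => j _.
by rewrite compZ nP // scaler0.
Qed.

Lemma qdom_high M N (f : qhom M N) :
  exists n, forall i x, n <= i -> exists y, qrel f (comp i x) (comp i y).
Proof.
have [|n nP] := @cofinite_high M [set u | exists v, qrel f u v] _ (qrel_dom f).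
  by move=> i x [v xv]; exists (comp i v); exact: qrel_comp.
exists n => i x ni; have [v xv] := nP i x ni; exists v.
by rewrite -(compK i x); exact: qrel_comp.
Qed.

Lemma qindet_high M N (f : qhom M N) :
  exists n, forall i y, n <= i -> qrel f 0 y -> comp i y = 0.
Proof. exact: finite_dim_high (qrel_indet f). Qed.

Lemma qrelD M N (f : qhom M N) u u' v v' :
  qrel f u v -> qrel f u' v' -> qrel f (u + u') (v + v').
Proof. by move=> uv u'v'; have := qrel_lin 1 uv u'v'; rewrite !scale1r. Qed.

Lemma qrelZ M N (f : qhom M N) a u v : qrel f u v -> qrel f (a *: u) (a *: v).
Proof. by move=> uv; have := qrel_lin a uv (qrel0 f); rewrite !addr0. Qed.

Lemma qrelB M N (f : qhom M N) u u' v v' :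
  qrel f u v -> qrel f u' v' -> qrel f (u - u') (v - v').
Proof.
by move=> uv u'v'; apply: qrelD uv _; have := qrelZ (-1) u'v'; rewrite !scaleN1r.
Qed.

Lemma qrel_sum M N (f : qhom M N) (I : finType) (a : I -> A) (u : I -> M) (v : I -> N) :
  (forall l, qrel f (u l) (v l)) -> qrel f (\sum_l a l *: u l) (\sum_l a l *: v l).
Proof.
move=> uv; apply: (big_ind2 (qrel f)) => [|u1 v1 u2 v2|l _]; first exact: qrel0.
  exact: qrelD.
exact: qrelZ.
Qed.

(** D contains all components of large degree, and E has none. *)
Lemma qeq_high M N (f g : qhom M N) : qeq f g ->
  exists n, forall i x v w, n <= i -> qrel f x v -> qrel g x w -> comp i v = comp i w.
Proof.
move=> [D [E [DS Dc ES Ef fgP]]].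
have [n nP] := cofinite_high (let: And3 _ _ h := DS in h) Dc.
have [m mP] := finite_dim_high Ef.
exists (`|n| + `|m|) => i x v w ni xv xw.
have [_ _ /(_ (comp i v) (comp i w))] := fgP _ (nP i x ltac:(lia)).
move=> /(_ (qrel_comp i xv) (qrel_comp i xw)) /mP.
by move=> /(_ i ltac:(lia))/eqP; rewrite compB !compK subr_eq0 => /eqP.
Qed.

Lemma qeq_high2 M N (f g h : qhom M N) : qeq f h -> qeq g h ->
  exists n, forall i x v w, n <= i -> comp i x = x ->
    qrel f x v -> qrel g x w -> comp i v = comp i w.
Proof.
move=> /qeq_high[n nP] /qeq_high[m mP]; have [p pP] := qdom_high h.
exists (`|n| + `|m| + `|p|) => i x v w ni xi xv xw.
have [z] := pP i x ltac:(lia); rewrite xi => xz.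
by rewrite (nP i x v _ ltac:(lia) xv xz) (mP i x w _ ltac:(lia) xw xz).
Qed.

Hypothesis A_nonneg : forall i (a : A), i < 0 -> acomp i a = 0.
Hypothesis A_locfin : forall n, finite_dim (@below _ A (gfree1 A) n).

Lemma above_submod M n : graded_submod (@above _ A M n).
Proof.
split=> [i _|a x y xn yn i ni|i x xn j nj]; first exact: comp0.
  rewrite compD yn // addr0.
  have [s _ ->] := grading_sum (compP (gfree1 A)) (a : gfree1 A).
  rewrite scaler_suml comp_sum big1 // => j _.
  rewrite -[comp j _]/(acomp j a) scale_comp.
  have [j0|j0] := ltP j 0; first by rewrite A_nonneg // scale0r.
  by rewrite xn ?scaler0 //; lia.
by rewrite comp_comp; case: eqP => // ij; rewrite -ij xn.
Qed.

(** An element of [below n] is a combination of the generators whose coefficients may be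
    truncated to the components of A that land below degree n. *)
Lemma fp_below_finite M n : fin_presented M -> finite_dim (@below _ A M n).
Proof.
move=> [[m [d rels]] [g [gd gspan _ _]]].
have [e eP] := A_locfin (n + \sum_l `|tnth d l|).
apply: (@finite_dim_span _ _ _ _ ('I_m * 'I_(size e))%type (fun p => e`_p.2 *: g p.1)).
move=> x xn; have [u uE] := gspan x.
have /choice[lh lhP] l : exists p : A * A, [/\ u 0 l = p.1 + p.2,
    @below _ A (gfree1 A) (n - tnth d l) p.1 & @above _ A (gfree1 A) (n - tnth d l) p.2].
  have [a [b [? ? ?]]] := @cut_comp _ A (gfree1 A) (n - tnth d l) (u 0 l).
  by exists (a, b).
have x1E : x = \sum_l (lh l).1 *: g l.
  apply: comp_eq => i; have [ni|ni] := leP n i; last first.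
    rewrite uE !comp_sum; apply: eq_bigr => l _.
    rewrite !(comp_scale_hom _ _ (gd l)); have [-> _ h2] := lhP l.
    rewrite acompD; have := h2 (i - tnth d l) ltac:(lia).
    by rewrite -[comp _ _]/(acomp _ _) => ->; rewrite addr0.
  rewrite xn // comp_sum big1 // => l _; rewrite (comp_scale_hom _ _ (gd l)).
  have [_ h1 _] := lhP l; have := h1 (i - tnth d l) ltac:(lia).
  by rewrite -[comp _ _]/(acomp _ _) => ->; rewrite scale0r.
have /choice[c cP] l : exists c : 'I_(size e) -> k,
    (lh l).1 = \sum_j (c j)%:A *: (e`_j : gfree1 A).
  have [|c /subr0_eq cE] := eP (lh l).1; last by exists c.
  have [_ h1 _] := lhP l; apply: below_le h1.
  have : `|tnth d l| <= \sum_l `|tnth d l|.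
    by rewrite (bigD1 l) //= lerDl; apply: sumr_ge0.
  lia.
exists (fun p => c p.1 p.2); rewrite x1E.
rewrite -(pair_big xpredT xpredT (fun (l : 'I_m) (j : 'I_(size e)) => (c l j)%:A *: ((e`_j : A) *: g l))) /=.
apply: eq_bigr => l _; rewrite cP scaler_suml; apply: eq_bigr => j _.
by rewrite [in LHS]/GRing.scale /= scalerA.
Qed.

Lemma hom_finite M i : fin_presented M -> finite_dim (@hom _ A M i).
Proof.
move=> Mfp; apply: finite_dimS (fp_below_finite (i + 1) Mfp) => x.
exact: hom_below.
Qed.

Lemma hom_basis M i : fin_presented M -> exists m, has_dim (@hom _ A M i) m.
Proof. by move=> Mfp; apply: basis_exists; [exact: hom_ksubspace | exact: hom_finite]. Qed.

Lemma high_cofinite M (U : set M) n : fin_presented M -> graded_submod U ->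
  (forall i x, n <= i -> U (comp i x)) -> cofinite U.
Proof.
move=> /(fp_below_finite n)[e eP] US Un; exists e => x _.
have [l [h [-> ln hn]]] := cut_comp n x; have [c /subr0_eq cE] := eP l ln.
exists c; rewrite -cE addrAC subrr add0r; apply: (mem_of_comp US) => i.
have [/Un //|ni] := leP n i; rewrite hn //.
by case: US.
Qed.

Lemma high_finite M (E : set M) n : fin_presented M ->
  (forall i x, n <= i -> E x -> comp i x = 0) -> finite_dim E.
Proof.
by move=> /(fp_below_finite n) Mn En; apply: finite_dimS Mn => x Ex i /En ->.
Qed.

(** The differences of values of f and g on the elements of degree >= m lie in the sum E
    of the two indeterminacies; E is a submodule, and it is finite dimensional because it
    vanishes in large degrees. *)
Lemma high_qeq X Y (f g : qhom X Y) n :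
    (forall i x v w, n <= i -> qrel f x v -> qrel g x w -> comp i v = comp i w) ->
  qeq f g.
Proof.
move=> fg; have [p pP] := qdom_high f; have [q qP] := qdom_high g.
have [p' p'P] := qindet_high f; have [q' q'P] := qindet_high g.
pose m := `|n| + `|p| + `|q|.
pose E : set Y := [set v | exists v1 v2, [/\ v = v1 + v2, qrel f 0 v1 & qrel g 0 v2]].
have ES : graded_submod E.
  split=> [|a _ _ [v1 [v2 [-> fv gv]]] [w1 [w2 [-> fw gw]]]|i _ [v1 [v2 [-> fv gv]]]].
  - by exists 0, 0; rewrite addr0; split=> //; exact: qrel0.
  - exists (a *: v1 + w1), (a *: v2 + w2); rewrite scalerDr addrACA; split=> //.
      by have := qrel_lin a fv fw; rewrite scaler0 addr0.
    by have := qrel_lin a gv gw; rewrite scaler0 addr0.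
  exists (comp i v1), (comp i v2); rewrite compD; split=> //.
    by have := qrel_comp i fv; rewrite comp0.
  by have := qrel_comp i gv; rewrite comp0.
have domS (h : qhom X Y) : graded_submod [set u | exists v, qrel h u v].
  split=> [|a u u' [v uv] [v' uv']|i u [v uv]]; first by exists 0; exact: qrel0.
    by exists (a *: v + v'); exact: qrel_lin.
  by exists (comp i v); exact: qrel_comp.
exists (@above _ A X m), E; split=> //.
- exact: above_submod.
- apply: (@high_cofinite _ _ m (qgr_fp X) (above_submod _ _)) => i x mi j jm.
  by rewrite comp_comp; case: eqP => // ij; lia.
- apply: (@high_finite _ _ (`|p'| + `|q'|) (qgr_fp Y)) => i _ ni [v [w [-> fv gw]]].
  by rewrite compD (p'P i v ltac:(lia) fv) (q'P i w ltac:(lia) gw) addr0.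
move=> u um.
have dom (h : qhom X Y) l : l <= m ->
    (forall i x, l <= i -> exists y, qrel h (comp i x) (comp i y)) ->
    exists v, qrel h u v.
  move=> lm lP; apply: (mem_of_comp (domS h)) => i.
  have [mi|im] := leP m i; last by rewrite um //; exists 0; exact: qrel0.
  by have [y ?] := lP i u ltac:(lia); exists (comp i y).
split; [apply: (dom f p) => //; lia | apply: (dom g q) => //; lia |].
move=> v w uv uw; apply: (mem_of_comp ES) => i; rewrite compB.
have [ni|ni] := leP m i.
  by rewrite (fg i u v w ltac:(lia) uv uw) subrr; case: ES.
exists (comp i v), (- comp i w); split=> //.
  by have := qrel_comp i uv; rewrite um.
by have := qrelZ (-1) (qrel_comp i uw); rewrite um // !scaleN1r oppr0.
Qed.

Section MakeMorphism.
Variables (X Y : qgr A) (R : X -> Y -> Prop) (n : int).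
Hypothesis R0 : R 0 0.
Hypothesis R_lin : forall a u u' v v', R u v -> R u' v' -> R (a *: u + u') (a *: v + v').
Hypothesis R_comp : forall i u v, R u v -> R (comp i u) (comp i v).
Hypothesis R_dom : forall i u, n <= i -> exists v, R (comp i u) v.
Hypothesis R_indet : forall i v, n <= i -> R 0 v -> comp i v = 0.

Lemma high_dom_cofinite : cofinite [set u | exists v, R u v].
Proof.
apply: (@high_cofinite _ _ n (qgr_fp X)) => // [].
split=> [|a u u' [v uv] [v' uv']|i u [v uv]]; first by exists 0.
  by exists (a *: v + v'); exact: R_lin.
by exists (comp i v); exact: R_comp.
Qed.

Lemma high_indet_finite : finite_dim [set v | R 0 v].
Proof. exact: (@high_finite _ _ n (qgr_fp Y)). Qed.

Definition high_qhom : qhom X Y :=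
  QHom R0 R_lin R_comp high_dom_cofinite high_indet_finite.

End MakeMorphism.

Section LinearMorphism.
Variables (M N : gradedMod A) (f : M -> N).
Hypothesis fP : graded_linear f.

Lemma qlin_lin a u u' v v' : v = f u -> v' = f u' -> a *: v + v' = f (a *: u + u').
Proof. by move=> -> ->; rewrite fP.1. Qed.

Lemma qlin_comp i u v : v = f u -> comp i v = f (comp i u).
Proof. by move=> ->; rewrite fP.2. Qed.

Lemma qlin_dom : cofinite [set u | exists v, v = f u].
Proof. by exists [::] => x _; exists (fun=> 0); eexists. Qed.

Lemma qlin_indet : finite_dim [set v | v = f 0].
Proof.
by exists [::] => v ->; exists (fun=> 0); rewrite big_ord0 subr0; exact: glin0.
Qed.

Definition qlin : qhom M N :=
  @QHom _ _ M N (fun u v => v = f u) (esym (glin0 fP)) qlin_lin qlin_comp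
    qlin_dom qlin_indet.

End LinearMorphism.

(** A morphism into Y killed by g is corestricted along f, and a morphism out of Y that
    kills f is pushed along g, as relations; exactness is only needed in the degrees where
    the resulting relation has to be total and single-valued. *)
Lemma linear_short_exact X Y Z (f : X -> Y) (g : Y -> Z) n
    (fP : graded_linear f) (gP : graded_linear g) :
  injective f -> (forall z, exists y, g y = z) -> (forall x, g (f x) = 0) ->
  (forall i y, n <= i -> comp i y = y -> g y = 0 -> exists x, f x = y) ->
  short_exact (qlin fP) (qlin gP).
Proof.
move=> finj gsurj gf exY.
have f0 x : f x = 0 -> x = 0 by rewrite -(glin0 fP) => /finj.
split.
  split=> [|W h /qeq_high[m mP]].
    by apply: (@high_qeq _ _ _ _ 0) => i x _ _ _ [_ /= -> ->] ->; rewrite gf.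
  have [p pP] := qdom_high h; have [q qP] := qindet_high h.
  pose R (w : W) (x : X) := qrel h w (f x).
  have R0 : R 0 0 by rewrite /R (glin0 fP); exact: qrel0.
  have RL a u u' v v' : R u v -> R u' v' -> R (a *: u + u') (a *: v + v').
    by rewrite /R fP.1; exact: qrel_lin.
  have RC i u v : R u v -> R (comp i u) (comp i v).
    by rewrite /R fP.2; exact: qrel_comp.
  have RD i u : `|n| + `|m| + `|p| + `|q| <= i -> exists v, R (comp i u) v.
    move=> ni; have [v uv] := pP i u ltac:(lia).
    have gv0 : g (comp i v) = 0.
      have := mP i (comp i u) (g (comp i v)) 0 ltac:(lia) ltac:(by exists (comp i v)).
      by move=> /(_ erefl); rewrite comp0 -gP.2 compK.
    have [x xv] := exY i (comp i v) ltac:(lia) (compK _ _) gv0.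
    by exists x; rewrite /R xv.
  have RI i v : `|n| + `|m| + `|p| + `|q| <= i -> R 0 v -> comp i v = 0.
    by move=> ni /(qP i _ ltac:(lia)); rewrite -fP.2 => /f0.
  exists (high_qhom R0 RL RC RD RI); split.
    apply: (@high_qeq _ _ _ _ q) => i x v w qi [u /= xu ->] xw.
    have := qP i (f u - w) qi; rewrite compB => E; apply/subr0_eq/E.
    by have := qrelB xu xw; rewrite subrr.
  move=> u' /qeq_high[s sP].
  apply: (@high_qeq _ _ _ _ s) => i x v w si xv xw; apply: finj; rewrite !fP.2.
  by apply: sP si _ xw; exists v.
split=> [|W h /qeq_high[m mP]].
  by apply: (@high_qeq _ _ _ _ 0) => i x _ _ _ [_ /= -> ->] ->; rewrite gf.
have [p pP] := qdom_high h; have [q qP] := qindet_high h.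
have hg i y w : `|n| + `|m| + `|p| + `|q| <= i -> g y = 0 -> qrel h y w -> comp i w = 0.
  move=> ni gy yw.
  have [x xE] : exists x, f x = comp i y.
    by apply: (exY i); rewrite ?compK // ?gP.2 ?gy ?comp0 //; lia.
  have := mP i x (comp i w) 0 ltac:(lia); rewrite compK comp0; apply=> //.
  by exists (comp i y); [rewrite /= xE | exact: qrel_comp].
pose R (z : Z) (w : W) := exists2 y, g y = z & qrel h y w.
have R0 : R 0 0 by exists 0; [exact: glin0 | exact: qrel0].
have RL a u u' v v' : R u v -> R u' v' -> R (a *: u + u') (a *: v + v').
  move=> [y <- yv] [y' <- yv']; exists (a *: y + y'); first by rewrite gP.1.
  exact: qrel_lin.
have RC i u v : R u v -> R (comp i u) (comp i v).
  by move=> [y <- yv]; exists (comp i y); [rewrite gP.2 | exact: qrel_comp].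
have RD i u : `|n| + `|m| + `|p| + `|q| <= i -> exists v, R (comp i u) v.
  move=> ni; have [y <-] := gsurj u; have [v yv] := pP i y ltac:(lia).
  by exists (comp i v), (comp i y); [rewrite gP.2|].
have RI i v : `|n| + `|m| + `|p| + `|q| <= i -> R 0 v -> comp i v = 0.
  by move=> ni [y gy yv]; exact: hg gy yv.
exists (high_qhom R0 RL RC RD RI); split.
  apply: (@high_qeq _ _ _ _ (`|n| + `|m| + `|p| + `|q|)) => i y v w ni.
  move=> [_ /= -> [y' gy' y'v]] yw.
  have := hg i (y' - y) (v - w) ni; rewrite compB => E; apply/subr0_eq/E.
    by rewrite (glinB gP) gy' subrr.
  exact: qrelB.
move=> u' /qeq_high[s sP].
apply: (@high_qeq _ _ _ _ s) => i z v w si zv [y gy yw].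
by apply: sP si _ yw; exists (g y); rewrite ?gy.
Qed.

Hypothesis A_generated : forall M, fin_presented M -> exists n, forall m i x,
  n <= m -> m <= i -> comp i x = x -> exists s : seq (A * M),
    (forall p, p \in s -> comp m p.2 = p.2) /\ x = \sum_(p <- s) p.1 *: p.2.

(** A concrete cokernel.  The image of f need not be visibly finitely generated, but in
    large degrees it is the submodule generated by the values of f on one component X_N,
    which is finite dimensional; the quotient by it is finitely presented, hence an object
    on which the universal property of an abstract cokernel can be tested. *)
Lemma cokernel_test X Y (f : qhom X Y) : exists (C : qgr A) (p : Y -> C),
  [/\ graded_linear p,
      exists n, forall i x v, n <= i -> qrel f x v -> p (comp i v) = 0
    & forall i y, comp i y = y -> p y = 0 -> exists2 x, comp i x = x & qrel f x y].
Proof.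
have [n nP] := A_generated (qgr_fp X).
have [d dP] := qdom_high f; have [q qP] := qindet_high f.
pose N := `|n| + `|d| + `|q|.
have [t [e [eN espan _]]] := hom_basis N (qgr_fp X).
have /choice[y yP] s : exists y, qrel f (e s) y /\ comp N y = y.
  have [y] := dP N (e s) ltac:(lia); rewrite eN => ey.
  by exists (comp N y); rewrite compK.
pose U : set Y := [set x | exists b : 'I_t -> A, x = \sum_s b s *: y s].
have US : graded_submod U.
  split=> [|a _ _ [b ->] [c ->]|i _ [b ->]].
  - by exists (fun=> 0); rewrite big1 // => s _; rewrite scale0r.
  - exists (fun s => a * b s + c s); rewrite scaler_sumr -big_split.
    by apply: eq_bigr => s _; rewrite scalerDl scalerA.
  exists (fun s => acomp (i - N) (b s)); rewrite comp_sum; apply: eq_bigr => s _.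
  by rewrite (comp_scale_hom _ _ (yP s).2).
have Cfp := gquot_fp US (e := fun=> N) (fun s => (yP s).2) (fun x => iff_refl _) (qgr_fp Y).
exists (QGr Cfp), (gproj US); split; first exact: gproj_linear.
  exists N => i x v Ni xv; apply/gproj_eq0.
  have [s [sN xE]] := nP N i (comp i x) ltac:(lia) Ni (compK _ _).
  have [b bE] : exists b : 'I_t -> A, comp i x = \sum_s b s *: e s.
    rewrite xE; elim: s sN {xE} => [|p s IHs] sN.
      by exists (fun=> 0); rewrite big_nil big1 // => l _; rewrite scale0r.
    have [|b bE] := IHs; first by move=> p' ps; apply: sN; rewrite inE ps orbT.
    have [c cE] := espan p.2 (sN p (mem_head _ _)).
    exists (fun l => p.1 * (c l)%:A + b l); rewrite big_cons bE cE scaler_sumr -big_split.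
    by apply: eq_bigr => l _; rewrite /= scalerDl scalerA.
  have xy := qrel_sum b (fun s => (yP s).1).
  have := qP i (comp i v - \sum_s b s *: y s) ltac:(lia).
  have := qrelB (qrel_comp i xv) xy; rewrite bE subrr => E /(_ E)/eqP.
  rewrite compB compK subr_eq0 => /eqP ->.
  by have [_ _] := US; apply; exists b.
move=> i v vi /gproj_eq0[b bE]; exists (comp i (\sum_s b s *: e s)); first exact: compK.
have := qrel_comp i (qrel_sum b (fun s => (yP s).1)).
by rewrite -bE vi.
Qed.

Hypothesis A_torsion_free : forall M, fin_presented M -> exists n, forall i (x : M),
  n <= i -> comp i x = x ->
  (exists m, forall j a, m <= j -> acomp j a *: x = 0) -> x = 0.

(** Injectivity of f is tested on the maps a |-> a x from a twist of A, which f kills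
    when it kills x: uniqueness of factorizations makes a x vanish for a of large degree,
    and x = 0 because X has no torsion in large degrees.  The bound on deg a depends on x,
    which is why torsion-freeness is required.  Exactness at Y and surjectivity of g are
    tested on the concrete cokernels of f and of g. *)
Lemma short_exact_high X Y Z (f : qhom X Y) (g : qhom Y Z) : short_exact f g ->
  exists n, forall i, n <= i ->
  [/\ forall x, comp i x = x -> qrel f x 0 -> x = 0,
      forall x y, comp i x = x -> comp i y = y -> qrel f x y -> qrel g y 0,
      forall y, comp i y = y -> qrel g y 0 -> exists2 x, comp i x = x & qrel f x y
    & forall z, comp i z = z -> exists2 y, comp i y = y & qrel g y z].
Proof.
move=> [[gf0 kerf] [_ cokg]].
have [n1 inj] : exists n, forall i x, n <= i -> comp i x = x -> qrel f x 0 -> x = 0.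
  have [n nP] := A_torsion_free (qgr_fp X); exists n => i x ni xi fx0.
  apply: (nP i) => //.
  (* One generator, in the degree of x, so that a |-> a x preserves degrees. *)
  pose W := @qfree _ A 1 (fun=> i).
  have hP : graded_linear (fun u : W => \sum_(l < 1) u 0 l *: x).
    exact: (@gfree_map _ A 1 (fun=> i) X (fun=> x)).
  have [q qP] := qindet_high g; have [q' q'P] := qindet_high f.
  have [|u [_ uniq]] := kerf W (qzero W Y).
    by apply: (@high_qeq _ _ _ _ q) => j w v _ qj [_ -> gv] ->; rewrite comp0; exact: qP.
  have hu : qeq (qlin hP) u.
    apply: uniq; apply: (@high_qeq _ _ _ _ q') => j w v _ qj [_ -> fv] ->.
    rewrite comp0; apply: q'P => //.
    have := qrelB fv (qrelZ (w 0 0) fx0).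
    by rewrite big_ord1 scaler0 subrr subr0.
  have zu : qeq (qzero W X) u.
    apply: uniq; apply: (@high_qeq _ _ _ _ q') => j w v _ qj [_ -> fv] ->.
    by rewrite comp0; exact: q'P.
  have [m mP] := qeq_high2 hu zu; exists (`|m| + `|i|) => j a mj.
  have := mP (j + i) (\row_(l < 1) acomp j a : W) (acomp j a *: x) 0 ltac:(lia).
  rewrite comp0 (comp_scale_hom _ _ xi) addrK acomp_comp eqxx; apply=> //.
    by apply/rowP => l; rewrite !mxE addrK acomp_comp eqxx.
  by rewrite /= big_ord1 mxE.
have [n2 gf] : exists n, forall i x y, n <= i -> comp i x = x -> comp i y = y ->
    qrel f x y -> qrel g y 0.
  have [n nP] := qeq_high gf0; have [m mP] := qdom_high g.
  exists (`|n| + `|m|) => i x y ni xi yi xy.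
  have [w] := mP i y ltac:(lia); rewrite yi => yw.
  have := nP i x (comp i w) 0 ltac:(lia); rewrite compK comp0 => <- //.
  by exists y.
have [n3 exY] : exists n, forall i y, n <= i -> comp i y = y -> qrel g y 0 ->
    exists2 x, comp i x = x & qrel f x y.
  have [C [p [pP [m mP] pex]]] := cokernel_test f.
  have [|u [/qeq_high[s sP] _]] := cokg C (qlin pP).
    apply: (@high_qeq _ _ _ _ m) => j x _ _ mj [y xy ->] ->.
    by rewrite comp0 -pP.2; exact: mP mj xy.
  exists s => i y si yi yg; apply: pex => //.
  have := sP i y 0 (p y) si; rewrite comp0 -pP.2 yi => <- //.
  by exists 0 => //; exact: qrel0.
have [n4 gsurj] : exists n, forall i z, n <= i -> comp i z = z ->
    exists2 y, comp i y = y & qrel g y z.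
  have [C [p [pP [m mP] pex]]] := cokernel_test g.
  have [|u [_ uniq]] := cokg C (qzero Y C).
    by apply: (@high_qeq _ _ _ _ 0) => j x v _ _ [y _ ->] ->.
  have pu : qeq (qlin pP) u.
    apply: uniq; apply: (@high_qeq _ _ _ _ m) => j x _ _ mj [y xy ->] ->.
    by rewrite comp0 -pP.2; exact: mP mj xy.
  have zu : qeq (qzero Z C) u.
    by apply: uniq; apply: (@high_qeq _ _ _ _ 0) => j x _ _ _ [y _ ->] ->.
  have [s sP] := qeq_high2 pu zu; exists s => i z si zi; apply: pex => //.
  by have := sP i z (p z) 0 si zi erefl erefl; rewrite comp0 -pP.2 zi.
exists (`|n1| + `|n2| + `|n3| + `|n4|) => i ni; split.
- by move=> x; apply: inj; lia.
- by move=> x y; apply: gf; lia.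
- by move=> y; apply: exY; lia.
by move=> z; apply: gsurj; lia.
Qed.

Lemma short_exact_dim X Y Z (f : qhom X Y) (g : qhom Y Z) : short_exact f g ->
  exists n, forall i a c, n <= i ->
    has_dim (@hom _ A X i) a -> has_dim (@hom _ A Z i) c -> has_dim (@hom _ A Y i) (a + c).
Proof.
move=> /short_exact_high[n nP]; have [m mP] := qindet_high f; have [p pP] := qindet_high g.
have [s sP] := qdom_high f; have [t tP] := qdom_high g.
exists (`|n| + `|m| + `|p| + `|s| + `|t|) => i a c ni.
have [inj gf exY gsurj] := nP i ltac:(lia).
apply: (@has_dim_exact _ A X Y Z (qrel f) (qrel g)); try exact: hom_ksubspace;
  try exact: qrel0; try by move=> *; exact: qrel_lin.
- move=> x xi; have [y] := sP i x ltac:(lia); rewrite xi => xy.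
  by exists (comp i y); rewrite // /hom /= compK.
- move=> x xi; have [y] := tP i x ltac:(lia); rewrite xi => xy.
  by exists (comp i y); rewrite // /hom /= compK.
- by move=> v <- /(mP i _ ltac:(lia)); rewrite compK.
- by move=> v <- /(pP i _ ltac:(lia)); rewrite compK.
- exact: inj.
- exact: gf.
- exact: exY.
- exact: gsurj.
Qed.

End HighDegrees.

(** * Words and the algebra k<x, y> / (y ^ (r + 1)) *)

Section MonomialPresentation.
Variables (k : fieldType) (A : gradedAlg k) (x y : A) (r : nat).

(** The properties of k<x, y> / (y ^ (r + 1)) on which the structure of its modules rests. *)
Record xy_monomial : Prop := XYMonomial {
  xy_degx : acomp 1 x = x;
  xy_degy : acomp 1 y = y;
  xy_nilp : y ^+ r.+1 = 0;
  xy_ind : forall P : A -> Prop, P 1 -> (forall (t : k) a b, P a -> P b -> P (t *: a + b)) ->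
    (forall a, P a -> P (x * a)) -> (forall a, P a -> P (y * a)) -> forall b, P b;
  xy_unique : forall n (f : nat -> A) b,
    \sum_(j < n) y ^+ j * x * f j + y ^+ n * b = 0 ->
    forall j, (j < n)%N -> (j <= r)%N -> f j = 0
}.

End MonomialPresentation.

Section Words.
Variables (k : fieldType) (r : nat).
Local Notation F := (free_alg k).
Local Notation B := (xy_alg k r).
Local Notation proj := (qproj (free_y_proper k r)).
Implicit Types (w u v : seq bool) (a b : B) (c : bool).

Definition free_word w : F := << FMonom w >>.

Lemma malgU_scale (t : k) w : << t *g FMonom w >> = t *: free_word w.
Proof. by apply/malgP => u; rewrite [LHS]mcoeffU [RHS]mcoeffZ mcoeffU; case: (_ == _); rewrite ?mulr1 ?mulr0. Qed.

Lemma free_wordM u v : free_word u * free_word v = free_word (u ++ v).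
Proof.
rewrite /free_word malgM_def fgmulUU mulr1; congr << _ *g _ >>.
by apply/eqP; rewrite fmP /= fmM.
Qed.

Lemma free_wordX w n : free_word w ^+ n = free_word (flatten (nseq n w)).
Proof.
elim: n => [|n IHn]; last by rewrite exprS IHn free_wordM.
by rewrite expr0 /free_word -fmoneE.
Qed.

Lemma free_y_word n : free_y k ^+ n = free_word (nseq n true).
Proof.
rewrite /free_y (fmuE true) -/(free_word [:: true]) free_wordX.
by congr free_word; elim: n => //= n ->.
Qed.

Lemma free_coef_cons c c' w (a : F) :
  (free_word [:: c] * a)@_(FMonom (c' :: w)) = if c == c' then a@_(FMonom w) else 0.
Proof.
rewrite /free_word malgM_def fgmulUg raddf_sum /= [in RHS](monalgE a) raddf_sum /=.
rewrite -[RHS]mulrb -sumrMnl; apply: eq_bigr => u _.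
rewrite mul1r !mcoeffU -mulrnA mulnb; congr (_ *+ (nat_of_bool _)).
by rewrite fmP fmM /= eqseq_cons andbC fmP.
Qed.

Lemma free_coef_nil c (a : F) : (free_word [:: c] * a)@_(FMonom [::]) = 0.
Proof.
rewrite /free_word malgM_def fgmulUg raddf_sum /= big1 // => u _.
by rewrite mcoeffU; case: eqP => // /eqP; rewrite fmP fmM.
Qed.

Definition bad_word w := infix (nseq r.+1 true) w.

Lemma bad_cons c w : bad_word w -> bad_word (c :: w).
Proof. by rewrite /bad_word /= => ->; rewrite orbT. Qed.

Lemma bad_yx j w : (j <= r)%N -> bad_word (nseq j true ++ false :: w) = bad_word w.
Proof.
elim: j => [|j IHj] jr //=; rewrite {1}/bad_word /= -/(bad_word _) IHj; last exact: ltnW.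
case E : prefix => //=; have /prefixP[s] := E.
move=> /(congr1 (nth true^~ j)); rewrite nth_cat size_nseq ltnn subnn /=.
by rewrite nth_cat size_nseq jr nth_nseq jr.
Qed.

Lemma bad_y j : bad_word (nseq j true) = (r < j)%N.
Proof.
apply/idP/idP => [/size_infix|rj]; first by rewrite !size_nseq.
by rewrite /bad_word -(subnKC rj) nseqD prefix_infix.
Qed.

(** The ideal is spanned by the words that have y ^ (r + 1) as a factor. *)
Lemma ideal_coef (a : F) w : a \in principal_ideal (free_y k ^+ r.+1) ->
  ~~ bad_word w -> a@_(FMonom w) = 0.
Proof.
move=> /asboolP[s ->]; apply: contraNeq; rewrite raddf_sum /= => s0.
have /hasP[[a1 a2] _] : has (fun p => (p.1 * free_y k ^+ r.+1 * p.2)@_(FMonom w) != 0) s.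
  apply: contraNT s0 => /hasPn /= s0; rewrite big_seq big1 // => p ps.
  by apply/eqP/negPn; exact: s0.
rewrite /= mcoeff_neq0 free_y_word => /msuppM_le[u [v [/msuppM_le[u1 [u2 []]] _]]].
rewrite msuppU1 in_fset1 => /eqP -> -> _ /eqP; rewrite fmP !fmM /= => /eqP ->.
by rewrite -catA; exact: infix_infix.
Qed.

Lemma coef_ideal (a : F) : (forall w, ~~ bad_word w -> a@_(FMonom w) = 0) ->
  a \in principal_ideal (free_y k ^+ r.+1).
Proof.
move=> a0; rewrite (monalgE a); apply: rpred_sum => -[w] _.
have [wbad|/a0 ->] := boolP (bad_word w); last by rewrite monalgU0 rpred0.
have /infixP[p [s ->]] := wbad; set c := a@_ _.
have -> : << c *g FMonom (p ++ nseq r.+1 true ++ s) >> =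
    (c *: free_word p) * (free_y k ^+ r.+1) * free_word s.
  by rewrite free_y_word -!scalerAl !free_wordM -catA malgU_scale.
by apply/asboolP; exists [:: (c *: free_word p, free_word s)]; rewrite big_seq1.
Qed.

Definition word w : B := proj (free_word w).

Lemma word_cat u v : word (u ++ v) = word u * word v.
Proof. by rewrite /word -free_wordM -qprojrM. Qed.

Lemma word_nil : word [::] = 1.
Proof. by rewrite /word /free_word -fmoneE. Qed.

Local Notation x := (word [:: false]).
Local Notation y := (word [:: true]).

Lemma word_cons c w : word (c :: w) = word [:: c] * word w.
Proof. by rewrite -word_cat. Qed.

Lemma word_yX n : word (nseq n true) = y ^+ n.
Proof. by elim: n => [|n IHn]; rewrite ?word_nil // exprS -IHn -word_cons. Qed.

Lemma acomp_word w : acomp (size w)%:Z (word w) = word w.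
Proof.
rewrite /= /word qcomp_xyE fcomp_id // => u.
by rewrite msuppU1 in_fset1 => /eqP ->.
Qed.

Lemma word_ind (P : B -> Prop) : P 0 -> (forall a b, P a -> P b -> P (a + b)) ->
  (forall (t : k) w, P (t *: word w)) -> forall b, P b.
Proof.
move=> P0 PD Pw b; rewrite -[b](qreprK (z_proper := free_y_proper k r)).
rewrite (monalgE (qrepr b)) raddf_sum /=.
apply: (big_ind P) => // -[w] _.
by rewrite malgU_scale qprojlZ; exact: Pw.
Qed.

(** The coordinates of B in the basis of the words without factor y ^ (r + 1); on the
    remaining words the representative is not unique, and the value is set to 0. *)
Definition coef w b : k := if bad_word w then 0 else (qrepr b)@_(FMonom w).

Lemma coef_proj w (a : F) : coef w (proj a) = if bad_word w then 0 else a@_(FMonom w).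
Proof.
rewrite /coef; case: ifPn => // wgood; apply/eqP; rewrite -subr_eq0 -mcoeffB.
apply/eqP/ideal_coef => //.
by rewrite -(qproj_eq (free_y_proper k r)) qreprK.
Qed.

Lemma coefP b : (forall w, coef w b = 0) -> b = 0.
Proof.
rewrite -[b](qreprK (z_proper := free_y_proper k r)) => b0.
apply/eqP; rewrite -(raddf0 proj) qproj_eq subr0; apply: coef_ideal => w wgood.
by have := b0 w; rewrite coef_proj (negPf wgood).
Qed.

Lemma coefD w a b : coef w (a + b) = coef w a + coef w b.
Proof.
rewrite -[a](qreprK (z_proper := free_y_proper k r)).
rewrite -[b](qreprK (z_proper := free_y_proper k r)) -raddfD !coef_proj mcoeffD.
by case: ifP; rewrite ?addr0.
Qed.

Lemma coefZ w (t : k) b : coef w (t *: b) = t * coef w b.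
Proof.
rewrite -[b](qreprK (z_proper := free_y_proper k r)) -qprojlZ !coef_proj mcoeffZ.
by case: ifP; rewrite ?mulr0.
Qed.

Lemma coef0 w : coef w 0 = 0.
Proof. by rewrite -(scale0r 1) coefZ mul0r. Qed.

Lemma coef_sum (I : Type) (s : seq I) (P : pred I) (f : I -> B) w :
  coef w (\sum_(i <- s | P i) f i) = \sum_(i <- s | P i) coef w (f i).
Proof. by apply: (big_morph (coef w)); [exact: coefD | exact: coef0]. Qed.

Lemma coef_letter c w b : coef w (word [:: c] * b) =
  if bad_word w then 0 else
  if w is c' :: w' then if c == c' then coef w' b else 0 else 0.
Proof.
rewrite -[b](qreprK (z_proper := free_y_proper k r)) -qprojrM coef_proj.
case: ifPn => //; case: w => [|c' w]; first by rewrite free_coef_nil.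
rewrite free_coef_cons coef_proj => w'good; case: eqP => // _; rewrite ifN //.
by apply: contraNN w'good; exact: bad_cons.
Qed.

Lemma coef_yx i j w b : (i <= r)%N -> (j <= r)%N ->
  coef (nseq j true ++ false :: w) (y ^+ i * x * b) = if i == j then coef w b else 0.
Proof.
move=> ir jr; rewrite -mulrA; elim: i j ir jr => [|i IHi] [|j] ir jr.
- rewrite mul1r coef_letter (bad_yx w jr) /=.
  by rewrite /coef; case: (bad_word w).
- by rewrite mul1r coef_letter /= if_same.
- by rewrite exprS -mulrA coef_letter /= if_same.
rewrite exprS -mulrA coef_letter (bad_yx _ jr) /= IHi 1?ltnW // eqSS.
by rewrite /coef; case: (bad_word w); rewrite ?if_same.
Qed.

Lemma coef_yx_yX i j w b : (j < i)%N -> coef (nseq j true ++ false :: w) (y ^+ i * b) = 0.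
Proof.
elim: i j => [//|i IHi] [|j] ji; rewrite exprS -mulrA coef_letter /=.
  by rewrite if_same.
by rewrite IHi // if_same.
Qed.

Lemma yX_eq0 : y ^+ r.+1 = 0 :> B.
Proof.
apply: coefP => w; rewrite -word_yX coef_proj mcoeffU1 fmP /=.
case: ifPn => // wgood; case: eqP => // wE.
by case/negP: wgood; rewrite -[w]wE; have := bad_y r.+1; rewrite ltnSn.
Qed.

(** The words starting with y ^ j x, j <= r, occur in no other term of the sum. *)
Lemma left_unique n (f : nat -> B) b :
    \sum_(j < n) y ^+ j * x * f j + y ^+ n * b = 0 ->
  forall j, (j < n)%N -> (j <= r)%N -> f j = 0.
Proof.
move=> E j jn jr; apply: coefP => w.
have /eqP := congr1 (coef (nseq j true ++ false :: w)) E.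
rewrite coefD coef_yx_yX // addr0 coef0 coef_sum (bigD1 (Ordinal jn)) //=.
rewrite big1 => [|i ij]; first rewrite addr0 (coef_yx w (f j) jr jr) eqxx => /eqP //.
have ji : i != j :> nat by apply: contra ij => /eqP ij; apply/eqP/val_inj.
have [ir|ri] := leqP i r; first by rewrite coef_yx // (negPf ji).
by rewrite -mulrA coef_yx_yX // (leq_ltn_trans jr).
Qed.

Lemma xy_alg_monomial : xy_monomial (A := B) x y r.
Proof.
split.
- exact: (acomp_word [:: false]).
- exact: (acomp_word [:: true]).
- exact: yX_eq0.
- move=> P P1 PD Px Py; have P0 : P 0.
    by rewrite -(addNr 1) -scaleN1r; exact: PD.
  elim/word_ind => [//|a b Pa Pb|t w]; first by rewrite -[a]scale1r; exact: PD.
  rewrite -[_ *: _]addr0; apply: PD P0; elim: w => [|c w IHw]; first by rewrite word_nil.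
  by rewrite word_cons; case: c; [exact: Py | exact: Px].
- exact: left_unique.
Qed.

End Words.

(** * Finitely presented modules beyond their generators and relations *)

Section Structure.
Variables (k : fieldType) (B : gradedAlg k) (x y : B) (r : nat).
Hypothesis Bxy : xy_monomial x y r.
Implicit Types (M : gradedMod B) (N D : int) (a b : B).

Let acomp_x : acomp 1 x = x. Proof. exact: xy_degx Bxy. Qed.
Let acomp_y : acomp 1 y = y. Proof. exact: xy_degy Bxy. Qed.

Lemma acomp_scalar i (t : k) : i != 0 -> acomp i (t *: 1 : B) = 0.
Proof. by move=> i0; rewrite acompZ -acomp1 acomp_comp (negPf i0) scaler0. Qed.

Lemma acomp_yX (j : nat) : acomp j (y ^+ j) = y ^+ j.
Proof.
elim: j => [|j IHj]; first exact: acomp1.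
by rewrite exprS -[in LHS]acomp_y mul_acomp acomp_y (_ : _ - 1 = j%:Z) ?IHj //; lia.
Qed.

Lemma acomp_xX (j : nat) : acomp j (x ^+ j) = x ^+ j.
Proof.
elim: j => [|j IHj]; first exact: acomp1.
by rewrite exprS -[in LHS]acomp_x mul_acomp acomp_x (_ : _ - 1 = j%:Z) ?IHj //; lia.
Qed.

Lemma acomp_yxX (j : nat) : acomp (j%:Z + 1) (y ^+ j * x) = y ^+ j * x.
Proof. by rewrite -acomp_yX mul_acomp (_ : _ - _ = 1) ?acomp_x //; lia. Qed.

Lemma left_split b : exists (t : k) a a', b = t *: 1 + x * a + y * a'.
Proof.
elim/(xy_ind Bxy): b => [|t a b [t1 [a1 [a1' ->]]] [t2 [a2 [a2' ->]]]|a _|a _].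
- by exists 1, 0, 0; rewrite scale1r !mulr0 !addr0.
- exists (t * t1 + t2), (t *: a1 + a2), (t *: a1' + a2').
  rewrite !scalerDr scalerDl !mulrDr scalerA -!scalerAr.
  by rewrite addrACA; congr (_ + _); rewrite addrACA.
- by exists 0, a, 0; rewrite scale0r add0r mulr0 addr0.
- by exists 0, 0, a; rewrite scale0r add0r mulr0 add0r.
Qed.

Lemma xy_nonneg i b : i < 0 -> acomp i b = 0.
Proof.
move=> i0; elim/(xy_ind Bxy): b i i0 => [|t a b a0 b0|a a0|a a0] i i0.
- by rewrite -[1](scale1r (1 : B)) acomp_scalar //; lia.
- by rewrite acompD acompZ a0 // b0 // scaler0 addr0.
- by rewrite -acomp_x mul_acomp a0 ?mulr0 // subr_lt0 (lt_trans i0).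
- by rewrite -acomp_y mul_acomp a0 ?mulr0 // subr_lt0 (lt_trans i0).
Qed.

Lemma acomp0_scalar b : acomp 0 b = b -> exists t : k, b = t *: 1.
Proof.
have [t [a [a' ->]]] := left_split b => <-; exists t.
rewrite !acompD acompZ acomp1 -[in LHS]acomp_x -[in LHS]acomp_y !mul_acomp.
by rewrite !(@xy_nonneg (0 - 1)) // !mulr0 !addr0.
Qed.

(** Comparison of components of degree l kills the constant term of [left_split]. *)
Lemma graded_left_split l (b : B) : acomp l b = b -> 1 <= l ->
  exists a a', [/\ b = x * a + y * a', acomp (l - 1) a = a & acomp (l - 1) a' = a'].
Proof.
move=> bl l1; have [t [a [a' bE]]] := left_split b.
exists (acomp (l - 1) a), (acomp (l - 1) a'); rewrite !acomp_comp eqxx; split=> //.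
rewrite -[LHS]bl bE !acompD -[in LHS]acomp_x -[in LHS]acomp_y !mul_acomp acomp_x acomp_y.
by rewrite acomp_scalar ?add0r //; lia.
Qed.

Lemma finite_dimD M (U V W : set M) : finite_dim U -> finite_dim V ->
  (forall w, W w -> exists u v, [/\ U u, V v & w = u + v]) -> finite_dim W.
Proof.
move=> [e eP] Vfin WUV; apply: fin_codim_trans Vfin; exists e => w /WUV[u [v [/eP[c]]]].
by move=> /subr0_eq -> Vv ->; exists c; rewrite addrAC subrr add0r.
Qed.

Lemma finite_dimM a (U W : set (gfree1 B)) : finite_dim U ->
  (forall w, W w -> exists2 u, U u & w = a * u :> B) -> finite_dim W.
Proof.
move=> [e eP] WU; exists [seq a * z | z <- e] => w /WU[u /eP[c /subr0_eq ->] ->].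
exists c; apply/eqP; rewrite subr_eq0 size_map; apply/eqP.
rewrite mulr_sumr; apply: eq_bigr => j _; rewrite (nth_map 0) //.
by rewrite /GRing.scale /= !mulr_algl scalerAr.
Qed.

Lemma xy_hom_finite (n : nat) : finite_dim (@hom _ B (gfree1 B) n).
Proof.
elim: n => [|n IHn].
  exists [:: 1 : B] => b /acomp0_scalar[t ->]; exists (fun=> t).
  by rewrite big_ord1 /GRing.scale /= mulr1 subrr.
have hx : finite_dim [set b : gfree1 B | exists2 a, @hom _ B (gfree1 B) n a & b = x * a].
  by apply: (finite_dimM (a := x) IHn) => w.
have hy : finite_dim [set b : gfree1 B | exists2 a, @hom _ B (gfree1 B) n a & b = y * a].
  by apply: (finite_dimM (a := y) IHn) => w.
apply: finite_dimD hx hy _ => b bn.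
have [|a [a' [-> an a'n]]] := graded_left_split (bn : acomp _ _ = _); first by lia.
have E : n.+1%:Z - 1 = n by lia.
by exists (x * a), (y * a'); split=> //; [exists a | exists a'] => //; rewrite /hom /= -E.
Qed.

Lemma xy_locfin n : finite_dim (@below _ B (gfree1 B) n).
Proof.
have [n0|n0] := leP 0 n; last first.
  exists [::] => b bn; exists (fun=> 0); rewrite big_ord0 subr0.
  apply: comp_eq => i; rewrite comp0; have [/bn //|ni] := leP n i.
  by apply: xy_nonneg; lia.
rewrite -(gez0_abs n0); elim: (absz n) => [|m IHm].
  exists [::] => b bn; exists (fun=> 0); rewrite big_ord0 subr0.
  apply: comp_eq => i; rewrite comp0; have [/bn //|ni] := leP 0 i.
  by apply: xy_nonneg; lia.
apply: finite_dimD IHm (xy_hom_finite m) _ => b bm.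
exists (b - comp m b), (comp m b); rewrite subrK; split=> //; last exact: hom_comp.
move=> i mi; rewrite compB comp_comp; case: eqVneq => [->|im]; first exact: subrr.
by rewrite bm ?subr0 //; lia.
Qed.

Lemma graded_left_expansion (i : nat) l (b : B) : acomp l b = b -> i%:Z <= l ->
  exists (f : nat -> B) (b' : B), b = \sum_(j < i) y ^+ j * x * f j + y ^+ i * b'.
Proof.
suff : acomp l b = b -> i%:Z <= l -> exists (f : nat -> B) (b' : B),
   b = \sum_(j < i) y ^+ j * x * f j + y ^+ i * b' /\ acomp (l - i%:Z) b' = b'.
  by move=> H bl il; have [f [b' [? _]]] := H bl il; exists f, b'.
move=> bl; elim: i => [|i IHi] il.
  by exists (fun=> 0), b; rewrite big_ord0 add0r mul1r subr0.
have [|f [b' [-> b'l]]] := IHi; first by lia.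
have [|a [a' [-> _ a'l]]] := graded_left_split b'l; first by lia.
exists (fun j => if j == i then a else f j), a'; split; last first.
  by rewrite (_ : l - _ = l - i%:Z - 1) //; lia.
rewrite big_ord_recr /= eqxx mulrDr addrA !mulrA -exprSr; congr (_ + _ + _).
by apply: eq_bigr => j _; rewrite (ltn_eqF (ltn_ord j)).
Qed.

(** What holds in degrees >= N for a finitely presented module whose generators and
    relations live in degrees <= N. *)
Record regular_from M N : Prop := RegularFrom {
  regular_gen : forall D m, N <= D -> comp (D + 1) m = m ->
    exists m1 m2 : M, [/\ m = x *: m1 + y *: m2, comp D m1 = m1 & comp D m2 = m2];
  regular_free : forall (i : nat) D (m : nat -> M) m', (i <= r.+1)%N -> N + i%:Z <= D ->
    (forall j : nat, (j < i)%N -> comp (D - 1 - j%:Z) (m j) = m j) ->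
    comp (D - i%:Z) m' = m' ->
    \sum_(j < i) (y ^+ j * x) *: m j + y ^+ i *: m' = 0 ->
    forall j, (j < i)%N -> m j = 0
}.

(** Lift the m_j and m' to homogeneous vectors over the generators.  The lifted sum is a
    combination of relations whose coefficients have degree at least i, so they too expand
    as sum_(j < i) y ^ j x f_j + y ^ i f'; uniqueness of left expansions in B shows that
    each lift of m_j is a combination of relations. *)
Lemma presents_regular M n (d : n.-tuple int) rels N :
    presents M (existT _ n (d, rels)) -> (forall l, tnth d l <= N) ->
    (forall rho, rho \in rels -> exists e, e <= N /\ gfree_comp (tnth d) e rho = rho) ->
  regular_from M N.
Proof.
move=> [g [gd gspan _ ker]] dN relN.
have gl := gfree_map gd; pose G := gfree B (tnth d).
have lift i m : comp i m = m -> exists u : 'rV[B]_n,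
    \sum_l u 0 l *: g l = m /\ gfree_comp (tnth d) i u = u.
  move=> mi; have [u uE] := gspan m; exists (gfree_comp (tnth d) i u).
  split; last exact: (compK (M := G)).
  by have := glinC gl i u; rewrite /= -uE mi => <-; apply: eq_bigr => l _.
split=> [D m ND mD|i D m m' ir ND mD m'D E].
  have [u [uE uD]] := lift _ _ mD.
  have /choice[a aP] l : exists a : B * B, [/\ u 0 l = x * a.1 + y * a.2,
      acomp (D - tnth d l) a.1 = a.1 & acomp (D - tnth d l) a.2 = a.2].
    have ul : acomp (D + 1 - tnth d l) (u 0 l) = u 0 l by rewrite -{2}uD mxE.
    have [|a [a' [? h h']]] := graded_left_split ul; first by have := dN l; lia.
    by exists (a, a'); move: h h'; rewrite (_ : _ - 1 = D - tnth d l) //; lia.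
  exists (\sum_l (a l).1 *: g l), (\sum_l (a l).2 *: g l); split.
  - rewrite -uE !scaler_sumr -big_split; apply: eq_bigr => l _.
    by have [-> _ _] := aP l; rewrite /= scalerDl !scalerA.
  - rewrite comp_sum; apply: eq_bigr => l _; rewrite (comp_scale_hom _ _ (gd l)).
    by have [_ -> _] := aP l.
  - rewrite comp_sum; apply: eq_bigr => l _; rewrite (comp_scale_hom _ _ (gd l)).
    by have [_ _ ->] := aP l.
have /choice[u uP] (j : 'I_i) := lift _ _ (mD j (ltn_ord j)).
have [u' [u'E u'D]] := lift _ _ m'D.
pose v : G := \sum_(j < i) (y ^+ j * x) *: u j + y ^+ i *: u'.
have vD : comp D v = v.
  rewrite /v compD comp_sum; congr (_ + _).
    apply: eq_bigr => j _; rewrite -acomp_yxX scale_comp.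
    rewrite (_ : D - _ = D - 1 - j%:Z); last by lia.
    by have [_ h] := uP j; congr (_ *: _).
  by rewrite -acomp_yX scale_comp; congr (_ *: _).
have /ker[c cE] : \sum_l (v : 'rV_n) 0 l *: g l = 0.
  rewrite -[RHS]E; have := glinD gl (\sum_(j < i) (y ^+ j * x) *: (u j : G)) (y ^+ i *: (u' : G)).
  move=> /= ->; congr (_ + _).
    have := glin_sum gl (index_enum 'I_i) xpredT (fun j => (y ^+ j * x) *: (u j : G)).
    move=> /= ->; apply: eq_bigr => j _; have := glinZ gl (y ^+ j * x) (u j : G).
    by move=> /= ->; have [-> _] := uP j.
  by have := glinZ gl (y ^+ i) (u' : G); move=> /= ->; rewrite u'E.
have /choice[e eP] (q : 'I_(size rels)) : exists e, e <= N /\ gfree_comp (tnth d) e rels`_q = rels`_q.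
  by apply: relN; exact: mem_nth.
have {}cE : v = \sum_q acomp (D - e q) (c q) *: (rels`_q : G).
  rewrite -vD [in LHS]cE comp_sum; apply: eq_bigr => q _.
  by rewrite (comp_scale_hom (M := G) _ _ (eP q).2).
have /choice[f fP] q : exists f : (nat -> B) * B, acomp (D - e q) (c q) =
    \sum_(j < i) y ^+ j * x * f.1 j + y ^+ i * f.2.
  have cq : acomp (D - e q) (acomp (D - e q) (c q)) = acomp (D - e q) (c q).
    by rewrite acomp_comp eqxx.
  have [|f [b ->]] := graded_left_expansion (i := i) cq.
    by have [] := eP q; lia.
  by exists (f, b).
move=> j ji; pose oj := Ordinal ji.
have -> : m j = \sum_l (u oj) 0 l *: g l by have [-> _] := uP oj.
apply/ker; exists (fun q => (f q).1 j); apply/rowP => l.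
apply/eqP; rewrite -subr_eq0; apply/eqP.
pose h (j' : nat) : B := if insub j' is Some o then
   ((u o) 0 l - (\sum_q (f q).1 j' *: rels`_q) 0 l) else 0.
have hE (o : 'I_i) : h o = (u o) 0 l - (\sum_q (f q).1 o *: rels`_q) 0 l.
  by rewrite /h valK.
rewrite -(hE oj).
have E0 : \sum_(j < i) y ^+ j * x * h j +
    y ^+ i * (u' 0 l - (\sum_q (f q).2 *: rels`_q) 0 l) = 0; last first.
  by apply: (xy_unique Bxy E0 ji); rewrite -ltnS (leq_trans ji).
have /(congr1 (fun w : 'rV_n => w 0 l)) := cE.
rewrite /v !mxE !summxE => /eqP; rewrite -subr_eq0 => /eqP E0; rewrite -[RHS]E0.
rewrite (eq_bigr (fun j : 'I_i => (((y ^+ j * x) *: u j) 0 l -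
   \sum_q y ^+ j * x * ((f q).1 j * rels`_q 0 l)))); last first.
  move=> o _; rewrite hE mxE mulrBr summxE mulr_sumr; congr (_ - _).
  by apply: eq_bigr => q _; rewrite mxE.
rewrite sumrB exchange_big mulrBr mulr_sumr /=.
rewrite [LHS]addrACA -opprD -big_split; congr (_ - _); apply: eq_bigr => q _ /=.
rewrite !mxE fP mulrDl mulr_suml; congr (_ + _); last by rewrite mulrA.
by apply: eq_bigr => o _; rewrite mulrA.
Qed.

Lemma fp_regular M : fin_presented M -> exists N0, forall N, N0 <= N -> regular_from M N.
Proof.
move=> [[n [d rels]] Mp]; have [g [_ _ relh _]] := Mp.
have /choice[e eP] (q : 'I_(size rels)) : exists e, gfree_comp (tnth d) e rels`_q = rels`_q.
  have [e eP] := relh rels`_q (mem_nth 0 (ltn_ord q)); exists e.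
  by apply/rowP => l; rewrite mxE eP.
pose S := \sum_l `|tnth d l|; pose T := \sum_q `|e q|.
have S0 : 0 <= S by exact: sumr_ge0.
have T0 : 0 <= T by exact: sumr_ge0.
have dS l : `|tnth d l| <= S by rewrite /S (bigD1 l) //= lerDl; exact: sumr_ge0.
have eT q : `|e q| <= T by rewrite /T (bigD1 q) //= lerDl; exact: sumr_ge0.
exists (S + T) => N NST; apply: presents_regular Mp _ _ => [l|rho].
  by apply: le_trans (ler_norm _) (le_trans (dS l) (le_trans _ NST)); rewrite lerDl.
move=> /(nthP 0)[q qs <-]; exists (e (Ordinal qs)); split; last exact: eP (Ordinal qs).
by apply: le_trans (ler_norm _) (le_trans (eT _) (le_trans _ NST)); rewrite lerDr.
Qed.

Lemma xy_generated M : fin_presented M -> exists n, forall m i (z : M),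
  n <= m -> m <= i -> comp i z = z -> exists s : seq (B * M),
    (forall p, p \in s -> comp m p.2 = p.2) /\ z = \sum_(p <- s) p.1 *: p.2.
Proof.
move=> /fp_regular[n nP]; exists n => m i z nm mi; have [gen _] := nP m nm.
rewrite (_ : i = m + `|i - m|%N%:Z); last by lia.
elim: `|i - m|%N z => [|l IHl] z zi.
  exists [:: (1, z)]; rewrite big_seq1 scale1r; split=> // p.
  by rewrite inE => /eqP -> /=; rewrite -[RHS]zi addr0.
have [||z1 [z2 [-> /IHl[s [sP ->]] /IHl[t [tP ->]]]]] := gen (m + l%:Z) z.
- by lia.
- by rewrite -addrA -[1]/(1%N%:Z) -PoszD addn1.
exists ([seq (x * p.1, p.2) | p <- s] ++ [seq (y * p.1, p.2) | p <- t]); split.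
  by move=> p; rewrite mem_cat => /orP[] /mapP[q qs ->]; [exact: (sP q qs) | exact: (tP q qs)].
rewrite big_cat !big_map !scaler_sumr.
by congr (_ + _); apply: eq_bigr => p _; rewrite scalerA.
Qed.

(** For i = 1, [regular_free] says that x acts injectively in degrees >= N, so no power of
    x kills a nonzero element of large degree. *)
Lemma xy_torsion_free M : fin_presented M -> exists n, forall i (z : M),
  n <= i -> comp i z = z ->
  (exists m, forall j a, m <= j -> acomp j a *: z = 0) -> z = 0.
Proof.
move=> /fp_regular[n nP]; exists n => i z ni zi [m mP].
have [_ free] := nP n (lexx _).
have := mP `|m| (x ^+ `|m|%N) ltac:(lia).
rewrite -abszE acomp_xX; elim: `|m|%N i z ni zi {mP} => [|l IHl] i z ni zi; first by rewrite scale1r.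
rewrite exprSr -scalerA => /(IHl (i + 1))xz.
have {}xz : x *: z = 0.
  apply: xz; first by lia.
  by rewrite -acomp_x scale_comp acomp_x addrK zi.
apply: (free 1%N (i + 1) (fun=> z) 0 _ _ _ _ _ 0%N) => //.
- lia.
- by move=> [|//] _; rewrite subr0 addrK.
- by rewrite comp0.
by rewrite big_ord1 scaler0 addr0 mul1r.
Qed.

End Structure.

(** * Free submodules of finite codimension *)

Section Cover.
Variables (k : fieldType) (B : gradedAlg k) (x y : B) (r : nat).
Hypothesis Bxy : xy_monomial x y r.
Implicit Types (M : gradedMod B) (N D : int) (a b : B).

(** b is built from constants in l steps a, a' |-> t + x a + y a'; the recursion on l
    replaces a recursion on the length of words. *)
Fixpoint stage (l : nat) b : Prop :=
  if l is l'.+1 then exists (t : k) a a',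
    [/\ b = t *: 1 + x * a + y * a', stage l' a & stage l' a']
  else b = 0.

Lemma stage_lin l (t : k) a b : stage l a -> stage l b -> stage l (t *: a + b).
Proof.
elim: l a b => [|l IHl] a b /=; first by move=> -> ->; rewrite scaler0 addr0.
move=> [t1 [a1 [a1' [-> s1 s1']]]] [t2 [a2 [a2' [-> s2 s2']]]].
exists (t * t1 + t2), (t *: a1 + a2), (t *: a1' + a2'); split; try exact: IHl.
rewrite !scalerDr scalerDl !mulrDr scalerA -!scalerAr.
by rewrite addrACA; congr (_ + _); rewrite addrACA.
Qed.

Lemma stage0 l : stage l 0.
Proof.
elim: l => [//|l IHl]; exists 0, 0, 0; split=> //.
by rewrite scale0r !mulr0 !addr0.
Qed.

Lemma stageS l b : stage l b -> stage l.+1 b.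
Proof.
elim: l b => [|l IHl] b; first by move=> ->; exact: stage0.
by move=> [t [a [a' [-> sa sa']]]]; exists t, a, a'; split=> //; exact: IHl.
Qed.

Lemma stage_le l m b : (l <= m)%N -> stage l b -> stage m b.
Proof.
move=> /subnKC <- lb; elim: (m - l)%N => [|d IHd]; first by rewrite addn0.
by rewrite addnS; exact: stageS.
Qed.

Lemma stage_exists b : exists l, stage l b.
Proof.
elim/(xy_ind Bxy): b => [|t a b [l la] [m mb]|a [l la]|a [l la]].
- by exists 1%N, 1, 0, 0; split=> //; rewrite scale1r !mulr0 !addr0.
- by exists (maxn l m); apply: stage_lin; apply: stage_le;
    [exact: leq_maxl|exact: la|exact: leq_maxr|exact: mb].
- exists l.+1, 0, a, 0; split=> //; last exact: stage0.
  by rewrite scale0r add0r mulr0 addr0.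
- exists l.+1, 0, 0, a; split=> //; first by rewrite scale0r mulr0 !add0r.
  exact: stage0.
Qed.

Lemma stage_expansion l b : stage l b -> exists (t : nat -> k) (a : nat -> B),
  b = \sum_(j < r.+1) y ^+ j * ((t j)%:A + x * a j) /\ forall j, stage l.-1 (a j).
Proof.
move=> lb.
suff /(_ r.+1)[t [a [b' [E sa _]]]] : forall n, exists (t : nat -> k) (a : nat -> B) b',
    [/\ b = \sum_(j < n) y ^+ j * ((t j)%:A + x * a j) + y ^+ n * b',
        forall j, stage l.-1 (a j) & stage l b'].
  by exists t, a; rewrite {1}E (xy_nilp Bxy) mul0r addr0.
elim=> [|n [t [a [b' [E sa sb']]]]].
  exists (fun=> 0), (fun=> 0), b; rewrite big_ord0 add0r mul1r; split=> // _.
  exact: stage0.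
have [t' [a1 [a2 [b'E sa1 sa2]]]] : exists (t' : k) a1 a2,
    [/\ b' = t' *: 1 + x * a1 + y * a2, stage l.-1 a1 & stage l a2].
  case: (l) sb' => [->|l' [t' [a1 [a2 [-> ? ?]]]]].
    by exists 0, 0, 0; split=> //; rewrite scale0r !mulr0 !addr0.
  by exists t', a1, a2; split=> //; exact: stageS.
exists (fun j : nat => if j == n then t' else t j), (fun j : nat => if j == n then a1 else a j), a2.
split=> // [|j]; last by case: ifP.
rewrite [LHS]E b'E big_ord_recr /= eqxx exprSr -mulrA -[RHS]addrA -mulrDr; congr (_ + _).
by apply: eq_bigr => j _; rewrite (ltn_eqF (ltn_ord j)).
Qed.

Section Adapted.
Variables (M : gradedMod B) (N : int).
Hypothesis Mreg : regular_from x y r M N.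

(** In degree D the sum reduces to an instance of [regular_free] with i = D - N, or with
    i = r + 1 when D - N > r, where y ^ i = 0. *)
Lemma regular_decomposition (m : nat -> M) (v : nat -> M) :
    (forall j : nat, @above _ B M N (m j)) -> (forall i : nat, comp N (v i) = v i) ->
    \sum_(j < r.+1) (y ^+ j * x) *: m j + \sum_(i < r.+1) y ^+ i *: v i = 0 ->
  forall j : nat, (j <= r)%N -> m j = 0 /\ y ^+ j *: v j = 0.
Proof.
move=> mN vN E.
have yv D (i : nat) : comp D (y ^+ i *: v i) = if D == N + i%:Z then y ^+ i *: v i else 0.
  rewrite -[in LHS](acomp_yX Bxy) scale_comp (acomp_yX Bxy) -{1}vN comp_comp.
  rewrite (_ : (D - i%:Z == N) = (D == N + i%:Z)); last by rewrite subr_eq.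
  by case: ifP; rewrite ?vN // scaler0.
have ymD D (j : nat) : comp D ((y ^+ j * x) *: m j) =
    (y ^+ j * x) *: comp (D - 1 - j%:Z) (m j).
  by rewrite -(acomp_yxX Bxy) scale_comp; congr (_ *: comp _ _); lia.
have m0 j : (j <= r)%N -> m j = 0.
  move=> jr; apply: comp_eq => E0; rewrite comp0.
  have [|NE] := ltP E0 N; first exact: mN.
  pose D := E0 + 1 + j%:Z; pose i := minn `|D - N|%N r.+1.
  have DN : D - N = `|D - N|%N by rewrite /D; lia.
  pose v' := if (`|D - N|%N <= r)%N then v `|D - N|%N else 0.
  have <- : comp (D - 1 - j%:Z) (m j) = comp E0 (m j) by congr comp; rewrite /D; lia.
  apply: (@regular_free _ _ _ _ _ _ _ Mreg i D
    (fun j : nat => comp (D - 1 - j%:Z) (m j)) v' _ _ _ _ _ j); rewrite ?geq_minr //.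
  - by rewrite /i; lia.
  - by move=> j' _; exact: compK.
  - rewrite /v' /i; case: leqP => Dr; last exact: comp0.
    by rewrite (minn_idPl (leqW Dr)) (_ : D - _ = N) //; lia.
  - have := congr1 (comp D) E; rewrite comp0 compD !comp_sum => {2}<-.
    congr (_ + _); last first.
      rewrite /v' /i; case: leqP => Dr; last first.
        rewrite (minn_idPr Dr) scaler0 big1 // => i' _; rewrite yv.
        by case: eqP => // DE; have := ltn_ord i'; lia.
      rewrite (minn_idPl (leqW Dr)) (bigD1 (Ordinal (Dr : (_ < r.+1)%N))) //= yv.
      rewrite (_ : (D == _) = true); last by apply/eqP; lia.
      rewrite big1 ?addr0 // => i' i'D; rewrite yv; case: eqP => // DE.
      by case/eqP: i'D; apply: val_inj => /=; lia.
    have ir : (i <= r.+1)%N by exact: geq_minr.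
    rewrite (big_ord_widen r.+1 (fun j' : nat => (y ^+ j' * x) *: comp (D - 1 - j'%:Z) (m j')) ir).
    rewrite big_mkcond /=; apply: eq_bigr => j' _; rewrite ymD.
    case: ltnP => // ij'; rewrite mN ?scaler0 //.
    by have := ltn_ord j'; move: ij'; rewrite /i; lia.
  - by rewrite /i /D; lia.
move=> j jr; split; first exact: m0.
have /(congr1 (comp (N + j%:Z))) := E; rewrite comp0 big1 ?add0r => [|j' _]; last first.
  by rewrite m0 ?scaler0 // -ltnS.
rewrite comp_sum (bigD1 (Ordinal (jr : (j < r.+1)%N))) //= yv eqxx big1 ?addr0 // => i ij.
rewrite yv; case: eqP => // ji; case/eqP: ij; apply: val_inj => /=; lia.
Qed.

(** Homogeneous bases of the subspaces y ^ i M_N, i <= r. *)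
Record adapted m (e : 'I_m -> M) (d : 'I_m -> nat) : Prop := Adapted {
  adapted_deg : forall s, (d s <= r)%N;
  adapted_in : forall s, exists2 v, comp N v = v & e s = y ^+ d s *: v;
  adapted_span : forall (i : nat) v, (i <= r)%N -> comp N v = v ->
    exists c : 'I_m -> k, y ^+ i *: v = \sum_(s | d s == i) (c s)%:A *: e s;
  adapted_free : forall (i : nat) (c : 'I_m -> k),
    \sum_(s | d s == i) (c s)%:A *: e s = 0 -> forall s, d s = i -> c s = 0
}.

Variables (m : nat) (e : 'I_m -> M) (d : 'I_m -> nat).
Hypothesis ade : adapted e d.

Lemma adapted_hom s : comp (N + (d s)%:Z) (e s) = e s.
Proof.
have [v vN ->] := adapted_in ade s.
by rewrite -(acomp_yX Bxy) scale_comp addrK vN.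
Qed.

(** With b_s = sum_j y ^ j (t_j + x a_j), the relation sum_s (b_s x + c_s) e_s = 0 reads
    sum_j y ^ j x (sum_s (a_j x + t_j) e_s) + sum_s c_s e_s = 0, to which
    [regular_decomposition] applies.  The scalars c_s are carried along because the new
    relations contain the scalars t_j. *)
Lemma adapted_step (t : 'I_m -> nat -> k) (a : 'I_m -> nat -> B) (c : 'I_m -> k) :
    \sum_s ((\sum_(j < r.+1) y ^+ j * ((t s j)%:A + x * a s j)) * x + (c s)%:A) *: e s = 0 ->
  (forall s, c s = 0) /\
  forall j : nat, (j <= r)%N -> \sum_s (a s j * x + (t s j)%:A) *: e s = 0.
Proof.
move=> E.
have /choice[v vP] s : exists v, comp N v = v /\ e s = y ^+ d s *: v.
  by have [v ? ?] := adapted_in ade s; exists v.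
pose w (i : nat) := \sum_(s | d s == i) (c s)%:A *: v s.
have wE (i : nat) : y ^+ i *: w i = \sum_(s | d s == i) (c s)%:A *: e s.
  rewrite scaler_sumr; apply: eq_bigr => s /eqP <-.
  by rewrite scaleA_comm -(vP s).2.
pose n (j : nat) := \sum_s (a s j * x + (t s j)%:A) *: e s.
have H : forall j : nat, (j <= r)%N -> n j = 0 /\ y ^+ j *: w j = 0; last first.
  split=> [s|j jr]; last by have [] := H j jr.
  have [_] := H (d s) (adapted_deg ade s); rewrite wE.
  by move/(adapted_free ade); apply.
apply: regular_decomposition.
- move=> j; have [U0 UL _] := above_submod (@xy_nonneg _ _ _ _ _ Bxy) M N.
  apply: (big_ind (@above _ B M N)) => // [u u' uN u'N|s _].
    by have := UL 1 u u' uN u'N; rewrite scale1r.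
  rewrite -[_ *: _]addr0; apply: UL => // i iN; apply: comp_ne (adapted_hom s) _; lia.
- by move=> i; rewrite comp_sum; apply: eq_bigr => s _; rewrite compZ (vP s).1.
- rewrite -[RHS]E; under [in RHS]eq_bigr do rewrite scalerDl mulr_suml scaler_suml.
  rewrite big_split /= exchange_big /=; congr (_ + _).
    apply: eq_bigr => j _; rewrite scaler_sumr; apply: eq_bigr => s _.
    rewrite scalerA -!mulrA; congr (_ * _ *: _).
    by rewrite mulrDr mulrDl mulr_algl mulr_algr addrC mulrA.
  under eq_bigr do rewrite wE.
  rewrite [RHS](partition_big (fun s => inord (d s) : 'I_r.+1) xpredT) //=.
  apply: eq_bigr => i _; apply: eq_bigl => s.
  by rewrite -val_eqE /= inordK // ltnS; exact: adapted_deg ade s.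
Qed.

Lemma adapted_independent l (b : 'I_m -> B) (c : 'I_m -> k) :
    (forall s, stage l (b s)) -> \sum_s (b s * x + (c s)%:A) *: e s = 0 ->
  (forall s, b s = 0) /\ (forall s, c s = 0).
Proof.
elim: l b c => [|l IHl] b c lb E.
  have [|c0 _] := @adapted_step (fun _ _ => 0) (fun _ _ => 0) c; last by split.
  rewrite -[RHS]E; apply: eq_bigr => s _; rewrite (lb s) big1 // => j _.
  by rewrite scale0r mulr0 addr0 mulr0.
have /choice[ta taP] s : exists ta : (nat -> k) * (nat -> B),
    b s = \sum_(j < r.+1) y ^+ j * ((ta.1 j)%:A + x * ta.2 j) /\
    forall j, stage l (ta.2 j).
  by have [t [a H]] := stage_expansion (lb s); exists (t, a).
have [|c0 aE] := @adapted_step (fun s => (ta s).1) (fun s => (ta s).2) c.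
  by rewrite -[RHS]E; apply: eq_bigr => s _; rewrite (taP s).1.
split=> // s; rewrite (taP s).1 big1 // => j _.
have jr : (j <= r)%N by rewrite -ltnS.
have [|a0 t0] := IHl _ _ _ (aE j jr); first by move=> s'; exact: (taP s').2.
by rewrite a0 t0 scale0r mulr0 addr0 mulr0.
Qed.

(** Iterating M_(D+1) = x M_D + y M_D; a term x y ^ l v is a combination of the x e_s by
    definition of the e_s. *)
Lemma adapted_generate l z : comp (N + l%:Z) z = z -> exists (u : 'I_m -> B) v,
  comp N v = v /\ z = \sum_s u s *: (x *: e s) + y ^+ l *: v.
Proof.
elim: l z => [|l IHl] z zl.
  exists (fun=> 0), z; rewrite addr0 in zl; split=> //.
  by rewrite big1 ?add0r ?scale1r // => s _; rewrite scale0r.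
have [||z1 [z2 [-> /IHl[u1 [v1 [v1N ->]]] /IHl[u2 [v2 [v2N ->]]]]]] :=
    regular_gen Mreg (D := N + l%:Z) (m := z); first by lia.
  by rewrite -addrA -[1]/(1%N%:Z) -PoszD addn1.
have [c cE] : exists c : 'I_m -> k, y ^+ l *: v1 = \sum_(s | d s == l) (c s)%:A *: e s.
  have [lr|rl] := leqP l r; first exact: (adapted_span ade).
  exists (fun=> 0); rewrite -(subnKC rl) exprD (xy_nilp Bxy) mul0r scale0r big1 // => s _.
  by rewrite !scale0r.
exists (fun s => x * u1 s + y * u2 s + if d s == l then (c s)%:A else 0), v2; split=> //.
rewrite cE !scalerDr exprS -[in RHS]scalerA addrA; congr (_ + _).
rewrite addrAC !scaler_sumr [X in _ + X]big_mkcond /= -!big_split /=.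
apply: eq_bigr => s _; rewrite !scalerDl !scalerA; congr (_ + _).
by case: ifP => _; rewrite ?mul0r ?scale0r // ?scalerA mulr_algl mulr_algr.
Qed.

Definition cover (u : gfree B (fun s => N + (d s)%:Z + 1)) : M :=
  \sum_s u 0 s *: (x *: e s).

Lemma cover_linear : graded_linear cover.
Proof.
apply: gfree_map => s; rewrite -{1}(xy_degx Bxy) scale_comp (xy_degx Bxy).
by rewrite addrK adapted_hom.
Qed.

Lemma cover_injective : injective cover.
Proof.
move=> u u' E; apply/eqP; rewrite -subr_eq0; apply/eqP.
have := glinB cover_linear u u'; rewrite E subrr; set w := u - u' => w0.
have /choice[l lP] s := stage_exists (w 0 s).
have [||w00 _] := @adapted_independent (\max_s l s) (fun s => w 0 s) (fun=> 0).
- by move=> s; apply: stage_le (lP s); exact: (leq_bigmax s).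
- rewrite -[RHS]w0; apply: eq_bigr => s _.
  by rewrite scale0r addr0 scalerA.
by apply/rowP => s; rewrite w00 mxE.
Qed.

Lemma cover_surjective D z : N + r.+1%:Z <= D -> comp D z = z -> exists u, cover u = z.
Proof.
move=> ND zD; have DE : D = N + `|D - N|%N%:Z by lia.
have [|u [v [vN ->]]] := @adapted_generate `|D - N|%N z; first by rewrite -DE.
exists (\row_s u s); rewrite (_ : `|D - N| = (r.+1 + (`|D - N| - r.+1))%N)%N; last by lia.
rewrite exprD (xy_nilp Bxy) mul0r scale0r addr0.
by apply: eq_bigr => s _; rewrite mxE.
Qed.

End Adapted.

Lemma adapted_exists M N : fin_presented M -> exists m (e : 'I_m -> M) (d : 'I_m -> nat),
  adapted N e d.
Proof.
move=> Mfp; pose V (i : nat) : set M := [set z | exists2 v, comp N v = v & z = y ^+ i *: v].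
have Vk i : ksubspace (V i).
  split=> [|t z z' [v vN ->] [v' v'N ->]]; first by exists 0; rewrite ?comp0 ?scaler0.
  exists (t%:A *: v + v'); first by rewrite compD compZ vN v'N.
  by rewrite scalerDr scaleA_comm.
have Vfin i : finite_dim (V i).
  apply: finite_dimS (hom_finite (@xy_locfin _ _ _ _ _ Bxy) (N + i%:Z) Mfp) => z [v vN ->].
  by rewrite /hom /= -(acomp_yX Bxy) scale_comp addrK vN.
have /choice[n nP] (i : 'I_r.+1) := basis_exists (Vk i) (Vfin i).
pose T : finType := {i : 'I_r.+1 & 'I_(n i)}.
have /choice[f fP] (i : 'I_r.+1) : exists f : nat -> M,
    is_basis (V i) (fun q : 'I_(n i) => f q).
  have [f [fV fs ff]] := nP i.
  exists (fun q => if insub q is Some o then f o else 0); split.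
  - by move=> q; rewrite valK.
  - by move=> z /fs[c ->]; exists c; apply: eq_bigr => q _; rewrite valK.
  - by move=> c E; apply: ff; rewrite -[RHS]E; apply: eq_bigr => q _; rewrite valK.
pose e (s : 'I_#|T|) : M := f (tag (enum_val s)) (tagged (enum_val s)).
pose d (s : 'I_#|T|) : nat := tag (enum_val s).
have sumE (i : 'I_r.+1) (F : T -> M) :
    \sum_(s : 'I_#|T| | d s == i) F (enum_val s) = \sum_(q < n i) F (Tagged _ q).
  transitivity (\sum_(p : T | tag p == i) F p).
    by rewrite [RHS](reindex (@enum_val T T)) //; apply: onW_bij; exact: enum_val_bij.
  transitivity (\sum_(i' : 'I_r.+1 | i' == i) \sum_(q < n i') F (Tagged _ q)); last first.
    by rewrite big_pred1_eq.
  rewrite (sig_big_dep (fun i' => i' == i) (fun _ _ => true)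
    (fun i' (q : 'I_(n i')) => F (Tagged _ q))) /=.
  by apply: eq_big => [p|[i' q] _] //; rewrite andbT.
exists #|T|, e, d; split.
- by move=> s; rewrite /d -ltnS; exact: ltn_ord.
- by move=> s; have [fV _ _] := fP (tag (enum_val s)); exact: fV.
- move=> i v ir vN; pose oi : 'I_r.+1 := Ordinal (ir : (i < r.+1)%N).
  have [_ fs _] := fP oi; have [|c cE] := fs (y ^+ i *: v); first by exists v.
  pose c' (q : nat) : k := if insub q is Some o then c o else 0.
  pose F (p : T) : M := (c' (tagged p))%:A *: f (tag p) (tagged p).
  exists (fun s : 'I_#|T| => c' (tagged (enum_val s))).
  rewrite cE -[RHS]/(\sum_(s | d s == oi) F (enum_val s)) sumE.
  by apply: eq_bigr => q _; rewrite /F /c' /= valK.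
move=> i c E s dsi; pose oi := tag (enum_val s).
pose F (p : T) : M := (c (enum_rank p))%:A *: f (tag p) (tagged p).
have [_ _ ff] := fP oi.
have : \sum_(q < n oi) (c (enum_rank (Tagged _ q : T)))%:A *: f oi q = 0.
  rewrite -[LHS]/(\sum_(q < n oi) F (Tagged _ q)) -sumE -[RHS]E -dsi.
  by apply: eq_bigr => s' _; rewrite /F enum_valK.
move=> /ff/(_ (tagged (enum_val s))).
have sE : enum_rank (Tagged _ (tagged (enum_val s)) : T) = s.
  by rewrite -[RHS]enum_valK; case: (enum_val s).
by rewrite sE.
Qed.

End Cover.

(** * Classes and Hilbert functions *)

Section Classes.
Variables (k : fieldType) (B : gradedAlg k) (x y : B) (r : nat).
Hypothesis Bxy : xy_monomial x y r.
Implicit Types (M : gradedMod B) (X Y Z : qgr B) (i n N : int).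

Let B_nonneg := @xy_nonneg _ _ _ _ _ Bxy.
Let B_locfin := @xy_locfin _ _ _ _ _ Bxy.

Definition presentation_class (p : K0_index B) : K0 B := \pi_(K0 B)%qT << p >>.

Lemma presentation_class_exact X Y Z (f : qhom X Y) (g : qhom Y Z) (p q s : K0_index B) :
    short_exact f g -> presents X (val p) -> presents Y (val q) -> presents Z (val s) ->
  presentation_class q = presentation_class p + presentation_class s.
Proof.
move=> fg Xp Yq Zs; rewrite /presentation_class -raddfD; apply/eqP.
rewrite -Quotient.idealrBE; apply/asboolP => S; apply.
by exists X, Y, Z, f, g, p, q, s.
Qed.

Definition qnull : qgr B := @qfree k B 0 (fun=> 0).

Lemma qnull0 (z : qnull) : z = 0.
Proof. by apply/rowP => -[]. Qed.

Lemma zero_cokernel_exact X Y (f : X -> Y) n (fP : graded_linear f) :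
    injective f -> (forall i z, n <= i -> comp i z = z -> exists u, f u = z) ->
  short_exact (qlin fP) (qlin (@glin_zero _ B Y qnull)).
Proof.
move=> finj fsurj; apply: (linear_short_exact B_nonneg B_locfin (n := n)) => //.
- by move=> z; exists 0; rewrite [z]qnull0.
- by move=> i z ni zi _; exact: (fsurj i z).
Qed.

Lemma id_linear X : graded_linear (fun u : X => u).
Proof. by []. Qed.

Lemma id_exact X : short_exact (qlin (id_linear X)) (qlin (@glin_zero _ B X qnull)).
Proof. by apply: (@zero_cokernel_exact X X id 0) => // i z _ _; exists z. Qed.

Lemma presentation_class_null p : presents qnull (val p) -> presentation_class p = 0.
Proof.
move=> pP; have := presentation_class_exact (id_exact qnull) pP pP pP.
by move=> /eqP; rewrite -subr_eq0 opprD addNKr oppr_eq0 => /eqP.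
Qed.

(** The identity of X, with one presentation for the source and another for the target,
    followed by the null object, gives a relation of the Grothendieck group. *)
Lemma presentation_classE X p : presents X (val p) -> K0_class X = presentation_class p.
Proof.
move=> Xp; have [s sP] := qgr_index qnull; have [q Xq] := qgr_index X.
have XE (p' q' : K0_index B) : presents X (val p') -> presents X (val q') ->
    presentation_class q' = presentation_class p'.
  move=> Xp' Xq'; rewrite (presentation_class_exact (id_exact X) Xp' Xq' sP).
  by rewrite (presentation_class_null sP) addr0.
exact: XE Xp (svalP (qgr_index X)).
Qed.

Lemma K0_null_class : K0_class qnull = 0.
Proof.
have [s sP] := qgr_index qnull.
by rewrite (presentation_classE sP) (presentation_class_null sP).
Qed.

Lemma K0_class_iso X Y (f : X -> Y) n (fP : graded_linear f) :
    injective f -> (forall i z, n <= i -> comp i z = z -> exists u, f u = z) ->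
  K0_class Y = K0_class X.
Proof.
move=> finj fsurj; rewrite (K0_class_exact (zero_cokernel_exact fP finj fsurj)).
by rewrite K0_null_class addr0.
Qed.

Definition line_class n : K0 B := K0_class (twist (structure_sheaf B) n).

Section FreeStep.
Variables (m : nat) (d : 'I_m.+1 -> int).
Let L := twist (structure_sheaf B) (- d ord0).
Let F := @qfree k B m.+1 d.
Let F' := @qfree k B m (fun l => d (lift ord0 l)).

Definition first_coord (a : L) : F :=
  \row_l if unlift ord0 l is Some _ then 0 else (a : B).
Definition other_coords (u : F) : F' := \row_l (u : 'rV[B]_m.+1) 0 (lift ord0 l).

Lemma first_coord_linear : graded_linear first_coord.
Proof.
split=> [a u v|i u]; apply/rowP => l; rewrite !mxE; case: unliftP => [j _|lE] //.
- by rewrite mulr0 addr0.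
- by rewrite acomp0.
by rewrite lE addrC.
Qed.

Lemma other_coords_linear : graded_linear other_coords.
Proof. by split=> [a u v|i u]; apply/rowP => l; rewrite !mxE. Qed.

Lemma free_step_exact : short_exact (qlin first_coord_linear) (qlin other_coords_linear).
Proof.
apply: (linear_short_exact B_nonneg B_locfin (n := 0)).
- by move=> u v /rowP/(_ ord0); rewrite !mxE unlift_none.
- move=> u; exists (\row_l if unlift ord0 l is Some j then (u : 'rV[B]_m) 0 j else 0).
  by apply/rowP => l; rewrite !mxE liftK.
- by move=> u; apply/rowP => l; rewrite !mxE liftK.
move=> i u _ _ /rowP u0; exists ((u : 'rV[B]_m.+1) 0 ord0).
apply/rowP => l; rewrite mxE; case: unliftP => [j ->|-> //].
by have := u0 j; rewrite !mxE.
Qed.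

End FreeStep.

Lemma K0_class_free m (d : 'I_m -> int) :
  K0_class (@qfree k B m d) = \sum_l line_class (- d l).
Proof.
elim: m d => [|m IHm] d.
  rewrite big_ord0 -K0_null_class.
  apply: (K0_class_iso (n := 0) (glin_zero qnull (@qfree k B 0 d))).
    by move=> u v _; apply/rowP => -[].
  by move=> i z _ _; exists 0; apply/rowP => -[].
by rewrite (K0_class_exact (free_step_exact d)) IHm big_ord_recl.
Qed.

Definition eventual_dim X (h : int -> nat) : Prop :=
  exists n, forall i, n <= i -> has_dim (@hom _ B X i) (h i).

Lemma eventual_dim_exact X Y Z (f : qhom X Y) (g : qhom Y Z) h h' : short_exact f g ->
  eventual_dim X h -> eventual_dim Z h' -> eventual_dim Y (fun i => h i + h' i)%N.
Proof.
move=> fg [n nP] [m mP].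
have [p pP] := short_exact_dim B_nonneg B_locfin (@xy_generated _ _ _ _ _ Bxy)
  (@xy_torsion_free _ _ _ _ _ Bxy) fg.
exists (`|n| + `|m| + `|p|) => i ni; apply: pP; first lia.
  by apply: nP; lia.
by apply: mP; lia.
Qed.

Lemma eventual_dim_uniq X h h' : eventual_dim X h -> eventual_dim X h' ->
  exists n, forall i, n <= i -> h i = h' i.
Proof.
move=> [n nP] [m mP]; exists (`|n| + `|m|) => i ni.
by apply: (has_dim_uniq (nP i _) (mP i _)); lia.
Qed.

Lemma qnull_dim : eventual_dim qnull (fun=> 0%N).
Proof.
exists 0 => i _; exists (fun=> 0); split=> [[]//|z _|c _ []//].
by exists (fun=> 0); rewrite big_ord0; exact: qnull0.
Qed.

Lemma hilbert_exists : exists h : int -> nat,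
  forall i, has_dim (@hom _ B (gfree1 B) i) (h i).
Proof.
have /choice[h hP] i := hom_basis B_locfin i (gfree1_fp B).
by exists h.
Qed.

Variable h : int -> nat.
Hypothesis hP : forall i, has_dim (@hom _ B (gfree1 B) i) (h i).

Lemma line_dim n : eventual_dim (twist (structure_sheaf B) n) (fun i => h (n + i)).
Proof. by exists 0 => i _; have [e [? ? ?]] := hP (n + i); exists e; split. Qed.

Lemma free_dim m (d : 'I_m -> int) :
  eventual_dim (@qfree k B m d) (fun i => \sum_l h (- d l + i))%N.
Proof.
elim: m d => [|m IHm] d.
  exists 0 => i _; rewrite big_ord0; exists (fun=> 0); split=> [[]//|z _|c _ []//].
  by exists (fun=> 0); rewrite big_ord0; apply/rowP => -[].
have [n nP] := eventual_dim_exact (free_step_exact d) (line_dim _) (IHm _).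
by exists n => i /nP; rewrite big_ord_recl.
Qed.

(** In both respects X looks like the direct sum of the O(s), s in ds. *)
Definition has_type X (ds : seq int) : Prop :=
  K0_class X = \sum_(s <- ds) line_class s /\
  eventual_dim X (fun i => \sum_(s <- ds) h (s + i))%N.

Lemma cover_type X N m (e : 'I_m -> X) (d : 'I_m -> nat) :
    regular_from x y r X N -> adapted y r N e d ->
  has_type X [seq - (N + (d s)%:Z + 1) | s <- enum 'I_m].
Proof.
move=> Xreg ade; pose F := @qfree k B m (fun s => N + (d s)%:Z + 1).
have cl := cover_linear Bxy ade; have ci := cover_injective Bxy Xreg ade.
have cs := cover_surjective Bxy Xreg ade.
have ex := @zero_cokernel_exact F X _ (N + r.+1%:Z) cl ci cs.
split; first by rewrite (@K0_class_iso F X _ _ cl ci cs) K0_class_free big_map big_enum.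
have [n nP] := eventual_dim_exact ex (free_dim _) qnull_dim.
by exists n => i /nP; rewrite addn0 big_map big_enum.
Qed.

Lemma type_exists X : exists ds, has_type X ds.
Proof.
have [N Nreg] := fp_regular Bxy (qgr_fp X).
have [m [e [d ade]]] := adapted_exists Bxy N (qgr_fp X).
by eexists; exact: cover_type (Nreg N (lexx _)) ade.
Qed.

Lemma y_exp_neq0 (j : nat) : (j <= r)%N -> y ^+ j != 0.
Proof.
move=> jr; apply/eqP => yj0.
have := xy_unique Bxy (n := j.+1) (f := fun i : nat => (i == j)%:R) (b := 0).
rewrite mulr0 addr0 big_ord_recr /= yj0 !mul0r addr0 big1 => [|i _]; last first.
  by rewrite (ltn_eqF (ltn_ord i)) mulr0.
move=> /(_ erefl j (ltnSn j) jr)/eqP; rewrite eqxx.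
by rewrite oner_eq0.
Qed.

(** The submodule of B generated by the x y ^ j, j <= r, is free on them and contains
    everything of degree > r: [cover_type] for N = - n and the basis e_j = y ^ j. *)
Lemma line_type n :
  line_class n = \sum_(j < r.+1) line_class (n - j.+1%:Z) /\
  exists m, forall i, m <= i -> h (n + i) = (\sum_(j < r.+1) h (n - j.+1%:Z + i))%N.
Proof.
pose X := @qfree k B 1 (fun=> - n).
pose e (j : 'I_r.+1) : X := \row_(_ < 1) (y ^+ j : B).
have Xreg : regular_from x y r X (- n).
  have Xp := @gfree_presents k B 1 (fun=> - n).
  by apply: (presents_regular Bxy Xp) => // l; rewrite tnth_mktuple.
have rowE (z : 'rV[B]_1) : z = \row__ z 0 0 by apply/rowP => l; rewrite mxE ord1.
have ade : adapted y r (- n) e (fun j => j).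
  split=> [j|j|i v ir vN|i c E j ji].
  - by rewrite -ltnS.
  - exists (\row_(_ < 1) (1 : B)); apply/rowP => l; rewrite !mxE ?mulr1 //.
    by rewrite subrr acomp1.
  - have /(acomp0_scalar Bxy)[t tE] : acomp 0 ((v : 'rV[B]_1) 0 0) = (v : 'rV[B]_1) 0 0.
      by rewrite -[in RHS]vN mxE subrr.
    exists (fun=> t); rewrite (big_pred1 (Ordinal (ir : (i < r.+1)%N))) //.
    by apply/rowP => l; rewrite !mxE ord1 tE mulr_algl mulr_algr.
  have jr : (j <= r)%N by rewrite -ltnS.
  move: E; rewrite (big_pred1 j) => [/rowP/(_ 0)|s]; last by rewrite -ji.
  rewrite !mxE mulr_algl => /eqP; rewrite scaler_eq0 (negPf (y_exp_neq0 jr)) orbF.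
  by move/eqP.
have [cE hE] := cover_type Xreg ade.
have sumE (V : nmodType) (G : int -> V) :
    \sum_(s <- [seq - (- n + (nat_of_ord s)%:Z + 1) | s <- enum 'I_r.+1]) G s =
    \sum_(j < r.+1) G (n - j.+1%:Z).
  by rewrite big_map big_enum; apply: eq_bigr => j _; congr G; lia.
split.
  rewrite -sumE -cE K0_class_free big_ord1 opprK //.
have [m mP] := eventual_dim_uniq hE (free_dim (fun _ : 'I_1 => - n)).
exists m => i /mP; rewrite big_ord1 opprK => <-.
exact: (sumE nat (fun s => h (s + i))).
Qed.

(** The relation between sum_l w_l g_l and sum_l w_l g'_l is the graph of an isomorphism
    from M to M', fed to [has_dim_exact] with the null object as third term. *)
Lemma presents_dim M M' (p : presentation B) i a : presents M p -> presents M' p ->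
  has_dim (@hom _ B M i) a -> has_dim (@hom _ B M' i) a.
Proof.
case: p => n [d rels] [g [gd gspan _ gker]] [g' [gd' gspan' _ gker']].
have gl := gfree_map gd; have gl' := gfree_map gd'.
pose R (u : M) (v : M') := exists w : 'rV[B]_n,
  u = \sum_l w 0 l *: g l /\ v = \sum_l w 0 l *: g' l.
have gZ a' (w w' : 'rV[B]_n) : \sum_l (a' *: w + w') 0 l *: g l =
    a' *: (\sum_l w 0 l *: g l) + \sum_l w' 0 l *: g l by exact: gl.1 a' w w'.
have gZ' a' (w w' : 'rV[B]_n) : \sum_l (a' *: w + w') 0 l *: g' l =
    a' *: (\sum_l w 0 l *: g' l) + \sum_l w' 0 l *: g' l by exact: gl'.1 a' w w'.
have RL (t : B) u u' v v' : R u v -> R u' v' -> R (t *: u + u') (t *: v + v').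
  by move=> [w [-> ->]] [w' [-> ->]]; exists (t *: w + w'); rewrite gZ gZ'.
have RC j u v : R u v -> R (comp j u) (comp j v).
  move=> [w [-> ->]]; exists (gfree_comp (tnth d) j w).
  by split; [rewrite -(glinC gl) | rewrite -(glinC gl')].
have R0 : R 0 0.
  by exists 0; split; rewrite big1 // => l _; rewrite mxE scale0r.
have R1 u : R u 0 -> u = 0 by move=> [w [-> /esym /gker' /gker]].
have R2 v : R 0 v -> v = 0 by move=> [w [/esym /gker h0 ->]]; apply/gker'.
move=> Ma; rewrite -[a]addn0.
apply: (@has_dim_exact _ B M M' qnull R (fun _ w => w = 0) (hom i) (hom i) (hom i)) => //.
- exact: hom_ksubspace.
- by move=> t; exact: RL.
- by move=> t _ _ w w' -> ->; rewrite scaler0 addr0.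
- move=> u ui; have [w uE] := gspan u.
  exists (comp i (\sum_l w 0 l *: g' l)); first exact: compK.
  by rewrite -ui; apply: RC; exists w.
- by move=> v _; exists 0 => //; exact: comp0.
- exact: hom_ksubspace.
- exact: hom_ksubspace.
- by move=> v _ /R2.
- by move=> u _ /R1.
- move=> v vi _; have [w vE] := gspan' v.
  exists (comp i (\sum_l w 0 l *: g l)); first exact: compK.
  by rewrite -vi; apply: RC; exists w.
- by move=> w _; exists 0; [exact: comp0 | exact: qnull0].
exists (fun=> 0); split=> [[]//|z _|c _ []//].
by exists (fun=> 0); rewrite big_ord0; exact: qnull0.
Qed.

Lemma index_type (p : K0_index B) : exists ds,
  presentation_class p = \sum_(s <- ds) line_class s /\
  forall X, presents X (val p) -> eventual_dim X (fun i => \sum_(s <- ds) h (s + i))%N.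
Proof.
have /asboolP[M Mp] := valP p.
have [ds [cE [n nP]]] := type_exists (QGr (ex_intro _ _ Mp)).
exists ds; rewrite -cE -(@presentation_classE (QGr (ex_intro _ _ Mp))) //; split=> // X Xp.
by exists n => i /nP; exact: presents_dim Mp Xp.
Qed.

(** x ^ i is a nonzero element of degree i. *)
Lemma hilbert_gt0 (i : nat) : (0 < h i)%N.
Proof.
rewrite lt0n; apply/eqP => h0; have [e [_ espan _]] := hP i.
move: e espan; rewrite h0 => e espan.
have [|c] := espan (x ^+ i); first exact: acomp_xX Bxy i.
rewrite big_ord0; elim: i {h0 e espan c} => [/eqP|i IHi]; first by rewrite oner_eq0.
rewrite exprS => xi0; apply: IHi.
have := xy_unique Bxy (n := 1%N) (f := fun=> x ^+ i) (b := 0).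
by rewrite big_ord1 mulr0 addr0 mul1r => /(_ xi0 0%N); apply.
Qed.

End Classes.

(** * Combinations of twists with nonnegative value *)

Section Windows.
Variables (r : nat) (A : zmodType) (o : int -> A).
Hypothesis oE : forall n, o n = \sum_(j < r.+1) o (n - j.+1%:Z).
Implicit Types (u : nat -> int) (m : int).

Definition shift_window u : nat -> int :=
  fun l => if (l < r)%N then u l.+1 else \sum_(j < r.+1) u j.

(** For l <= r these classes span the same subgroup as o (m - 1), ..., o (m - r - 1), and
    passing from m to m - 1 acts on coordinates by the integral matrix [shift_window]. *)
Definition partial_class m (l : nat) : A := \sum_(j < l.+1) o (m - j.+1%:Z).

Definition window_class m u : A := \sum_(l < r.+1) partial_class m l *~ u l.

Lemma partial_class0 m : partial_class m 0 = o (m - 1).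
Proof. by rewrite /partial_class big_ord1. Qed.

Lemma partial_classS m l :
  partial_class m l.+1 = o (m - 1) + partial_class (m - 1) l.
Proof.
rewrite /partial_class big_ord_recl; congr (_ + _).
by apply: eq_bigr => j _; congr o; rewrite /bump /= -addrA; congr (_ + _); lia.
Qed.

Lemma partial_class_full m : partial_class m r = o m.
Proof. by rewrite oE. Qed.

Lemma window_class_shift m u :
  window_class m u = window_class (m - 1) (shift_window u).
Proof.
rewrite /window_class [RHS]big_ord_recr /= {2}/shift_window ltnn.
rewrite partial_class_full [in RHS]big_ord_recl mulrzDr addrCA big_ord_recl /=.
rewrite partial_class0; congr (_ + _).
rewrite mulrz_sumr -big_split /=; apply: eq_bigr => l _.
by rewrite /shift_window ltn_ord partial_classS mulrzDl addrC.
Qed.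

Lemma window_class_iter n m u :
  window_class m u = window_class (m - n%:Z) (iter n shift_window u).
Proof.
elim: n m u => [|n IHn] m u; first by rewrite subr0.
by rewrite window_class_shift IHn iterSr; congr window_class; lia.
Qed.

Lemma window_classD m u v :
  window_class m u + window_class m v = window_class m (fun l => u l + v l).
Proof. by rewrite -big_split /=; apply: eq_bigr => l _; rewrite -mulrzDr. Qed.

Lemma window_class_add m u m' u' :
  exists n v, window_class m u + window_class m' u' = window_class n v.
Proof.
have aux a b w w' : b <= a ->
    exists n v, window_class a w + window_class b w' = window_class n v.
  move=> ba; exists b; rewrite (window_class_iter `|a - b|%N a).
  rewrite (_ : a - _ = b); last by lia.
  by rewrite window_classD; eexists.
case/orP: (le_total m m') => mm'; last exact: aux.
by rewrite addrC; exact: aux.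
Qed.

Lemma window_class_gen (s : seq (int * int)) :
  exists m u, \sum_(p <- s) o p.1 *~ p.2 = window_class m u.
Proof.
elim: s => [|[n c] s [m [u IH]]].
  exists 0, (fun=> 0); by rewrite big_nil /window_class big1.
rewrite big_cons IH /=.
have -> : o n *~ c = window_class n (fun l => if l == r then c else 0).
  rewrite /window_class big_ord_recr /= eqxx partial_class_full big1 ?add0r //.
  by move=> l _; rewrite (ltn_eqF (ltn_ord l)).
exact: window_class_add.
Qed.

Lemma window_class_ge0 m u : (forall l, (l <= r)%N -> 0 <= u l) ->
  exists d : seq int, window_class m u = \sum_(s <- d) o s.
Proof.
move=> u0; pose nn (a : A) := exists d : seq int, a = \sum_(s <- d) o s.
have nnD a b : nn a -> nn b -> nn (a + b).
  by move=> [d ->] [e ->]; exists (d ++ e); rewrite big_cat.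
have nn0 : nn 0 by exists [::]; rewrite big_nil.
have nno n : nn (o n) by exists [:: n]; rewrite big_seq1.
suff : nn (window_class m u) by [].
rewrite /window_class; apply: (big_ind nn) => // l _.
have nnp : nn (partial_class m l) by apply: (big_ind nn).
have := u0 l (ltn_ord l); case: (u l) => // n _.
rewrite -pmulrn; elim: n => [|n IHn]; first by rewrite mulr0n.
by rewrite mulrS; exact: nnD.
Qed.

Variables (R : realFieldType) (alpha : R) (rho : {additive A -> R}).
Hypothesis alpha_ge1 : 1 <= alpha.
Hypothesis rho_o : forall n, rho (o n) = alpha ^ n.

Let alpha_gt0 : 0 < alpha. Proof. exact: lt_le_trans ltr01 alpha_ge1. Qed.
Let alphaN0 : alpha != 0. Proof. by rewrite gt_eqF. Qed.

(** The value of [partial_class 0 l]; up to scaling, the left eigenvector of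
    [shift_window] for the eigenvalue alpha. *)
Definition weight (l : nat) : R := \sum_(j < l.+1) alpha ^- j.+1.
Definition window_value u : R := \sum_(l < r.+1) weight l * (u l)%:~R.

Lemma weight_gt0 l : 0 < weight l.
Proof.
rewrite /weight big_ord_recl ltr_pwDl ?invr_gt0 ?exprn_gt0 //.
by apply: sumr_ge0 => j _; rewrite invr_ge0 exprn_ge0 // ltW.
Qed.

Lemma weight_geometric l : (alpha - 1) * weight l + alpha ^- l.+1 = 1.
Proof.
elim: l => [|l IHl]; first by rewrite /weight big_ord1 expr1 mulrBl mul1r subrK divff.
rewrite /weight big_ord_recr -/(weight l) mulrDr -addrA -[RHS]IHl; congr (_ + _).
rewrite mulrBl mul1r subrK exprS invfM.
by rewrite /= mulVKf.
Qed.

Lemma rho_window_class m u : rho (window_class m u) = alpha ^ m * window_value u.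
Proof.
rewrite raddf_sum mulr_sumr; apply: eq_bigr => l _.
rewrite raddfMz /= raddf_sum mulrA -mulrzr; congr (_ * _).
rewrite mulr_sumr; apply: eq_bigr => j _; rewrite rho_o expfzDr //.
Qed.

Lemma window_value_shift u : window_value (shift_window u) = alpha * window_value u.
Proof.
have := rho_window_class 0 u.
rewrite window_class_shift rho_window_class expr0z mul1r sub0r => <-.
by rewrite exprN1 mulVKf.
Qed.

(** The entry that [shift_window] appends is a weighted mean of the window, by
    [sum_alphaV], plus a nonnegative multiple of its value. *)
Lemma window_sum u : (\sum_(l < r.+1) u l)%:~R =
  (alpha - 1) * window_value u + \sum_(l < r.+1) alpha ^- l.+1 * (u l)%:~R.
Proof.
rewrite rmorph_sum mulr_sumr -big_split; apply: eq_bigr => l _ /=.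
by rewrite mulrA -mulrDl weight_geometric mul1r.
Qed.

Lemma sum_alphaV : \sum_(l < r.+1) alpha ^- l.+1 = 1.
Proof.
have := congr1 rho (oE 0); rewrite rho_o expr0z raddf_sum => ->.
by apply: eq_bigr => j _; rewrite rho_o sub0r -exprnN.
Qed.

(** By [window_sum], a sum <= - K - 1 leaves no room above the lower bound of the u_l: they
    all equal - K - 1, and such a window has negative value. *)
Lemma window_sum_gt (K : nat) u : (forall l, (l <= r)%N -> - K.+1%:Z <= u l) ->
  0 <= window_value u -> - K%:Z <= \sum_(l < r.+1) u l.
Proof.
move=> uK u0; rewrite leNgt; apply/negP => sK.
pose v (l : 'I_r.+1) : R := (u l)%:~R + K.+1%:R.
have v0 l : 0 <= v l.
  rewrite /v -[_%:R]/(K.+1%:Z%:~R) -intrD (ler_int _ 0).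
  have := uK l (ltn_ord l); lia.
have s0 : (alpha - 1) * window_value u + \sum_(l < r.+1) alpha ^- l.+1 * v l <= 0.
  rewrite /v; under eq_bigr do rewrite mulrDr.
  rewrite big_split /= addrA -window_sum -mulr_suml sum_alphaV mul1r.
  rewrite -[_%:R]/(K.+1%:Z%:~R) -intrD (ler_int _ _ 0); lia.
have a0 (l : nat) : 0 < alpha ^- l.+1 by rewrite invr_gt0 exprn_gt0.
have v00 l : v l = 0.
  have t0 : \sum_(l < r.+1) alpha ^- l.+1 * v l <= 0.
    by apply: le_trans s0; rewrite lerDr mulr_ge0 // subr_ge0.
  have av0 (i : 'I_r.+1) : true -> 0 <= alpha ^- i.+1 * v i.
    by rewrite mulr_ge0 // ltW.
  have t00 : \sum_(l < r.+1) alpha ^- l.+1 * v l = 0.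
    by apply/le_anti; rewrite t0 sumr_ge0.
  have /eqP := psumr_eq0P av0 t00 (i := l) isT.
  by rewrite mulf_eq0 gt_eqF //= => /eqP.
suff : window_value u < 0 by rewrite ltNge u0.
have -> : window_value u = - \sum_(l < r.+1) weight l * K.+1%:R.
  rewrite -sumrN; apply: eq_bigr => l _; rewrite -mulrN; congr (_ * _).
  by apply/eqP; rewrite -subr_eq0 opprK; apply/eqP; exact: v00.
rewrite oppr_lt0 big_ord_recl ltr_pwDl ?mulr_gt0 ?weight_gt0 //.
by apply: sumr_ge0 => l _; rewrite mulr_ge0 // ltW // weight_gt0.
Qed.

(** After j shifts the last j entries have been appended, hence are >= - K. *)
Lemma window_raise (K : nat) u : (forall l, (l <= r)%N -> - K.+1%:Z <= u l) ->
    0 <= window_value u ->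
  exists n, let v := iter n shift_window u in
    (forall l, (l <= r)%N -> - K%:Z <= v l) /\ 0 <= window_value v.
Proof.
move=> uK u0; exists r.+1.
pose inv j v := [/\ forall l, (l <= r)%N -> - K.+1%:Z <= v l,
  forall l, (l <= r)%N -> (r < l + j)%N -> - K%:Z <= v l & 0 <= window_value v].
suff /(_ r.+1)[_ vK v0] : forall j, inv j (iter j shift_window u).
  by split=> // l lr; apply: vK; rewrite // addnS ltnS leq_addl.
elim=> [|j [vK vj v0]].
  by split=> // l lr; rewrite addn0 ltnNge lr.
set v := iter j _ _ in vK vj v0 *; have sK := window_sum_gt vK v0.
rewrite iterS -/v; split=> [l lr|l lr lj|].
- rewrite /shift_window; case: ifP => [?|_]; first exact: vK.
  by apply: le_trans sK; lia.
- rewrite /shift_window; case: ifP => [?|_] //.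
  by apply: vj => //; rewrite addSnnS.
- by rewrite window_value_shift mulr_ge0 // ltW.
Qed.

Lemma window_eventually_ge0 u : 0 <= window_value u ->
  exists n, forall l, (l <= r)%N -> 0 <= iter n shift_window u l.
Proof.
have [K] : exists K : nat, forall l, (l <= r)%N -> - K%:Z <= u l.
  exists (\sum_(l < r.+1) `|u l|%N)%N => l lr.
  have : (`|u l| <= \sum_(l < r.+1) `|u l|)%N.
    by rewrite (bigD1 (Ordinal (lr : (l < r.+1)%N))) //= leq_addr.
  lia.
elim: K u => [|K IHK] u uK u0; first by exists 0.
have [n [vK v0]] := window_raise uK u0.
have [n' ?] := IHK _ vK v0.
by exists (n' + n)%N; rewrite iterD.
Qed.

(** The values of a class and of its window have the same sign. *)
Lemma nonneg_value_is_sum (s : seq (int * int)) (a : A) :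
    a = \sum_(p <- s) o p.1 *~ p.2 -> 0 <= rho a ->
  exists d : seq int, a = \sum_(n <- d) o n.
Proof.
have [m [u ->]] := window_class_gen s => ->.
rewrite rho_window_class pmulr_rge0 ?exprz_gt0 // => u0.
have [n v0] := window_eventually_ge0 u0.
rewrite (window_class_iter n); exact: window_class_ge0.
Qed.

End Windows.

(** * The value of a class *)

Section AdditiveKernel.
Variables (U V : zmodType) (f : {additive U -> V}).

Definition additive_kernel : {pred U} := fun a => f a == 0.

Lemma additive_kernelE a : (a \in additive_kernel) = (f a == 0).
Proof. by []. Qed.

Lemma additive_kernel_zmod : zmod_closed additive_kernel.
Proof.
split=> [|a b /eqP a0 /eqP b0]; rewrite additive_kernelE; first by rewrite raddf0.
by rewrite raddfB a0 b0 subrr.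
Qed.

HB.instance Definition _ :=
  GRing.isZmodClosed.Build U additive_kernel additive_kernel_zmod.

End AdditiveKernel.

Section Root.
Variables (R : realFieldType) (alpha : R) (r : nat).
Hypothesis alpha_gt0 : 0 < alpha.
Hypothesis alpha_root : root ('X^(r.+1) - \sum_(i < r.+1) 'X^i) alpha.

Lemma root_powers : alpha ^+ r.+1 = \sum_(i < r.+1) alpha ^+ i.
Proof.
move: alpha_root; rewrite rootE !hornerE horner_sum subr_eq0 => /eqP ->.
by apply: eq_bigr => i _; rewrite hornerXn.
Qed.

Lemma root_recurrence (n : int) : alpha ^ n = \sum_(j < r.+1) alpha ^ (n - j.+1%:Z).
Proof.
have a0 : alpha != 0 by rewrite gt_eqF.
rewrite -{1}(subrK r.+1%:Z n) expfzDr // -exprnP root_powers mulr_sumr.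
rewrite (reindex_inj rev_ord_inj) /=; apply: eq_bigr => j _.
rewrite exprnP -expfzDr //; congr (_ ^ _).
by have := ltn_ord j; lia.
Qed.

Lemma root_ge1 : 1 <= alpha.
Proof.
rewrite leNgt; apply/negP => a1.
have : alpha ^+ r.+1 < 1 by rewrite exprn_ilt1 // ltW.
rewrite root_powers big_ord_recl expr0 ltNge lerDl sumr_ge0 // => i _.
by rewrite exprn_ge0 // ltW.
Qed.

(** alpha = 1 + alpha^-1 + ... + alpha^-r, and alpha^-1 = alpha^r - alpha^(r-1) - ... - 1. *)
Lemma int_adjoin_inv : int_adjoin alpha = int_adjoin alpha^-1.
Proof.
have closed (z t : R) : (exists p : {poly int}, (map_poly intr p).[t] = z) ->
    int_adjoin z `<=` int_adjoin t.
  move=> [q qz] _ [p _ <-]; exists (p \Po q) => //.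
  by rewrite map_comp_poly horner_comp qz.
have a0 : alpha != 0 by rewrite gt_eqF.
apply/seteqP; split; apply: closed.
  exists (\sum_(i < r.+1) 'X^i).
  rewrite rmorph_sum horner_sum.
  apply: (mulIf (expf_neq0 r a0)); rewrite -exprS root_powers mulr_suml.
  rewrite (reindex_inj rev_ord_inj) /=; apply: eq_bigr => i _.
  rewrite map_polyXn hornerXn exprVn subSS.
  apply: (mulfI (expf_neq0 (r - i) a0)); rewrite mulVKf ?expf_neq0 //.
  by rewrite -exprD subnK // leq_ord.
exists ('X^r - \sum_(i < r) 'X^i).
rewrite rmorphB rmorph_sum hornerD hornerN horner_sum /= map_polyXn hornerXn.
apply: (mulIf a0); rewrite mulVf // mulrBl -exprSr root_powers mulr_suml big_ord_recl.
rewrite expr0 -addrA [X in _ + X](_ : _ = 0) ?addr0 //; apply/eqP; rewrite subr_eq0.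
by apply/eqP/eq_bigr => i _; rewrite map_polyXn hornerXn -exprSr.
Qed.

Lemma int_adjoin_lin u v (c : int) :
  int_adjoin alpha u -> int_adjoin alpha v -> int_adjoin alpha (u *~ c + v).
Proof.
move=> [p _ <-] [q _ <-]; exists (c%:P * p + q) => //.
by rewrite rmorphD rmorphM /= map_polyC hornerD hornerM hornerC mulrzl.
Qed.

Lemma int_adjoin_exp (n : int) : int_adjoin alpha (alpha ^ n).
Proof.
case: n => n; first by exists 'X^n; rewrite // map_polyXn hornerXn.
rewrite int_adjoin_inv NegzE -exprnN -exprVn.
by exists 'X^(n.+1); rewrite // map_polyXn hornerXn.
Qed.

End Root.

Section Rank.
Variables (k : fieldType) (B : gradedAlg k) (x y : B) (r : nat).
Hypothesis Bxy : xy_monomial x y r.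
Variables (R : realFieldType) (alpha : R).
Hypothesis alpha_gt0 : 0 < alpha.
Hypothesis alpha_root : root ('X^(r.+1) - \sum_(i < r.+1) 'X^i) alpha.
Variable h : int -> nat.
Hypothesis hP : forall i, has_dim (@hom _ B (gfree1 B) i) (h i).

Let a0 : alpha != 0. Proof. by rewrite gt_eqF. Qed.

Definition hilbert_window (i : int) : R := window_value r alpha (fun l : nat => (h (i + l%:Z))%:Z).

Lemma hilbert_window_growth : exists n : int, forall i : int, n <= i ->
  hilbert_window (i + 1) = alpha * hilbert_window i.
Proof.
have [_ [m mP]] := line_type Bxy hP 0; exists m => i mi.
have oE (n : int) : alpha ^ n = \sum_(j < r.+1) alpha ^ (n - j.+1%:Z).
  exact: root_recurrence alpha_gt0 alpha_root n.
rewrite /hilbert_window -(@window_value_shift r R (fun n => alpha ^ n) oE R alpha idfun) //;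
  last exact: root_ge1 alpha_gt0 alpha_root.
apply: eq_bigr => l _; congr (_ * _%:~R); rewrite /shift_window.
case: ltnP => lr; first by congr Posz; congr h; lia.
have -> : nat_of_ord l = r by apply/eqP; rewrite eqn_leq lr -ltnS ltn_ord.
have := mP (i + 1 + r%:Z); rewrite add0r => -> //; last by lia.
rewrite (big_morph Posz PoszD erefl) (reindex_inj rev_ord_inj) /=.
apply: eq_bigr => j _; congr Posz; congr h.
by have := ltn_ord j; lia.
Qed.

Lemma hilbert_window_pos i : 0 <= i -> 0 < hilbert_window i.
Proof.
move=> i0; rewrite /hilbert_window /window_value big_ord_recl ltr_pwDl //.
  rewrite mulr_gt0 ?weight_gt0 ?(root_ge1 alpha_gt0 alpha_root) // ltr0n.
  by rewrite addr0 -(gez0_abs i0) (hilbert_gt0 Bxy hP).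
apply: sumr_ge0 => l _; rewrite mulr_ge0 ?ler0n //.
by rewrite ltW // weight_gt0 // (root_ge1 alpha_gt0 alpha_root).
Qed.

Definition type_value (ds : seq int) : R := \sum_(s <- ds) alpha ^ s.

(** The window at i of the sum of the h(s + i) has value (sum of the alpha ^ s) times the
    value of the window of h at i, which is positive. *)
Lemma type_value_eq ds ds' :
    (exists n : int, forall i : int, n <= i ->
       (\sum_(s <- ds) h (s + i) = \sum_(s <- ds') h (s + i))%N) ->
  type_value ds = type_value ds'.
Proof.
move=> [n nP]; have [m0 growth] := hilbert_window_growth; pose m : int := `|m0|.
have powers (j : nat) : hilbert_window (m + j%:Z) = alpha ^+ j * hilbert_window m.
  elim: j => [|j IHj]; first by rewrite addr0 mul1r.
  by rewrite exprS -mulrA -IHj -growth; [congr hilbert_window; lia | rewrite /m; lia].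
(* In degree i, all the shifted windows lie where [nP] and [growth] apply. *)
pose T : int := \sum_(s <- ds ++ ds') `|s|; pose i : int := `|n| + m + T.
have bound s : s \in ds ++ ds' -> `|s| <= T.
  by move=> sd; rewrite /T (big_rem s) //= lerDl; apply: sumr_ge0.
have window (es : seq int) : {subset es <= ds ++ ds'} ->
    window_value r alpha (fun l : nat => (\sum_(s <- es) h (s + (i + l%:Z)))%N%:Z) =
    type_value es * (alpha ^ (i - m) * hilbert_window m).
  move=> esd; rewrite /window_value /type_value mulr_suml.
  under eq_bigr do rewrite (big_morph Posz PoszD erefl) rmorph_sum mulr_sumr.
  rewrite exchange_big /= [LHS]big_seq [RHS]big_seq; apply: eq_bigr => s /esd /bound sT.
  rewrite mulrA -expfzDr //.
  have -> : s + (i - m) = absz (s + (i - m)) by rewrite gez0_abs // /i; lia.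
  rewrite -powers; apply: eq_bigr => l _; congr (_ * _%:~R); congr Posz; congr h.
  by rewrite /i; lia.
apply: (@mulIf _ (alpha ^ (i - m) * hilbert_window m)).
  by rewrite mulf_neq0 ?expfz_neq0 // gt_eqF // hilbert_window_pos // /m.
rewrite -!window => [|s|s]; try by rewrite mem_cat => ->; rewrite ?orbT.
apply: eq_bigr => l _; congr (_ * _%:~R); congr Posz; apply: nP.
have T0 : 0 <= T by apply: sumr_ge0.
by rewrite /i /m; lia.
Qed.

(** Send a presentation to the value of a type of the module.  Types are unique only up
    to [type_value_eq]; the same lemma, applied to the concatenation of the types of the
    outer terms, gives additivity on exact sequences. *)
Lemma K0_rank_exists : exists phi : {additive K0 B -> R},
  forall X ds, eventual_dim X (fun i => \sum_(s <- ds) h (s + i))%N ->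
  phi (K0_class X) = type_value ds.
Proof.
have /choice[ty tyP] := index_type Bxy hP.
pose v p := type_value (ty p).
have [Phi PhiU] : exists Phi : {additive {malg int[K0_index B]} -> R},
    forall p, Phi << p >> = v p.
  by exists (mmap intr v) => p; rewrite /= mmapU mul1r.
have rel_ker b : K0_relation b -> b \in additive_kernel Phi.
  move=> [X [Y [Z [f [g [p [q [s [fg [Xp Yq Zs] ->]]]]]]]]].
  rewrite additive_kernelE raddfB raddfD.
  have -> : Phi << q >> - (Phi << p >> + Phi << s >>) = v q - (v p + v s) by congr (_ - (_ + _)).
  rewrite subr_eq0; apply/eqP.
  rewrite /v /type_value -big_cat; apply: type_value_eq.
  have := eventual_dim_exact Bxy fg ((tyP p).2 X Xp) ((tyP s).2 Z Zs).
  move=> /(eventual_dim_uniq ((tyP q).2 Y Yq))[n nP]; exists n => i /nP ->.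
  by rewrite big_cat.
have null_ker b : b \in K0_null (k := k) (A := B) -> Phi b = 0.
  by move=> /asboolP bN; apply/eqP; exact: bN (additive_kernel Phi) rel_ker.
pose phi (a : K0 B) : R := Phi (repr a).
have phi_pi b : phi (\pi_(K0 B)%qT b) = Phi b.
  apply/eqP; rewrite -subr_eq0 -raddfB; apply/eqP/null_ker.
  have : \pi_(K0 B)%qT (repr (\pi_(K0 B)%qT b)) == \pi_(K0 B)%qT b by rewrite reprK.
  by rewrite -Quotient.idealrBE.
have phiB : zmod_morphism phi.
  by move=> a b; rewrite -[a]reprK -[b]reprK -raddfB !phi_pi raddfB.
pose phiM := GRing.isZmodMorphism.Build _ _ phi phiB.
pose phiA : {additive K0 B -> R} := HB.pack phi phiM.
exists phiA => X ds Xds; rewrite /= /K0_class.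
case: (qgr_index X) => p Xp /=; rewrite phi_pi PhiU.
exact/type_value_eq/(eventual_dim_uniq ((tyP p).2 X Xp) Xds).
Qed.

End Rank.

Lemma K0_generated (k : fieldType) (B : gradedAlg k) (x y : B) (r : nat) :
  xy_monomial x y r -> forall a : K0 B, exists s : seq (int * int),
    a = \sum_(p <- s) line_class B p.1 *~ p.2.
Proof.
move=> Bxy a; have [h hP] := hilbert_exists Bxy.
pose gen (a : K0 B) := exists s : seq (int * int), a = \sum_(p <- s) line_class B p.1 *~ p.2.
have gen0 : gen 0 by exists [::]; rewrite big_nil.
have genD b c : gen b -> gen c -> gen (b + c).
  by move=> [s ->] [t ->]; exists (s ++ t); rewrite big_cat.
rewrite -[a]reprK (monalgE (repr a)) raddf_sum /=; apply: (big_ind gen) => // p _.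
have [ds [cE _]] := index_type Bxy hP p.
have -> : << (repr a)@_p *g p >> = << p >> *~ (repr a)@_p.
  by rewrite -[X in << X *g _ >>]intz raddfMz.
rewrite raddfMz /=; rewrite /presentation_class in cE; rewrite cE mulrz_suml.
by exists [seq (s, (repr a)@_p) | s <- ds]; rewrite big_map.
Qed.

Theorem theorem7p10 (k : fieldType) (r : nat) (R : realType) (alpha : R)
    (r_ge1 : (1 <= r)%N) (alpha_gt0 : 0 < alpha)
    (alpha_root : root ('X^(r.+1) - \sum_(i < r.+1) 'X^i) alpha) :
  let B := xy_alg k r in
  let O := structure_sheaf B in
  exists phi : {additive K0 B -> R},
    [/\ injective phi,
        phi (K0_class O) = 1,
        (forall n : int, phi (K0_class (twist O n)) = alpha ^ n)
      & range phi = int_adjoin alpha]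
    /\
    phi @` positive_cone B = [set z | 0 <= z] `&` int_adjoin alpha
    /\
    [set z | 0 <= z] `&` int_adjoin alpha
      = int_adjoin alpha^-1 `&` [set z | 0 <= z].
Proof.
move=> B O; have Bxy := xy_alg_monomial k r.
have [h hP] := hilbert_exists Bxy.
have [phi phiE] := K0_rank_exists Bxy alpha_gt0 alpha_root hP.
have phi_line n : phi (line_class B n) = alpha ^ n.
  rewrite (phiE _ [:: n]) /type_value ?big_seq1 //.
  have [m mP] := line_dim hP n; exists m => i /mP.
  by rewrite big_seq1.
have nonneg (a : K0 B) : 0 <= phi a ->
    exists ds : seq int, a = \sum_(s <- ds) line_class B s.
  have [s aE] := K0_generated Bxy a.
  have lineE n := (line_type Bxy hP n).1.
  exact: (nonneg_value_is_sum lineE (root_ge1 alpha_gt0 alpha_root) phi_line aE).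
have value (ds : seq int) : phi (\sum_(s <- ds) line_class B s) = \sum_(s <- ds) alpha ^ s.
  by rewrite raddf_sum; apply: eq_bigr => s _.
have phi_adjoin a : int_adjoin alpha (phi a).
  have [s ->] := K0_generated Bxy a; elim: s => [|[n c] s IHs].
    by rewrite big_nil raddf0; exists 0; rewrite // rmorph0 horner0.
  rewrite big_cons raddfD raddfMz /= phi_line; apply: int_adjoin_lin IHs.
  exact: int_adjoin_exp alpha_gt0 alpha_root n.
have adjoin_phi z : int_adjoin alpha z -> exists a, phi a = z.
  move=> [p _ <-]; exists (\sum_(i < size p) line_class B i *~ p`_i).
  rewrite raddf_sum horner_coef size_map_inj_poly //; last exact: intr_inj.
  apply: eq_bigr => i _.
  by rewrite raddfMz /= phi_line coef_map mulrC mulrzr.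
exists phi; split; [split|split].
- apply: raddf_inj => a a0; have [|ds aE] := nonneg a; first by rewrite a0.
  have := value ds; rewrite -aE a0; case: ds aE => [aE _|s ds _]; first by rewrite aE big_nil.
  move=> /eqP; rewrite eq_sym big_cons gt_eqF // ltr_pwDl ?exprz_gt0 //.
  by apply: sumr_ge0 => i _; rewrite exprz_ge0 // ltW.
- rewrite (phiE _ [:: 0]) /type_value ?big_seq1 ?expr0z //.
  by exists 0 => i _; rewrite big_seq1 add0r; exact: hP.
- exact: phi_line.
- apply/seteqP; split=> [_ [a _ <-]|z /adjoin_phi[a <-]]; first exact: phi_adjoin.
  by exists a.
- apply/seteqP; split=> [_ [_ [X ->] <-]|z [z0 /adjoin_phi[a az]]].
    split; last exact: phi_adjoin.
    have [ds [-> _]] := type_exists Bxy hP X; rewrite /= value.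
    by apply: sumr_ge0 => i _; rewrite exprz_ge0 // ltW.
  have [|ds aE] := nonneg a; first by rewrite az.
  exists a => //; exists (@qfree k B (size ds) (fun l => - ds`_l)).
  rewrite (K0_class_free Bxy) aE (big_nth 0) big_mkord.
  by apply: eq_bigr => l _; rewrite opprK.
by rewrite setIC (int_adjoin_inv alpha_gt0 alpha_root).
Qed.
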